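(* Let $a_1>a_2>0$ with $a_1+a_2=1$, $B_1>0$, $\bar\gamma>0$, $R_1>0$ and $\gamma_1^{\mathrm{th}}=2^{R_1}-1$. Let $h_1=h_{l1}h_sh_{g1}$ be the end-to-end channel coefficient of receiver Rx1 (model in the context), and let $$\gamma_1=\frac{a_1B_1\bar\gamma h_1^2}{a_2B_1\bar\gamma h_1^2+1}$$ be its signal-to-interference-plus-noise ratio. Then the outage probability $P_1^o=\mathbb P(\gamma_1<\gamma_1^{\mathrm{th}})$ of Rx1 is $$P_1^o=\begin{cases}F_{h_1}\left(\sqrt{\dfrac{\gamma_1^{\mathrm{th}}}{a_1B_1\bar\gamma-a_2B_1\bar\gamma\gamma_1^{\mathrm{th}}}}\right), & \dfrac{a_1}{a_2}>\gamma_1^{\mathrm{th}},\\[2ex] 1, & \dfrac{a_1}{a_2}\le\gamma_1^{\mathrm{th}},\end{cases}$$ where $F_{h_1}$ is the cumulative distribution function of $h_1$, given for $x>0$ by $$F_{h_1}(x)=\frac{\omega}{\Gamma(\alpha)\Gamma(\beta)}\sum_{k=0}^{\infty}\binom{2k}{k}\left(\frac{v}{2}\right)^{2k} G_{2k+2,\,2k+4}^{2k+3,\,1}\left(\frac{\alpha\beta\, x}{A_0 h_{l1}}\,\Bigg|\,\begin{array}{c}1,\ \{c+1\}_1^{2k+1}\\ \alpha,\ \beta,\ \{c\}_1^{2k+1},\ 0\end{array}\right),$$ with $c=\frac{(1+q^2)\omega}{2q}$, $v=\frac{(1-q^2)\omega}{2q}$, and $\omega,q,A_0$ the pointing-error parameters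 of Rx1.
   Context: System. A transmitter serves two receivers Rx1, Rx2 through an optical reconfigurable intelligent surface using power-domain non-orthogonal multiple access: $a_1,a_2$ are the power allocation coefficients of the two messages, $B_1$ is the beam-splitting factor toward Rx1, $\bar\gamma$ is the transmit signal-to-noise ratio, and $R_1$ is the target rate of Rx1. Rx1 decodes its own message treating the other as noise; an outage occurs when $\gamma_1<\gamma_1^{\mathrm{th}}$. Channel model for Rx1. $h_1=h_{l1}h_sh_{g1}$, with $h_s$, $h_{g1}$ independent and the following factors. (i) Atmospheric loss: $h_{l1}>0$ is a deterministic constant. (ii) Atmospheric turbulence: $h_s>0$ has the Gamma-Gamma density $$f_{h_s}(x)=\frac{2(\alpha\beta)^{\frac{\alpha+\beta}{2}}}{\Gamma(\alpha)\Gamma(\beta)}x^{\frac{\alpha+\beta}{2}-1}K_{\alpha-\beta}\left(2\sqrt{\alpha\beta x}\right),\quad x>0,$$ where $K_\nu$ is the modified Bessel function of the second kind, and $\alpha,\beta>0$ are given in terms of the Rytov variance $\sigma_R^2>0$ by $\alpha=\left[\exp\left(\frac{0.49\sigma_R^2}{(1+1.11\sigma_R^{12/5})^{7/6}}\right)-1\right]^{-1}$ and $\beta=\left[\exp\left(\frac{0.51\sigma_R^2}{(1+0.69\sigma_R^{12/5})^{5/6}}\right)-1\right]^{-1}$. (iii) Pointing errors: $h_{g1}\in[0,A_0]$ has density $$f_{h_{g1}}(x)=\frac{\omega}{A_0}\left(\frac{x}{A_0}\right)^{\frac{(1+q^2)\omega}{2q}-1} I_0\left(-\frac{(1-q^2)\omega}{2q}\ln\frac{x}{A_0}\right),\quad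 0< x\le A_0,$$ where $I_0$ is the modified Bessel function of the first kind of order zero and $A_0,\omega,q>0$ are parameters of Rx1. Notation. $\{p\}_1^{N}$ in a parameter list means that $p$ is repeated $N$ times. $G_{p,q}^{m,n}$ is the Meijer G-function $$G_{p,q}^{m,n}\left(z\,\Big|\,\begin{array}{c}a_1,\dots,a_p\\ b_1,\dots,b_q\end{array}\right)=\frac{1}{2\pi i}\int_{\mathcal L}\frac{\prod_{j=1}^m\Gamma(b_j-s)\prod_{j=1}^n\Gamma(1-a_j+s)}{\prod_{j=m+1}^q\Gamma(1-b_j+s)\prod_{j=n+1}^p\Gamma(a_j-s)}z^s\,ds,$$ where $\mathcal L$ is a line running from $\psi-i\infty$ to $\psi+i\infty$ that has the poles of all $\Gamma(b_j-s)$, $j\le m$, to its right and the poles of all $\Gamma(1-a_j+s)$, $j\le n$, to its left (empty products equal 1; the $a_j$, $b_j$, $p$, $q$ in this definition are unrelated to the power coefficients and the channel parameter $q$). The convention $0^0=1$ is used when $v=0$. *)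

(* Defs.v *)
From HB Require Import structures.
From mathcomp Require Import all_boot all_order all_algebra.
From mathcomp Require Import complex.
From mathcomp Require Import all_classical all_reals all_analysis.

Set Implicit Arguments.
Unset Strict Implicit.
Unset Printing Implicit Defensive.

Import Order.TTheory GRing.Theory Num.Theory.
Import numFieldNormedType.Exports.

Local Open Scope classical_set_scope.
Local Open Scope complex_scope.
Local Open Scope ring_scope.

Section complex_integral.
Context {R : realType}.
Let mu := @lebesgue_measure R.

Definition cintegrable (D : set R) (f : R -> R[i]) : Prop :=
  mu.-integrable D (EFin \o (fun t => complex.Re (f t))) /\
  mu.-integrable D (EFin \o (fun t => complex.Im (f t))).

Definition cintegral (D : set R) (f : R -> R[i]) : R[i] :=
  (Rintegral mu D (fun t => complex.Re (f t)))
    +i* (Rintegral mu D (fun t => complex.Im (f t))).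

End complex_integral.

Section special_functions.
Context {R : realType}.
Let mu := @lebesgue_measure R.

Definition cexp (z : R[i]) : R[i] :=
  (expR (complex.Re z))%:C * (cos (complex.Im z) +i* sin (complex.Im z)).

(* Meaningful for x > 0. *)
Definition cpow (x : R) (s : R[i]) : R[i] := cexp (s * (ln x)%:C).

(* Euler's integral; meaningful for x > 0. *)
Definition Gamma (x : R) : R :=
  Rintegral mu `]0, +oo[ (fun t => t `^ (x - 1) * expR (- t)).

Definition euler_integral (z : R[i]) : R[i] :=
  cintegral `]0, +oo[ (fun t => cpow t (z - 1) * (expR (- t))%:C).

Definition Gamma_shift (z : R[i]) : nat :=
  if 0 < complex.Re z then 0%N else (Num.truncn (- complex.Re z)).+1.

(* Euler's integral where it converges, extended to the left by
   Gamma(z) = Gamma(z + N) / (z (z + 1) ... (z + N - 1)) with N the least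
   natural number such that Re (z + N) > 0. At a pole the denominator vanishes,
   so that the value is 0; hence (cGamma z)^-1 is 0 there, which is the value
   of the entire function 1 / Gamma. *)
Definition cGamma (z : R[i]) : R[i] :=
  euler_integral (z + (Gamma_shift z)%:R)
    / \prod_(0 <= l < Gamma_shift z) (z + l%:R).

(* K_nu(x) = int_0^oo exp(- x cosh t) cosh(nu t) dt; meaningful for x > 0. *)
Definition cosh (t : R) : R := (expR t + expR (- t)) / 2.
Definition besselK (nu x : R) : R :=
  Rintegral mu `[0, +oo[ (fun t => expR (- x * cosh t) * cosh (nu * t)).

Definition besselI0 (x : R) : R :=
  limn (series (fun k : nat => (x / 2) ^+ (2 * k) / (k`!%:R) ^+ 2)).

End special_functions.

(* The Meijer G-function G^{m,n}_{p,q}(z | a ; b) at z > 0, with p = size a and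
   q = size b; the entries of a and b are numbered from 0. *)
Section meijerG.
Context {R : realType}.
Variables (m n : nat) (a b : seq R[i]) (z : R).

Definition meijer_integrand (s : R[i]) : R[i] :=
  ((\prod_(0 <= j < m) cGamma (b`_j - s))
     * (\prod_(0 <= j < n) cGamma (1 - a`_j + s)))
  / ((\prod_(m <= j < size b) cGamma (1 - b`_j + s))
     * (\prod_(n <= j < size a) cGamma (a`_j - s)))
  * cpow z s.

(* The vertical line Re s = psi has the poles of every Gamma(b_j - s), j < m, to
   its right and those of every Gamma(1 - a_j + s), j < n, to its left; the
   poles of Gamma are the numbers - l with l a natural number. *)
Definition separating_line (psi : R) : Prop :=
  (forall (j l : nat) (s : R[i]), (j < m)%N ->
     b`_j - s = - l%:R -> psi < complex.Re s) /\
  (forall (j l : nat) (s : R[i]), (j < n)%N ->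
     1 - a`_j + s = - l%:R -> complex.Re s < psi).

(* The integrand pulled back along t |-> psi + i t, with ds = i dt. *)
Definition meijer_on_line (psi t : R) : R[i] :=
  meijer_integrand (psi +i* t) * 'i%C.

Definition meijer_line_integral (psi : R) : R[i] :=
  ((2 * pi)%:C * 'i%C)^-1 * cintegral setT (meijer_on_line psi).

(* Evaluated on a chosen separating line; meijerG_wd below asserts that such a
   line exists and that the choice is irrelevant. *)
Definition meijerG : R[i] :=
  meijer_line_integral (xget 0 [set psi | separating_line psi]).

(* The contour integral exists (absolutely convergent) on every separating
   line, of which there is at least one, and does not depend on the line. *)
Definition meijerG_wd : Prop :=
  (exists psi, separating_line psi) /\
  (forall psi, separating_line psi ->
     cintegrable setT (meijer_on_line psi) /\
     meijer_line_integral psi = meijerG).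

End meijerG.

Section random_variables.
Context (d : measure_display) (T : measurableType d) (R : realType)
  (P : probability T R).

Definition independent_RVs (X Y : {RV P >-> R}) : Prop :=
  forall A B : set R, measurable A -> measurable B ->
    P (X @^-1` A `&` Y @^-1` B) = (P (X @^-1` A) * P (Y @^-1` B))%E.

(* The law of X has density f on D and no mass outside D: in particular X
   belongs to D almost surely. *)
Definition has_density_on (X : {RV P >-> R}) (D : set R) (f : R -> R) : Prop :=
  forall A : set R, measurable A ->
    distribution P X A
    = (\int[@lebesgue_measure R]_(x in (A `&` D)%classic) (f x)%:E)%E.

End random_variables.

Section channel.
Context {R : realType}.

Definition gg_alpha (sigma : R) : R :=
  (expR (49 / 100 * sigma ^+ 2
         / (1 + 111 / 100 * sigma `^ (12 / 5)) `^ (7 / 6)) - 1)^-1.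

Definition gg_beta (sigma : R) : R :=
  (expR (51 / 100 * sigma ^+ 2
         / (1 + 69 / 100 * sigma `^ (12 / 5)) `^ (5 / 6)) - 1)^-1.

Definition gamma_gamma_density (alpha beta x : R) : R :=
  2 * (alpha * beta) `^ ((alpha + beta) / 2) / (Gamma alpha * Gamma beta)
  * x `^ ((alpha + beta) / 2 - 1)
  * besselK (alpha - beta) (2 * Num.sqrt (alpha * beta * x)).

Definition pointing_error_density (A0 omega q x : R) : R :=
  omega / A0 * (x / A0) `^ ((1 + q ^+ 2) * omega / (2 * q) - 1)
  * besselI0 (- ((1 - q ^+ 2) * omega / (2 * q)) * ln (x / A0)).

Definition sinr1 (a1 a2 B1 snr h : R) : R :=
  a1 * B1 * snr * h ^+ 2 / (a2 * B1 * snr * h ^+ 2 + 1).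

End channel.

(* Main.v *)
Require Import Defs.
From HB Require Import structures.
From mathcomp Require Import all_boot all_order all_algebra.
From mathcomp Require Import complex ring lra.
From mathcomp Require Import all_classical all_reals all_analysis measurable_realfun.

Set Implicit Arguments.
Unset Strict Implicit.
Unset Printing Implicit Defensive.

Import Order.TTheory GRing.Theory Num.Theory.
Import numFieldNormedType.Exports.

Local Open Scope classical_set_scope.
Local Open Scope complex_scope.
Local Open Scope ring_scope.

(* In logarithmic variables the product channel becomes a sum. The Bessel kernel K
   makes ln (alpha beta hs) a sum of two independent log-Gamma variables, and the
   series of I_0, together with C(2k, k) / (2k)! = 1 / (k!)^2, makes the law of
   -ln (hg1 / A0) a nonnegative combination of Erlang laws of orders 2k + 1. By
   independence and monotone convergence the distribution function of h1 is the
   corresponding combination of distribution functions of products of hs and the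
   exponential of minus an Erlang variable.
   Each of these is a Meijer G-function: by Gamma(z + 1) = z Gamma(z) and the
   nonvanishing of Gamma for Re z > 0, the integrand collapses to
     Gamma(alpha - s) Gamma(beta - s) (c - s)^-(2k+1) z^s / s,
   whose restriction to Re s = psi is, up to e^(psi ln z), a characteristic function
   divided by psi + it. Fourier inversion, through Abel summation and the Poisson
   kernel, then identifies the contour integral for every admissible psi at once. *)

(** * Measures with a density and laws of differences *)

(** Cancelling Gamma factors is legitimate only where they are nonzero. Here [cGamma] is handled
    through Euler's integral and its recurrence alone, so nonvanishing is obtained by a
    concentration argument for large real part and then carried to the left by the recurrence.
    Measures are finite but deliberately not normalised: the log-Gamma measure of parameter a has
    mass Gamma(a), so that the values Gamma(a + it) are literally its characteristic function. Each
    line Re s = psi is evaluated separately. The exponential tilts by psi put into the densities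
    cancel, one after the other, against the kernel e^(-psi x) of the inversion formula, and what
    remains does not mention psi; this is how independence of the line is obtained. Absolute
    convergence rests on one factor 1 / (c - s) and on the factor 1 / s, the Gamma factors being
    bounded on the line by the masses of their measures. *)

Section density.
Local Open Scope ereal_scope.
Context d (T : measurableType d) (R : realType) (mu : {measure set T -> \bar R}).
Variables (f : T -> R) (f0 : forall x, (0 <= f x)%R)
  (mf : measurable_fun setT f).

(* The proof arguments occur only so that the measure structure can be inferred. *)
Definition dens (f0' : forall x, (0 <= f x)%R) (mf' : measurable_fun setT f)
  (A : set T) : \bar R := \int[mu]_(x in A) (f x)%:E.

Local Notation nu := (dens f0 mf).

Let dens0 : nu set0 = 0. Proof. exact: integral_set0. Qed.

Let dens_ge0 A : 0 <= nu A.
Proof. by apply: integral_ge0 => x _; rewrite lee_fin. Qed.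

Let dens_sigma_additive : semi_sigma_additive nu.
Proof.
move=> F mF tF mUF; rewrite /dens ge0_integral_bigcup//.
- by apply: is_cvg_nneseries => n _ _; exact: dens_ge0.
- apply/measurable_EFinP; exact: measurable_funTS.
- by move=> x _; rewrite lee_fin.
Qed.

HB.instance Definition _ :=
  isMeasure.Build _ _ _ nu dens0 dens_ge0 dens_sigma_additive.

Import HBNNSimple.

(** Monotone convergence along simple approximations of [g] reduces the claim to indicators. *)
Lemma ge0_integral_dens (g : T -> \bar R) : measurable_fun setT g ->
  (forall x, 0 <= g x) -> \int[nu]_x g x = \int[mu]_x (g x * (f x)%:E).
Proof.
move=> mg g0; pose g_ := nnsfun_approx measurableT mg.
have mEf : measurable_fun setT (EFin \o f) by exact/measurable_EFinP.
have fE0 x : 0 <= (f x)%:E by rewrite lee_fin.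
transitivity (limn (fun n => \int[nu]_x (g_ n x)%:E)).
  rewrite -monotone_convergence//.
  - by apply: eq_integral => x _; apply/esym/cvg_lim => //; exact: cvg_nnsfun_approx.
  - by move=> n; exact/measurable_EFinP.
  - by move=> *; rewrite lee_fin.
  - by move=> x _ m n mn; rewrite lee_fin; exact/lefP/nd_nnsfun_approx.
transitivity (limn (fun n => \int[mu]_x ((g_ n x)%:E * (f x)%:E))); last first.
  rewrite -monotone_convergence//.
  - apply: eq_integral => x _; apply/cvg_lim => //.
    under eq_fun do rewrite muleC.
    rewrite muleC; apply: cvgeZl => //.
    exact: cvg_nnsfun_approx.
  - by move=> n; apply: emeasurable_funM => //; exact/measurable_EFinP.
  - by move=> n x _; rewrite mule_ge0// lee_fin.
  - move=> x _ m n mn; apply: lee_wpmul2r => //.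
    by rewrite lee_fin; exact/lefP/nd_nnsfun_approx.
congr (limn _); apply/funext => n.
under [LHS]eq_integral do rewrite fimfunE -fsumEFin//.
rewrite ge0_integral_fsum//; last 2 first.
  - by move=> y; exact/measurable_EFinP/measurable_funM.
  - by move=> y x _; rewrite nnfun_muleindic_ge0.
under [RHS]eq_integral.
  move=> x _; rewrite fimfunE -fsumEFin// muleC ge0_mule_fsumr; last first.
    by move=> y; rewrite nnfun_muleindic_ge0.
  over.
rewrite [RHS]ge0_integral_fsum//; last 2 first.
  - move=> y; apply: emeasurable_funM => //.
    exact/measurable_EFinP/measurable_funM.
  - by move=> y x _; rewrite mule_ge0// nnfun_muleindic_ge0.
apply: eq_fsbigr => r _; rewrite integralZl_indic_nnsfun// integral_indic// setIT.
(* A negative r is not a value of the nonnegative [g_ n], so both sides vanish. *)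
have [r0|r0] := ltP r 0%R.
  rewrite preimage_nnfun0// measure0 mule0.
  by rewrite integral0_eq// => x _; rewrite indicE in_set0 mulr0 mule0.
under eq_integral do rewrite EFinM muleCA.
rewrite ge0_integralZl//; last 2 first.
  - by apply: emeasurable_funM => //; exact/measurable_EFinP.
  - by move=> x _; rewrite mule_ge0// lee_fin.
congr (_ * _); transitivity (\int[mu]_(x in g_ n @^-1` [set r]) (f x)%:E) => //.
by rewrite [LHS]integral_mkcond epatch_indic.
Qed.

(** Positive and negative parts commute with multiplication by the nonnegative [f], so the identity
    holds whether or not the integrals converge. *)
Lemma integral_dens (g : T -> \bar R) : measurable_fun setT g ->
  \int[nu]_x g x = \int[mu]_x (g x * (f x)%:E).
Proof.
move=> mg; rewrite [LHS]integralE [RHS]integralE.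
rewrite !ge0_integral_dens//; last 2 first.
- exact: measurable_funeneg.
- exact: measurable_funepos.
have maxM (a : \bar R) x : maxe a 0 * (f x)%:E = maxe (a * (f x)%:E) 0.
  rewrite [LHS]muleC maxe_pMr; [by rewrite mule0 muleC|by []|by rewrite lee_fin].
congr (_ - _); apply: eq_integral => x _.
  by rewrite funeposE maxM funeposE.
by rewrite !funenegE -mulNe maxM.
Qed.

End density.

Section finite_density.
Local Open Scope ereal_scope.
Context d (T : measurableType d) (R : realType) (mu : {measure set T -> \bar R}).
Variables (f : T -> R) (f0 : forall x, (0 <= f x)%R)
  (mf : measurable_fun setT f) (intf : mu.-integrable setT (EFin \o f)).

(** The set function of [dens], carrying integrability of [f] so that it is inferred to be a finite
    measure, as the product measures below require. *)
Definition fdens (f0' : forall x, (0 <= f x)%R) (mf' : measurable_fun setT f)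
  (intf' : mu.-integrable setT (EFin \o f)) := dens mu f0' mf'.

Local Notation nu := (fdens f0 mf intf).

HB.instance Definition _ := Measure.on nu.

Let fdens_finite : nu setT < +oo.
Proof.
rewrite [ltLHS](_ : _ = \int[mu]_x `|(f x)%:E|); last first.
  by apply: eq_integral => x _; rewrite gee0_abs// lee_fin.
by case/integrableP : intf.
Qed.

HB.instance Definition _ := @Measure_isFinite.Build _ _ _ nu
  (lty_fin_num_fun fdens_finite).

End finite_density.

Section law_of_difference.
Local Open Scope ereal_scope.
Context (R : realType).
Local Notation TR := (measurableTypeR R).

Definition subp (p : TR * TR) : TR := (p.1 - p.2 : R)%R.

Lemma measurable_subp : measurable_fun setT subp.
Proof. exact: measurable_funB. Qed.

HB.instance Definition _ := isMeasurableFun.Build _ _ _ _ subp measurable_subp.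

Variables m1 m2 : {finite_measure set TR -> \bar R}.

(** The law of X - Y for independent X and Y of laws [m1] and [m2]. Differences are preferred to
    sums because in Gamma(alpha - s) with s = psi + it the variable t enters with a minus sign. *)
Definition subm (A : set TR) : \bar R := pushforward (m1 \x m2) subp A.

Let subm0 : subm set0 = 0.
Proof. by rewrite /subm /pushforward preimage_set0 measure0. Qed.

Let subm_ge0 A : 0 <= subm A. Proof. exact: measure_ge0. Qed.

Let subm_sigma_additive : semi_sigma_additive subm.
Proof.
have mF A : measurable A -> measurable (subp @^-1` A).
  by move=> mA; rewrite -[X in measurable X]setTI; exact: measurable_subp.
move=> F mFn tF mUF; rewrite /subm /pushforward preimage_bigcup.
apply: measure_semi_sigma_additive.
- by move=> n; exact: mF.
- apply/trivIsetP => /= i j _ _ ij; rewrite -preimage_setI.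
  by move/trivIsetP : tF => /(_ _ _ _ _ ij) ->//; rewrite preimage_set0.
- by rewrite -preimage_bigcup; exact: mF.
Qed.

HB.instance Definition _ := isMeasure.Build _ _ _ subm
  subm0 subm_ge0 subm_sigma_additive.

Let subm_finite : subm setT < +oo.
Proof.
rewrite /subm /pushforward preimage_setT -setXTT product_measure1E//.
by rewrite lte_mul_pinfty// ?fin_num_measure// ltey_eq fin_num_measure.
Qed.

HB.instance Definition _ := @Measure_isFinite.Build _ _ _ subm
  (lty_fin_num_fun subm_finite).

Lemma ge0_integral_subm (g : TR -> \bar R) : measurable_fun setT g ->
  (forall x, 0 <= g x) ->
  \int[subm]_x g x = \int[m1]_x \int[m2]_y g (x - y : R)%R.
Proof.
move=> mg g0.
have := @ge0_integral_pushforward _ _ _ _ _ _ measurable_subp (m1 \x m2) setT g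
  measurableT mg (fun x _ => g0 x).
rewrite preimage_setT => h; transitivity (\int[m1 \x m2]_x (g \o subp) x).
  by rewrite -h; exact: eq_measure_integral.
rewrite fubini_tonelli1//=.
by apply: measurableT_comp => //; exact: measurable_subp.
Qed.

Lemma bounded_integrable2 (h : TR * TR -> R) (M : R) : measurable_fun setT h ->
  (forall p, `|h p| <= M)%R -> (m1 \x m2).-integrable setT (EFin \o h).
Proof.
move=> mh hM; have M0 : (0 <= M)%R by rewrite (le_trans _ (hM (0%R, 0%R))).
apply/integrable12ltyP; first exact/measurable_EFinP.
apply: (@le_lt_trans _ _ (\int[m1]_x \int[m2]_y (M%:E))).
  apply: ge0_le_integral => //=.
  - by move=> x _; apply: integral_ge0 => y _.
  - apply: (@measurable_fun_fubini_tonelli_F _ _ _ _ _ m2 (fun p => `|(h p)%:E|)) => //.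
    by apply: measurableT_comp => //; exact/measurable_EFinP.
  - move=> x _; apply: ge0_le_integral => //=.
    + do 2 apply: measurableT_comp => //.
      exact: measurableT_comp.
    + by move=> y _; rewrite lee_fin hM.
under eq_integral do rewrite integral_cst//.
rewrite integral_cst//.
by rewrite lte_mul_pinfty// ?ltey_eq ?fin_num_measure// ?mule_ge0 ?lee_fin ?fin_numM ?fin_num_measure.
Qed.

Lemma integral_subm (g : TR -> R) (M : R) : measurable_fun setT g ->
  (forall x, `|g x| <= M)%R ->
  \int[subm]_x (g x)%:E = \int[m1]_x \int[m2]_y (g (x - y : R)%R)%:E.
Proof.
move=> mg gM.
have ig : (m1 \x m2).-integrable setT (EFin \o (g \o subp)).
  apply: (@bounded_integrable2 _ M) => [|p]; last exact: gM.
  by apply: measurableT_comp => //; exact: measurable_subp.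
have mEg : measurable_fun setT (EFin \o g) by exact/measurable_EFinP.
have := @integral_pushforward _ _ _ _ _ _ measurable_subp (m1 \x m2) setT _
  mEg ig measurableT.
rewrite preimage_setT => h.
transitivity (\int[m1 \x m2]_x ((EFin \o g) \o subp) x).
  by rewrite -h; exact: eq_measure_integral.
by rewrite -integral12_prod_meas1.
Qed.

(** Boundedness on finite measures makes every inner integral finite, so that [fine] passes through
    Fubini's theorem. *)
Lemma Rintegral_swap (h : TR * TR -> R) (M : R) : measurable_fun setT h ->
  (forall p, `|h p| <= M)%R ->
  Rintegral m1 setT (fun x => Rintegral m2 setT (fun y => h (x, y))) =
  Rintegral m2 setT (fun y => Rintegral m1 setT (fun x => h (x, y))).
Proof.
move=> mh hM; have ih := bounded_integrable2 mh hM.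
have ib (m : {finite_measure set TR -> \bar R}) (g : TR -> R) : measurable_fun setT g ->
    (forall x, `|g x| <= M)%R -> \int[m]_x (g x)%:E \is a fin_num.
  move=> mg gM; apply: integrable_fin_num => //.
  apply: measurable_bounded_integrable => //.
    by rewrite ltey_eq fin_num_measure.
  exists M; split; first exact: num_real.
  by move=> x Mx y _ /=; rewrite (le_trans (gM y))// ltW.
have := Fubini ih; rewrite /Rintegral => e.
transitivity (fine (\int[m1]_x \int[m2]_y (EFin \o h) (x, y))).
  congr fine; apply: eq_integral => x _; rewrite fineK//; apply: ib => //.
  exact: measurableT_comp.
rewrite e; congr fine; apply: eq_integral => y _; rewrite fineK//; apply: ib => //.
exact: measurableT_comp.
Qed.

(** A by-product of Fubini's theorem on the product with [m1], where the bounded [h] is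
    integrable. *)
Lemma measurable_Rintegral2 (h : TR * TR -> R) (M : R) : measurable_fun setT h ->
  (forall p, `|h p| <= M)%R ->
  measurable_fun setT (fun x : TR => Rintegral m2 setT (fun y => h (x, y))).
Proof.
move=> mh hM; have mF := measurable_fubini_F (bounded_integrable2 mh hM).
by apply: (measurableT_comp _ mF); exact: fine_measurable.
Qed.

(** Each section of the event X - Y = x is a single point, which the atomless [m2] ignores. *)
Lemma subm_set1 (x : TR) : (forall y, m2 [set y] = 0) -> subm [set x] = 0.
Proof.
move=> m20; rewrite /subm /pushforward/= /product_measure1/=.
apply: integral0_eq => y _ /=.
rewrite (_ : xsection _ y = [set (y - x : R)%R])//.
apply/seteqP; split => z; rewrite /xsection/= inE/= /subp/=.
  by move=> <-; rewrite opprB addrC subrK.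
by move=> ->; rewrite opprB addrC subrK.
Qed.

End law_of_difference.

(** * Characteristic functions of finite measures *)

Section characteristic.
Context (R : realType).
Local Notation TR := (measurableTypeR R).
Implicit Types m : {finite_measure set TR -> \bar R}.

Lemma measurable_cosM (t : R) : measurable_fun setT (fun x : TR => cos (t * x)).
Proof.
apply: measurableT_comp; first exact: continuous_measurable_fun (@continuous_cos R).
exact: measurable_funM.
Qed.

Lemma measurable_sinM (t : R) : measurable_fun setT (fun x : TR => sin (t * x)).
Proof.
apply: measurableT_comp; first exact: continuous_measurable_fun (@continuous_sin R).
exact: measurable_funM.
Qed.

Lemma bounded_integrable m (g : TR -> R) (M : R) : measurable_fun setT g ->
  (forall x, `|g x| <= M)%R -> m.-integrable setT (EFin \o g).
Proof.
move=> mg gM; apply: measurable_bounded_integrable => //.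
- by rewrite ltey_eq fin_num_measure.
- exists M; split; first exact: num_real.
  by move=> x Mx y _ /=; rewrite (le_trans (gM y))// ltW.
Qed.

Lemma integrable_cosM m t : m.-integrable setT (EFin \o (fun x : TR => cos (t * x))).
Proof. by apply: (@bounded_integrable _ _ 1) => [|x]; [exact: measurable_cosM|exact: cos_max]. Qed.

Lemma integrable_sinM m t : m.-integrable setT (EFin \o (fun x : TR => sin (t * x))).
Proof. by apply: (@bounded_integrable _ _ 1) => [|x]; [exact: measurable_sinM|exact: sin_max]. Qed.

(** The integral of e^(itx) against a measure of arbitrary finite mass. *)
Definition chr m (t : R) : R[i] :=
  (Rintegral m setT (fun x => cos (t * x)))
    +i* (Rintegral m setT (fun x => sin (t * x))).

Lemma Rintegral_subm m1 m2 (g : TR -> R) (M : R) : measurable_fun setT g ->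
  (forall x, `|g x| <= M)%R ->
  Rintegral (subm m1 m2) setT g =
  Rintegral m1 setT (fun x => Rintegral m2 setT (fun y => g (x - y : R)%R)).
Proof.
move=> mg gM; rewrite /Rintegral (integral_subm _ _ mg gM).
congr fine; apply: eq_integral => x _; rewrite fineK//.
apply: integrable_fin_num => //.
apply: (@bounded_integrable _ _ M) => //.
exact: (measurableT_comp mg (measurable_funB _ _)).
Qed.

(** Fubini and the addition formulas for cosine and sine; the sign of the difference lands on the
    argument of the second factor. *)
Lemma chr_subm m1 m2 t : chr (subm m1 m2) t = chr m1 t * chr m2 (- t).
Proof.
rewrite /chr (@Rintegral_subm _ _ _ 1); [|exact: measurable_cosM|by move=> x; exact: cos_max].
rewrite (@Rintegral_subm _ _ _ 1); [|exact: measurable_sinM|by move=> x; exact: sin_max].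
under eq_Rintegral.
  move=> x _; under eq_Rintegral do rewrite mulrBr -(mulNr t) cosD.
  rewrite RintegralB//; last 2 first.
    exact: (integrableZl _ _ (integrable_cosM _ _)).
    exact: (integrableZl _ _ (integrable_sinM _ _)).
  rewrite !RintegralZl//; [|exact: integrable_sinM|exact: integrable_cosM].
  over.
under [X in _ +i* X]eq_Rintegral.
  move=> x _; under eq_Rintegral do rewrite mulrBr -(mulNr t) sinD.
  rewrite RintegralD//; last 2 first.
    exact: (integrableZl _ _ (integrable_cosM _ _)).
    exact: (integrableZl _ _ (integrable_sinM _ _)).
  rewrite !RintegralZl//; [|exact: integrable_sinM|exact: integrable_cosM].
  over.
rewrite RintegralB//; last 2 first.
  exact: (integrableZr _ _ (integrable_cosM _ _)).
  exact: (integrableZr _ _ (integrable_sinM _ _)).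
rewrite RintegralD//; last 2 first.
  exact: (integrableZr _ _ (integrable_sinM _ _)).
  exact: (integrableZr _ _ (integrable_cosM _ _)).
rewrite !RintegralZr//; try exact: integrable_sinM; try exact: integrable_cosM.
by apply/eqP; rewrite eq_complex /= eqxx /= addrC.
Qed.

End characteristic.

(** * Changes of variables and improper integrals *)

Section lebesgue_image.
Local Open Scope ereal_scope.
Context d (T : measurableType d) (R : realType) (nu : {measure set T -> \bar R}).
Local Notation mu := (@lebesgue_measure R).
Local Notation TR := (measurableTypeR R).
Variables (phi : T -> TR) (mphi : measurable_fun setT phi).
Hypothesis nuphi : forall a b : R, (a < b)%R ->
  nu (phi @^-1` `]a, b]) = (b - a)%:E.

(** By uniqueness of Lebesgue measure, a change of variables has to be checked on half-open
    intervals only. *)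
Let pushE (A : set TR) : measurable A -> pushforward nu phi A = mu A.
Proof.
pose m := measure_function_pushforward__canonical__measure_function_Measure nu
  mphi.
move=> mA; apply/esym; apply: (@lebesgue_measure_unique R m) => //.
move=> _ [[a b]] _ <- /=; rewrite lebesgue_measure_itv/= lte_fin.
rewrite /pushforward; case: ifPn => [ab|]; first by rewrite nuphi.
rewrite -leNgt => ba; rewrite set_itv_ge ?bnd_simp -?leNgt//.
by rewrite preimage_set0 measure0.
Qed.

Lemma ge0_integral_lebesgue_image (g : TR -> \bar R) :
  measurable_fun setT g -> (forall x, 0 <= g x) ->
  \int[nu]_x g (phi x) = \int[mu]_x g x.
Proof.
move=> mg g0.
have := @ge0_integral_pushforward _ _ _ _ _ _ mphi nu setT g measurableT mg
  (fun x _ => g0 x).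
rewrite preimage_setT => <-.
by apply: eq_measure_integral => A mA _; exact: pushE.
Qed.

Lemma integral_lebesgue_image (g : TR -> \bar R) : measurable_fun setT g ->
  \int[nu]_x g (phi x) = \int[mu]_x g x.
Proof.
move=> mg; rewrite [LHS]integralE [RHS]integralE.
rewrite -(ge0_integral_lebesgue_image (measurable_funepos mg))//.
rewrite -(ge0_integral_lebesgue_image (measurable_funeneg mg))//.
by congr (_ - _); apply: eq_integral => x _; rewrite ?funeposE ?funenegE.
Qed.

Lemma integrable_lebesgue_image (g : TR -> \bar R) : measurable_fun setT g ->
  nu.-integrable setT (g \o phi) <-> mu.-integrable setT g.
Proof.
move=> mg; have := ge0_integral_lebesgue_image (measurableT_comp (@abse_measurable _ setT) mg) (fun=> abse_ge0 _).
move=> /= e; split => /integrableP[_ h]; apply/integrableP; split => //.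
- by rewrite -e.
- exact: measurableT_comp.
- by rewrite -e in h.
Qed.

End lebesgue_image.

Section lebesgue_change.
Local Open Scope ereal_scope.
Context (R : realType).
Local Notation mu := (@lebesgue_measure R).
Local Notation TR := (measurableTypeR R).
Implicit Types g : TR -> \bar R.

Let mopp : measurable_fun setT (-%R : TR -> TR).
Proof. exact: measurable_funN. Qed.

Let nuopp (a b : R) : (a < b)%R -> mu ((-%R : TR -> TR) @^-1` `]a, b]) = (b - a)%:E.
Proof.
move=> ab; rewrite opp_preimage_itvbndbnd lebesgue_measure_itv/= lte_fin.
by rewrite ltrN2 ab opprK addrC.
Qed.

Let mshift (c : R) : measurable_fun setT ((fun x : R => x + c)%R : TR -> TR).
Proof. exact: measurable_funD. Qed.

Let nushift (c a b : R) : (a < b)%R -> mu (((fun x : R => x + c)%R : TR -> TR) @^-1` `]a, b]) = (b - a)%:E.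
Proof.
move=> ab; rewrite (_ : _ @^-1` _ = `](a - c)%R, (b - c)%R]%classic).
  by rewrite lebesgue_measure_itv/= lte_fin ltrD2r ab; congr EFin; lra.
by apply/seteqP; split => x /=; rewrite !in_itv/= ltrBlDr lerBrDr.
Qed.

Lemma integralT_opp g : measurable_fun setT g ->
  \int[mu]_x g (- (x : R))%R = \int[mu]_x g x.
Proof. exact: (integral_lebesgue_image mopp nuopp). Qed.

Lemma integrableT_opp g : measurable_fun setT g ->
  mu.-integrable setT (fun x : TR => g (- (x : R))%R) <-> mu.-integrable setT g.
Proof. exact: (integrable_lebesgue_image mopp nuopp). Qed.

Lemma integralT_shift c g : measurable_fun setT g ->
  \int[mu]_x g ((x : R) + c)%R = \int[mu]_x g x.
Proof. by move=> mg; exact: (integral_lebesgue_image (mshift c) (@nushift c)). Qed.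

Lemma integrableT_shift c g : measurable_fun setT g ->
  mu.-integrable setT (fun x : TR => g ((x : R) + c)%R) <-> mu.-integrable setT g.
Proof. exact: (integrable_lebesgue_image (mshift c) (nushift c)). Qed.

(** Density of dx / x on the positive half-line, whose image under [ln] is Lebesgue measure. *)
Let invp (x : TR) : R := (if 0 < (x : R) then (x : R)^-1 else 0)%R.

Let invp_ge0 x : (0 <= invp x)%R.
Proof. by rewrite /invp; case: ifPn => // x0; rewrite invr_ge0 ltW. Qed.

Let minvp : measurable_fun setT invp.
Proof.
rewrite (_ : invp = (fun x : R => x^-1 : R)%R \_ `]0%R, +oo[).
  apply/(measurable_restrictT _ _).1 => //.
  apply: open_continuous_measurable_fun => // x.
  rewrite inE/= in_itv/= andbT => x0.
  by apply: inv_continuous; rewrite gt_eqF.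
by apply/funext => x; rewrite patchE /invp mem_setE in_itv/= andbT.
Qed.

Let mln : measurable_fun setT (@ln R : TR -> TR).
Proof. exact: measurable_ln. Qed.

Let nuln (a b : R) : (a < b)%R ->
  dens mu invp_ge0 minvp ((@ln R : TR -> TR) @^-1` `]a, b]) = (b - a)%:E.
Proof.
move=> ab; rewrite /dens integral_mkcond.
transitivity (\int[mu]_(x in `]expR a, expR b]) (invp x)%:E).
  rewrite [RHS]integral_mkcond; apply: eq_integral => x _.
  rewrite !patchE (_ : (x \in _ @^-1` _) = (a < ln x <= b)%R); last first.
    by apply/idP/idP; rewrite inE/= in_itv.
  rewrite (_ : (x \in _) = (expR a < x <= expR b)%R); last first.
    by apply/idP/idP; rewrite inE/= in_itv.
  (* For x <= 0 the value of [ln x] is a default that may fall in the interval, but the density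
     vanishes there. *)
  rewrite /invp; case: (ltP 0%R x) => x0; last by rewrite !if_same.
  by rewrite -ltr_expR -(ler_expR (ln x)) lnK.
rewrite integral_itv_obnd_cbnd; last first.
  exact/measurable_EFinP/measurable_funTS.
transitivity (\int[mu]_(x in `[expR a, expR b]) (x^-1)%:E).
  apply: eq_integral => x; rewrite inE/= in_itv/= => /andP[ax _].
  by rewrite /invp (lt_le_trans _ ax)// expR_gt0.
rewrite (@continuous_FTC2 _ _ (@ln R)).
- by rewrite !expRK.
- by rewrite ltr_expR.
- apply: continuous_in_subspaceT => x; rewrite inE/= in_itv/= => /andP[ax _].
  by apply: inv_continuous; rewrite gt_eqF// (lt_le_trans _ ax)// expR_gt0.
- split.
  + move=> x; rewrite in_itv/= => /andP[ax _]. 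
    have x0 : (0 < x)%R by rewrite (lt_trans _ ax)// expR_gt0.
    by have [] := is_derive1_ln x0.
  + by apply: cvg_at_right_filter; apply: continuous_ln; rewrite expR_gt0.
  + by apply: cvg_at_left_filter; apply: continuous_ln; rewrite expR_gt0.
- move=> x; rewrite in_itv/= => /andP[ax _].
  have x0 : (0 < x)%R by rewrite (lt_trans _ ax)// expR_gt0.
  by rewrite derive1E; have [_ ->] := is_derive1_ln x0.
Qed.

(** Read backwards: the right-hand integrand composed with [ln], times the density 1 / x, is [G] on
    the positive half-line. *)
Lemma exp_substitution (G : TR -> R) : measurable_fun setT G ->
  \int[mu]_(x in `]0%R, +oo[) (G x)%:E = \int[mu]_x (G (expR x) * expR x)%:E.
Proof.
move=> mG.
have mg : measurable_fun setT (fun x => (G (expR x) * expR x)%:E).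
  apply/measurable_EFinP/measurable_funM => //.
  exact: measurableT_comp.
rewrite -(integral_lebesgue_image mln nuln mg).
rewrite integral_dens; last exact: (measurableT_comp mg mln).
rewrite [LHS]integral_mkcond; apply: eq_integral => x _.
rewrite patchE mem_setE in_itv/= andbT /invp; case: ifPn => [x0|_].
  by rewrite lnK ?posrE// -EFinM mulfK// gt_eqF.
by rewrite mule0.
Qed.

End lebesgue_change.

Section improper_FTC.
Context (R : realType).
Local Notation mu := (@lebesgue_measure R).
Implicit Types f F : R -> R.

(** The compact case on growing intervals, followed by dominated convergence. *)
Lemma FTC2y f F (a l : R) : continuous f -> (forall x : R, is_derive x 1 F (f x)) ->
  mu.-integrable `[a, +oo[ (EFin \o f) -> F x @[x --> +oo] --> l ->
  Rintegral mu `[a, +oo[ f = l - F a.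
Proof.
move=> cf dF intf Fl.
have cF : continuous F.
  by move=> x; apply/differentiable_continuous/derivable1_diffP; have [] := dF x.
have mf : measurable_fun setT f by exact: continuous_measurable_fun.
(* [n.+1] keeps the intervals nondegenerate, as the compact case demands. *)
pose f_ n := f \_ `[a, a + n.+1%:R].
have fE n : (\int[mu]_(x in `[a, +oo[) (f_ n x)%:E)%E = (F (a + n.+1%:R) - F a)%:E.
  rewrite EFinB -(@continuous_FTC2 _ f F a (a + n.+1%:R)).
  - rewrite [LHS]integral_mkcond [RHS]integral_mkcond; apply: eq_integral => x _.
    rewrite !patchE /f_ !mem_setE !in_itv/= andbT patchE mem_setE in_itv/=.
    by case: (leP a x) => //=; case: ifP.
  - by rewrite ltrDl.
  - exact: continuous_subspaceT.
  - split=> [x _| |]; first by have [] := dF x.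
      by apply: cvg_at_right_filter; exact: cF.
    by apply: cvg_at_left_filter; exact: cF.
  - by move=> x _; rewrite derive1E; have [_ ->] := dF x.
have lim1 : (\int[mu]_(x in `[a, +oo[) (f_ n x)%:E)%E @[n --> \oo] -->
    (\int[mu]_(x in `[a, +oo[) (f x)%:E)%E.
  apply: (@dominated_cvg _ _ _ mu _ _ (fun n x => (f_ n x)%:E) _
      (fun x => `|(f x)%:E|%E)) => //=.
  - move=> n; apply: measurable_funTS; apply/measurable_EFinP.
    by apply/(measurable_restrictT _ _).1 => //; exact: measurable_funTS.
  - move=> x ax; apply: cvg_near_cst; near=> n.
    rewrite /f_ patchE mem_setE; case: ifPn => //.
    move: ax; rewrite !in_itv/= andbT => -> /=; rewrite -ltNge => h.
    exfalso; move: h; apply/negP; rewrite -leNgt -lerBlDl.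
    by apply: (@le_trans _ _ n%:R); [near: n; exact: nbhs_infty_ger|rewrite ler_nat].
  - exact: integrable_norm intf.
  - by move=> n x _; rewrite /f_ patchE; case: ifP => // _; rewrite normr0 lee_fin.
have lim2 : (F (a + n.+1%:R) - F a)%:E @[n --> \oo] --> (l - F a)%:E.
  apply: cvg_EFin; first exact: nearW.
  apply: cvgB; last exact: cvg_cst.
  apply: (cvg_comp (fun n : nat => a + n.+1%:R) F _ Fl).
  apply/cvgryPge => A; near=> n; rewrite -lerBlDl.
  by apply: (@le_trans _ _ n%:R); [near: n; exact: nbhs_infty_ger|rewrite ler_nat].
rewrite /Rintegral.
have -> : (\int[mu]_(x in `[a, +oo[) (f x)%:E)%E = (l - F a)%:E.
  have e : (fun n => \int[mu]_(x in `[a, +oo[) (f_ n x)%:E)%E =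
      (fun n => (F (a + n.+1%:R) - F a)%:E) by apply/funext.
  by rewrite e in lim1; exact: (cvg_unique _ lim1 lim2).
by [].
Unshelve. all: end_near. Qed.

Lemma integrable_fold f : mu.-integrable setT (EFin \o f) ->
  mu.-integrable setT (EFin \o (fun x => f (- x))).
Proof.
move=> intf; apply: (iffRL (@integrableT_opp R (EFin \o f) _)) => //.
by case/integrableP : intf.
Qed.

(** Links integrals over the line to half-line ones: primitives, the transform of an even weight,
    and the integral defining [besselK] all use it. *)
Lemma Rintegral_fold f : mu.-integrable setT (EFin \o f) ->
  Rintegral mu setT f = Rintegral mu `[0, +oo[ (fun x => f x + f (- x)).
Proof.
move=> intf.
have intS A g : measurable A -> mu.-integrable setT g -> mu.-integrable A g.
  by move=> mA; exact: integrableS.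
rewrite RintegralD//; last 2 first.
- exact: intS.
- by apply: intS => //; exact: integrable_fold.
rewrite -(setUv `[0%R, +oo[) Rintegral_setU//; last 3 first.
- exact: measurableC.
- by rewrite setUv.
- exact/disj_setPCl.
congr (_ + _).
rewrite setCitvr /Rintegral.
rewrite -[in RHS]integral_itv_obnd_cbnd//; last first.
  have /integrableP[mf _] := intS _ _ (measurable_itv `]0%R, +oo[) (integrable_fold intf).
  exact: mf.
congr fine; rewrite [LHS]integral_mkcond [RHS]integral_mkcond.
rewrite -integralT_opp; last first.
  apply/(measurable_restrictT _ _).1 => //.
  by have /integrableP[mf _] := intS _ _ (measurable_itv `]-oo, 0%R[) intf.
apply: eq_integral => x _; rewrite !patchE !mem_setE !in_itv/= andbT.
by rewrite oppr_lt0.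
Qed.

Lemma FTC2T f F (l l' : R) : continuous f -> (forall x : R, is_derive x 1 F (f x)) ->
  mu.-integrable setT (EFin \o f) -> F x @[x --> +oo] --> l ->
  F x @[x --> -oo] --> l' -> Rintegral mu setT f = l - l'.
Proof.
move=> cf dF intf Fl Fl'; rewrite Rintegral_fold//.
(* [F x - F (- x)] is a primitive of the folded integrand and vanishes at 0, so the half-line case
   applies. *)
have dG (x : R) : is_derive x 1 (fun x => F x - F (- x)) (f x + f (- x)).
  rewrite -[f (- x)]opprK; apply: is_deriveB.
  by rewrite -mulrN1; apply: (@is_derive1_comp _ F -%R).
have cG : continuous (fun x => f x + f (- x)).
  move=> x; apply: continuousD; first exact: cf.
  by apply: continuous_comp; [exact: continuousN|exact: cf].
have iG : mu.-integrable `[0, +oo[ (EFin \o (fun x => f x + f (- x))).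
  apply: (integrableS measurableT) => //.
  exact: (integrableD _ intf (integrable_fold intf)).
have lG : F x - F (- x) @[x --> +oo] --> l - l'.
  by apply: cvgB => //; apply/cvgNy_compNP.
by rewrite (FTC2y cG dG iG lG) oppr0 subrr subr0.
Qed.

End improper_FTC.

(** * Erlang laws *)

Section trigonometric_parts.
Context (R : realType).
Local Notation mu := (@lebesgue_measure R).

Lemma is_derive_cosM (t x : R) : is_derive x 1 (fun x => cos (t * x)) (- (t * sin (t * x))).
Proof.
have h : is_derive x 1 (fun x : R => t * x) t.
  by apply: is_derive_eq; rewrite /GRing.scale/= mulr1.
by have := @is_derive1_comp _ cos _ x _ _ (is_derive_cos _) h; rewrite mulNr mulrC.
Qed.

Lemma is_derive_sinM (t x : R) : is_derive x 1 (fun x => sin (t * x)) (t * cos (t * x)).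
Proof.
have h : is_derive x 1 (fun x : R => t * x) t.
  by apply: is_derive_eq; rewrite /GRing.scale/= mulr1.
by have := @is_derive1_comp _ sin _ x _ _ (is_derive_sin _) h; rewrite mulrC.
Qed.

Lemma continuous_cosM (t : R) : continuous (fun x : R => cos (t * x)).
Proof.
move=> x; apply: (continuous_comp _ (@continuous_cos R _)).
by apply: (@continuousM _ _ (cst t) id) => //; exact: cst_continuous.
Qed.

Lemma continuous_sinM (t : R) : continuous (fun x : R => sin (t * x)).
Proof.
move=> x; apply: (continuous_comp _ (@continuous_sin R _)).
by apply: (@continuousM _ _ (cst t) id) => //; exact: cst_continuous.
Qed.

Lemma bounded_cvg0 {T : Type} (F : set_system T) {FF : Filter F} (w g : T -> R) (M : R) :
  (forall x, `|g x| <= M) -> w x @[x --> F] --> (0 : R) ->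
  w x * g x @[x --> F] --> (0 : R).
Proof.
move=> gM w0; apply: norm_cvg0.
apply: (@squeeze_cvgr _ _ _ _ (cst 0) (fun x => `|w x| * M)).
- by apply: nearW => x /=; rewrite normr_ge0/= normrM ler_wpM2l.
- exact: cvg_cst.
- rewrite -(mul0r M); apply: cvgM; last exact: cvg_cst.
  by rewrite -(normr0 R); exact: cvg_norm w0.
Qed.

Lemma integrable_bounded_mul (D : set (measurableTypeR R)) (w g : R -> R) (M : R) : measurable D ->
  measurable_fun setT (g : measurableTypeR R -> R) -> (forall x, `|g x| <= M) ->
  mu.-integrable D (EFin \o w) -> mu.-integrable D (EFin \o (fun x => w x * g x)).
Proof.
move=> mD mg gM iw.
apply: (le_integrable mD _ _ (integrableZl mD M (integrable_abse iw))).
- apply/measurable_EFinP; apply: measurable_funM; last exact: measurable_funTS.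
  by apply/measurable_EFinP; case/integrableP : iw.
- move=> x _ /=; rewrite lee_fin normrM mulrC normrM normr_id ler_wpM2r//.
  by rewrite (le_trans (gM x))// ler_norm.
Qed.

Let mcos t : measurable_fun setT (fun x : measurableTypeR R => cos (t * x)).
Proof. exact: continuous_measurable_fun (@continuous_cosM t). Qed.

Let msin t : measurable_fun setT (fun x : measurableTypeR R => sin (t * x)).
Proof. exact: continuous_measurable_fun (@continuous_sinM t). Qed.

Section parts.
Variables (w w' : R -> R) (t : R).
Hypothesis cw' : continuous w'.
Hypothesis dw : forall x : R, is_derive x 1 w (w' x).
Hypothesis wy : w x @[x --> +oo] --> (0 : R).

Let cw : continuous w.
Proof.
by move=> x; apply/differentiable_continuous/derivable1_diffP; have [] := dw x.
Qed.

Let dc (x : R) : is_derive x 1 (fun x => w x * cos (t * x))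
  (w' x * cos (t * x) - t * (w x * sin (t * x))).
Proof.
apply: (is_derive_eq (is_deriveM (dw x) (is_derive_cosM t x))).
by rewrite /GRing.scale/=; ring.
Qed.

Let ds (x : R) : is_derive x 1 (fun x => w x * sin (t * x))
  (w' x * sin (t * x) + t * (w x * cos (t * x))).
Proof.
apply: (is_derive_eq (is_deriveM (dw x) (is_derive_sinM t x))).
by rewrite /GRing.scale/=; ring.
Qed.

Let cc : continuous (fun x => w' x * cos (t * x) - t * (w x * sin (t * x))).
Proof.
move=> x; apply: cvgB; first by apply: cvgM; [exact: cw'|exact: continuous_cosM].
apply: cvgM; first exact: cvg_cst.
by apply: cvgM; [exact: cw|exact: continuous_sinM].
Qed.

Let cs : continuous (fun x => w' x * sin (t * x) + t * (w x * cos (t * x))).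
Proof.
move=> x; apply: cvgD; first by apply: cvgM; [exact: cw'|exact: continuous_sinM].
apply: cvgM; first exact: cvg_cst.
by apply: cvgM; [exact: cw|exact: continuous_cosM].
Qed.

Let wcy : w x * cos (t * x) @[x --> +oo] --> (0 : R).
Proof. by apply: (@bounded_cvg0 _ _ _ _ _ 1) => // x; exact: cos_max. Qed.

Let wsy : w x * sin (t * x) @[x --> +oo] --> (0 : R).
Proof. by apply: (@bounded_cvg0 _ _ _ _ _ 1) => // x; exact: sin_max. Qed.

Section domain.
Variables (D : set (measurableTypeR R)) (mD : measurable D).
Hypothesis iw : mu.-integrable D (EFin \o w).
Hypothesis iw' : mu.-integrable D (EFin \o w').

Let iwc : mu.-integrable D (EFin \o (fun x => w x * cos (t * x))).
Proof. exact: (integrable_bounded_mul mD (mcos t) (fun x => cos_max (t * x)) iw). Qed.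

Let iws : mu.-integrable D (EFin \o (fun x => w x * sin (t * x))).
Proof. exact: (integrable_bounded_mul mD (msin t) (fun x => sin_max (t * x)) iw). Qed.

Let iw'c : mu.-integrable D (EFin \o (fun x => w' x * cos (t * x))).
Proof. exact: (integrable_bounded_mul mD (mcos t) (fun x => cos_max (t * x)) iw'). Qed.

Let iw's : mu.-integrable D (EFin \o (fun x => w' x * sin (t * x))).
Proof. exact: (integrable_bounded_mul mD (msin t) (fun x => sin_max (t * x)) iw'). Qed.

Lemma integrable_parts_cos :
  mu.-integrable D (EFin \o (fun x => w' x * cos (t * x) - t * (w x * sin (t * x)))).
Proof. exact: (integrableB mD iw'c (integrableZl mD t iws)). Qed.

Lemma integrable_parts_sin :
  mu.-integrable D (EFin \o (fun x => w' x * sin (t * x) + t * (w x * cos (t * x)))).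
Proof. exact: (integrableD mD iw's (integrableZl mD t iwc)). Qed.

Lemma Rintegral_parts_cos :
  Rintegral mu D (fun x => w' x * cos (t * x) - t * (w x * sin (t * x))) =
  Rintegral mu D (fun x => w' x * cos (t * x)) - t * Rintegral mu D (fun x => w x * sin (t * x)).
Proof. by rewrite RintegralB// ?RintegralZl//; exact: (integrableZl mD t iws). Qed.

Lemma Rintegral_parts_sin :
  Rintegral mu D (fun x => w' x * sin (t * x) + t * (w x * cos (t * x))) =
  Rintegral mu D (fun x => w' x * sin (t * x)) + t * Rintegral mu D (fun x => w x * cos (t * x)).
Proof. by rewrite RintegralD// ?RintegralZl//; exact: (integrableZl mD t iwc). Qed.

End domain.

(** Real part of integration by parts for w e^(itx): the integral of w' e^(itx) plus it times that
    of w e^(itx) equals - w(0). [parts_y_sin] is the imaginary part; over the whole line no boundary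
    term survives. *)
Lemma parts_y_cos : mu.-integrable `[0, +oo[ (EFin \o w) ->
  mu.-integrable `[0, +oo[ (EFin \o w') ->
  Rintegral mu `[0, +oo[ (fun x => w' x * cos (t * x))
    - t * Rintegral mu `[0, +oo[ (fun x => w x * sin (t * x)) = - w 0.
Proof.
move=> iw iw'; rewrite -Rintegral_parts_cos//.
rewrite (FTC2y cc dc (integrable_parts_cos _ iw iw') wcy)//.
by rewrite mulr0 cos0 mulr1 sub0r.
Qed.

Lemma parts_y_sin : mu.-integrable `[0, +oo[ (EFin \o w) ->
  mu.-integrable `[0, +oo[ (EFin \o w') ->
  Rintegral mu `[0, +oo[ (fun x => w' x * sin (t * x))
    + t * Rintegral mu `[0, +oo[ (fun x => w x * cos (t * x)) = 0.
Proof.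
move=> iw iw'; rewrite -Rintegral_parts_sin//.
rewrite (FTC2y cs ds (integrable_parts_sin _ iw iw') wsy)//.
by rewrite mulr0 sin0 mulr0 subr0.
Qed.

Hypothesis wNy : w x @[x --> -oo] --> (0 : R).

Lemma parts_T_cos : mu.-integrable setT (EFin \o w) ->
  mu.-integrable setT (EFin \o w') ->
  Rintegral mu setT (fun x => w' x * cos (t * x))
    - t * Rintegral mu setT (fun x => w x * sin (t * x)) = 0.
Proof.
move=> iw iw'; rewrite -Rintegral_parts_cos//.
have wcNy : w x * cos (t * x) @[x --> -oo] --> (0 : R).
  by apply: (@bounded_cvg0 _ _ _ _ _ 1) => // x; exact: cos_max.
by rewrite (FTC2T cc dc (integrable_parts_cos _ iw iw') wcy wcNy)// subr0.
Qed.

Lemma parts_T_sin : mu.-integrable setT (EFin \o w) ->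
  mu.-integrable setT (EFin \o w') ->
  Rintegral mu setT (fun x => w' x * sin (t * x))
    + t * Rintegral mu setT (fun x => w x * cos (t * x)) = 0.
Proof.
move=> iw iw'; rewrite -Rintegral_parts_sin//.
have wsNy : w x * sin (t * x) @[x --> -oo] --> (0 : R).
  by apply: (@bounded_cvg0 _ _ _ _ _ 1) => // x; exact: sin_max.
by rewrite (FTC2T cs ds (integrable_parts_sin _ iw iw') wsy wsNy)// subr0.
Qed.

End parts.
End trigonometric_parts.

Section erlang.
Context (R : realType).
Local Notation mu := (@lebesgue_measure R).
Local Notation TR := (measurableTypeR R).

Lemma measurable_itvR (i : interval R) : measurable ([set` i] : set TR).
Proof. exact: measurable_itv. Qed.

(** Density of the Erlang law of order n + 1 and rate c divided by c^(n+1), so that its transform is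
    exactly (c - it)^-(n+1). *)
Definition erlang (n : nat) (c u : R) : R := u ^+ n * expR (- c * u) / n`!%:R.

Lemma erlang_ge0 n c u : 0 <= u -> 0 <= erlang n c u.
Proof. by move=> u0; rewrite divr_ge0// mulr_ge0 ?exprn_ge0// expR_ge0. Qed.

Lemma erlang0 n c : erlang n.+1 c 0 = 0.
Proof. by rewrite /erlang expr0n/= !mul0r. Qed.

Lemma is_derive_expRM (c x : R) : is_derive x 1 (fun x => expR (c * x)) (c * expR (c * x)).
Proof.
have h : is_derive x 1 (fun x : R => c * x) c.
  by apply: is_derive_eq; rewrite /GRing.scale/= mulr1.
by have := @is_derive1_comp _ expR _ x _ _ (is_derive_expR _) h; rewrite mulrC.
Qed.

Lemma is_derive_erlang0 (c x : R) : is_derive x 1 (erlang 0 c) (- c * erlang 0 c x).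
Proof.
rewrite /erlang fact0; have := is_derive_expRM (- c) x.
rewrite (_ : (fun x => expR (- c * x)) = (fun x => x ^+ 0 * expR (- c * x) / 1)) ?expr0 ?mul1r ?divr1//.
by apply/funext => y; rewrite expr0 mul1r divr1.
Qed.

(** The link between consecutive orders that drives the induction in [chr_erlang]. *)
Lemma is_derive_erlangS n (c x : R) :
  is_derive x 1 (erlang n.+1 c) (erlang n c x - c * erlang n.+1 c x).
Proof.
have h1 : is_derive x 1 (fun x : R => x ^+ n.+1) (n.+1%:R * x ^+ n).
  rewrite (_ : (fun x : R => x ^+ n.+1) = id ^+ n.+1); last first.
    by apply/funext => y; rewrite exprfctE.
  apply: (is_derive_eq (is_deriveX n.+1 (is_derive_id x 1))).
  by rewrite /GRing.scale/= mulr1.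
have h2 := is_deriveM h1 (is_derive_expRM (- c) x).
have h3 := is_deriveZ (n.+1`!%:R^-1) h2.
rewrite [X in is_derive _ _ X _](_ : erlang n.+1 c = (n.+1`!%:R^-1) \*: ((fun x : R => x ^+ n.+1) * (fun x => expR (- c * x)))); last first.
  by apply/funext => y; rewrite /erlang [LHS]mulrC.
apply: (is_derive_eq h3); rewrite /erlang /GRing.scale/= factS natrM invfM.
have n0 : n.+1%:R != 0 :> R by rewrite pnatr_eq0.
have f0 : n`!%:R != 0 :> R by rewrite pnatr_eq0 -lt0n fact_gt0.
move: (n.+1%:R : R) n0 (n`!%:R : R) f0 => m m0 k k0.
by rewrite exprS; field; rewrite k0 m0.
Qed.

Lemma continuous_erlang n c : continuous (erlang n c).
Proof.
move=> x; apply/differentiable_continuous/derivable1_diffP.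
by case: n => [|n]; [have [] := is_derive_erlang0 c x|have [] := is_derive_erlangS n c x].
Qed.

(** Half of the exponential decay absorbs the power, since (cu/2)^n / n! is at most e^(cu/2). *)
Lemma erlang_le n c u : 0 < c -> 0 <= u ->
  erlang n c u <= (2 / c) ^+ n * expR (- (c / 2) * u).
Proof.
move=> c0 u0; have u0' : 0 <= c / 2 * u by rewrite mulr_ge0// divr_ge0// ltW.
have f0 : 0 < n`!%:R :> R by rewrite ltr0n fact_gt0.
have h : (c / 2 * u) ^+ n / n`!%:R <= expR (c / 2 * u).
  case: n f0 => [|n] f0; first by rewrite expr0 fact0 divr1 (le_trans _ (expR_ge1Dx _))// lerDl.
  by rewrite (le_trans _ (expR_ge1Dxn n u0'))// lerDr.
have e : expR (- c * u) = expR (- (c / 2) * u) * expR (- (c / 2) * u).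
  by rewrite -expRD; congr expR; field.
have e' : expR (c / 2 * u) * expR (- (c / 2) * u) = 1.
  by rewrite mulNr expRN mulfV// gt_eqF// expR_gt0.
set E := expR (- (c / 2) * u) in e e' *; have E0 : 0 <= E by exact: expR_ge0.
have -> : erlang n c u = (2 / c) ^+ n * (((c / 2 * u) ^+ n / n`!%:R) * E * E).
  have -> : (2 / c) ^+ n * ((c / 2 * u) ^+ n / n`!%:R * E * E) =
     ((2 / c) ^+ n * (c / 2 * u) ^+ n) * (E * E) / n`!%:R by ring.
  by rewrite /erlang e -exprMn; congr (_ ^+ _ * _ / _); field; rewrite gt_eqF.
rewrite ler_wpM2l ?exprn_ge0 ?divr_ge0 ?(ltW c0)//.
apply: (@le_trans _ _ (expR (c / 2 * u) * E * E)); last by rewrite e' mul1r.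
by rewrite !ler_wpM2r.
Qed.

Lemma integrable_expRy (c : R) : 0 < c ->
  mu.-integrable `[0, +oo[ (EFin \o (fun u => expR (- c * u))).
Proof.
move=> c0; have h := integrable_exponential_pdf c0.
have := integrableZl (measurable_itvR `[0, +oo[) (c^-1) (integrableS measurableT (measurable_itvR `[0, +oo[) (@subsetT _ _) h).
apply: eq_integrable => // u; rewrite inE/= in_itv/= andbT => u0.
rewrite (_ : exponential_pdf c u = c * expR (- c * u)); last by rewrite exponential_pdfE.
by rewrite -EFinM mulrA mulVf ?mul1r// gt_eqF.
Qed.

Lemma integrable_erlang n c : 0 < c ->
  mu.-integrable `[0, +oo[ (EFin \o erlang n c).
Proof.
move=> c0; have c20 : 0 < c / 2 by rewrite divr_gt0.
have h := integrableZl (measurable_itvR `[0, +oo[) ((2 / c) ^+ n) (integrable_expRy c20).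
apply: (le_integrable _ _ _ h) => //.
- apply/measurable_EFinP; apply: measurable_funTS.
  exact: continuous_measurable_fun (@continuous_erlang n c).
- move=> u; rewrite /= in_itv/= andbT => u0.
  rewrite lee_fin ger0_norm ?erlang_ge0// (le_trans (erlang_le n c0 u0))//.
  exact: ler_norm.
Qed.

Lemma cvgy_erlang n c : 0 < c -> erlang n c u @[u --> +oo] --> (0 : R).
Proof.
move=> c0; apply: (@squeeze_cvgr _ _ _ _ (cst 0) (fun u => (2 / c) ^+ n * expR (- (c / 2 * u)))).
- near=> u; have u0 : 0 <= u by near: u; exact: nbhs_pinfty_ge.
  by rewrite erlang_ge0//= -mulNr erlang_le.
- exact: cvg_cst.
- rewrite -(mulr0 ((2 / c) ^+ n)); apply: cvgM; first exact: cvg_cst.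
  apply: (cvg_comp (fun u => c / 2 * u) (fun u => expR (- u))); last exact: cvgr_expR.
  by apply: gt0_cvgMry; [rewrite divr_gt0|exact: cvg_id].
Unshelve. all: end_near. Qed.

Definition erlangT n c : R -> R := erlang n c \_ `[0, +oo[.

Lemma erlangT_ge0 n c u : 0 <= erlangT n c u.
Proof.
by rewrite /erlangT patchE mem_setE in_itv/= andbT; case: ifPn => // /erlang_ge0.
Qed.

Lemma measurable_erlangT n c : measurable_fun setT (erlangT n c : measurableTypeR R -> R).
Proof.
apply/(measurable_restrictT _ _).1 => //; apply: measurable_funTS.
exact: continuous_measurable_fun (@continuous_erlang n c).
Qed.

Lemma integrable_erlangT n c : 0 < c ->
  mu.-integrable setT (EFin \o erlangT n c).
Proof.
move=> c0; have := integrable_erlang n c0.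
by rewrite integrable_mkcond//= /erlangT restrict_EFin.
Qed.

Definition erlang_measure n c (c0 : 0 < c) :=
  @fdens _ TR R mu (erlangT n c) (@erlangT_ge0 n c) (@measurable_erlangT n c)
    (integrable_erlangT n c0).

HB.instance Definition _ n c (c0 : 0 < c) := FiniteMeasure.on (erlang_measure n c0).

Lemma Rintegral_erlang n c (c0 : 0 < c) (g : TR -> R) : measurable_fun setT g ->
  Rintegral (erlang_measure n c0) setT g =
  Rintegral mu `[0, +oo[ (fun u => erlang n c u * g u).
Proof.
move=> mg; rewrite /Rintegral; congr fine; rewrite integral_dens; last exact/measurable_EFinP.
rewrite [RHS]integral_mkcond; apply: eq_integral => x _.
by rewrite /erlangT !patchE; case: ifPn => _; rewrite ?mule0// -EFinM mulrC.
Qed.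

(** Integration by parts gives (c - it) phi_0 = 1, where the boundary term at 0 survives, and (c -
    it) phi_(n+1) = phi_n, where it vanishes. *)
Lemma chr_erlang n c (c0 : 0 < c) t :
  chr (erlang_measure n c0) t = (c -i* t) ^- n.+1.
Proof.
have z0 : c -i* t != 0 by rewrite eq_complex/= gt_eqF.
have chrE m : chr (erlang_measure m c0) t =
   (Rintegral mu `[0, +oo[ (fun u => erlang m c u * cos (t * u))) +i*
   (Rintegral mu `[0, +oo[ (fun u => erlang m c u * sin (t * u))).
  by rewrite /chr !Rintegral_erlang//; [exact: measurable_sinM|exact: measurable_cosM].
have mI := measurable_itvR `[0, +oo[.
have iE m := integrable_erlang m c0.
have ic m : mu.-integrable `[0, +oo[ (EFin \o (fun u => erlang m c u * cos (t * u))).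
  by apply: (@integrable_bounded_mul _ _ _ _ 1) => //; [exact: measurable_cosM|move=> x; exact: cos_max].
have is_ m : mu.-integrable `[0, +oo[ (EFin \o (fun u => erlang m c u * sin (t * u))).
  by apply: (@integrable_bounded_mul _ _ _ _ 1) => //; [exact: measurable_sinM|move=> x; exact: sin_max].
elim: n => [|n IH].
  have cw : continuous (fun x => - c * erlang 0 c x).
    by move=> x; apply: cvgM; [exact: cvg_cst|exact: continuous_erlang].
  have iw : mu.-integrable `[0, +oo[ (EFin \o (fun x => - c * erlang 0 c x)).
    exact: (integrableZl mI (- c) (iE 0%N)).
  have := parts_y_cos t cw (is_derive_erlang0 c) (@cvgy_erlang 0 _ c0) (iE _) iw.
  have := parts_y_sin t cw (is_derive_erlang0 c) (@cvgy_erlang 0 _ c0) (iE _) iw.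
  under eq_Rintegral do rewrite -(mulrA (- c)).
  rewrite RintegralZl// => hs.
  under eq_Rintegral do rewrite -(mulrA (- c)).
  rewrite RintegralZl// => hc.
  rewrite expr1; apply: (mulIf z0); rewrite mulVf// chrE.
  have e0 : erlang 0 c 0 = 1 by rewrite /erlang expr0 mulr0 expR0 fact0 divr1 mulr1.
  by apply/eqP; rewrite eq_complex/=; apply/andP; split; apply/eqP; rewrite e0 in hc; lra.
have cw : continuous (fun x => erlang n c x - c * erlang n.+1 c x).
  move=> x; apply: cvgB; first exact: continuous_erlang.
  by apply: cvgM; [exact: cvg_cst|exact: continuous_erlang].
have iw : mu.-integrable `[0, +oo[ (EFin \o (fun x => erlang n c x - c * erlang n.+1 c x)).
  exact: (integrableB mI (iE n) (integrableZl mI c (iE n.+1))).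
have := parts_y_cos t cw (is_derive_erlangS n c) (@cvgy_erlang n.+1 _ c0) (iE _) iw.
have := parts_y_sin t cw (is_derive_erlangS n c) (@cvgy_erlang n.+1 _ c0) (iE _) iw.
under eq_Rintegral do rewrite mulrBl -(mulrA c).
rewrite RintegralB//; last exact: (integrableZl mI c (is_ _)).
rewrite RintegralZl// => hs.
under eq_Rintegral do rewrite mulrBl -(mulrA c).
rewrite RintegralB//; last exact: (integrableZl mI c (ic _)).
rewrite RintegralZl// erlang0 => hc.
rewrite exprS invfM mulrC -IH; apply: (mulIf z0); rewrite mulfVK// !chrE.
by apply/eqP; rewrite eq_complex/=; apply/andP; split; apply/eqP; lra.
Qed.

End erlang.

(** * The Gamma function on the right half-plane *)

Section log_gamma_density.
Context (R : realType).
Local Notation mu := (@lebesgue_measure R).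
Local Notation TR := (measurableTypeR R).

(** Euler's integrand t^(a-1) e^(-t) dt seen through x = ln t, that is Gamma(a) times the density of
    the logarithm of a Gamma variable. *)
Definition gdens (a x : R) : R := expR (a * x - expR x).

Lemma gdens_ge0 a x : 0 <= gdens a x. Proof. exact: expR_ge0. Qed.

Lemma gdensS a x : gdens (a + 1) x = expR x * gdens a x.
Proof. by rewrite /gdens -expRD; congr expR; ring. Qed.

Lemma is_derive_gdens (a x : R) :
  is_derive x 1 (gdens a) (a * gdens a x - gdens (a + 1) x).
Proof.
have h1 : is_derive x 1 (fun x : R => a * x) a.
  by apply: is_derive_eq; rewrite /GRing.scale/= mulr1.
have h2 := is_deriveB h1 (is_derive_expR x).
apply: (is_derive_eq (@is_derive1_comp _ expR _ x _ _ (is_derive_expR _) h2)).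
by rewrite gdensS /gdens; ring.
Qed.

Lemma continuous_gdens a : continuous (gdens a).
Proof.
by move=> x; apply/differentiable_continuous/derivable1_diffP; have [] := is_derive_gdens a x.
Qed.

Lemma measurable_gdens a : measurable_fun setT (gdens a : TR -> R).
Proof. exact: continuous_measurable_fun (@continuous_gdens a). Qed.

(** The maximum of [gdens (a + 1)], attained at ln (a + 1). *)
Definition gdens_cst (a : R) := expR ((a + 1) * (ln (a + 1) - 1)).

Lemma gdens_le_r a x : 0 < a -> gdens a x <= gdens_cst a * expR (- x).
Proof.
move=> a0; rewrite /gdens /gdens_cst -expRD ler_expR.
have a10 : 0 < a + 1 by rewrite addr_gt0.
(* The tangent inequality 1 + y <= e^y at y = x - ln (a + 1). *)
have : (a + 1) * (1 + (x - ln (a + 1))) <= (a + 1) * expR (x - ln (a + 1)).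
  by rewrite ler_pM2l// expR_ge1Dx.
rewrite expRB lnK ?posrE// mulrCA mulfV ?gt_eqF// mulr1.
by move=> h; lra.
Qed.

Lemma gdens_le_l a x : gdens a x <= expR (a * x).
Proof. by rewrite /gdens ler_expR gerBl expR_ge0. Qed.

Lemma integrable_gdens a : 0 < a -> mu.-integrable setT (EFin \o gdens a).
Proof.
move=> a0.
(* Dominating functions on the two half-lines: a multiple of e^(-x) on the right, and e^(ax) on the
   left as a reflected exponential density. *)
have i1 := integrableZl (@measurableT _ TR) (gdens_cst a) (integrable_erlangT 0 (@ltr01 R)).
have i2 := integrable_fold (integrable_erlangT 0 a0).
apply: (le_integrable _ _ _ (integrableD (@measurableT _ TR) i1 i2)) => //.
  by apply/measurable_EFinP; exact: measurable_gdens.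
move=> x _ /=; rewrite lee_fin ger0_norm ?gdens_ge0// ger0_norm; last first.
  by rewrite addr_ge0// ?mulr_ge0 ?expR_ge0 ?erlangT_ge0.
rewrite /erlangT !patchE !mem_setE !in_itv/= !andbT /erlang !expr0 fact0 !divr1 !mul1r.
rewrite mulN1r mulNr mulrN opprK.
have [x0|x0] := leP 0 x.
  by rewrite (le_trans (gdens_le_r x a0))// lerDl; case: ifP => // _; exact: expR_ge0.
by rewrite mulr0 add0r oppr_ge0 (ltW x0) gdens_le_l.
Qed.

Lemma cvgy_gdens a : 0 < a -> gdens a x @[x --> +oo] --> (0 : R).
Proof.
move=> a0; apply: (@squeeze_cvgr _ _ _ _ (cst 0) (fun u => gdens_cst a * expR (- u))).
- by apply: nearW => u; rewrite /= gdens_ge0 gdens_le_r.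
- exact: cvg_cst.
- by rewrite -(mulr0 (gdens_cst a)); apply: cvgM; [exact: cvg_cst|exact: cvgr_expR].
Qed.

Lemma cvgNy_gdens a : 0 < a -> gdens a x @[x --> -oo] --> (0 : R).
Proof.
move=> a0; apply/cvgNy_compNP.
apply: (@squeeze_cvgr _ _ _ _ (cst 0) (fun u => expR (- (a * u)))).
- by apply: nearW => u; rewrite /= gdens_ge0 -mulrN gdens_le_l.
- exact: cvg_cst.
- apply: (cvg_comp (fun u => a * u) (fun u => expR (- u))); last exact: cvgr_expR.
  by apply: gt0_cvgMry => //; exact: cvg_id.
Qed.

Definition gdens_measure a (a0 : 0 < a) :=
  @fdens _ TR R mu (gdens a) (gdens_ge0 a) (@measurable_gdens a)
    (integrable_gdens a0).

HB.instance Definition _ a (a0 : 0 < a) := FiniteMeasure.on (gdens_measure a0).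

Lemma Rintegral_gdens a (a0 : 0 < a) (g : TR -> R) : measurable_fun setT g ->
  Rintegral (gdens_measure a0) setT g = Rintegral mu setT (fun x => gdens a x * g x).
Proof.
move=> mg; rewrite /Rintegral; congr fine; rewrite integral_dens; last exact/measurable_EFinP.
by apply: eq_integral => x _; rewrite -EFinM mulrC.
Qed.

(** Gamma(z + 1) = z Gamma(z) on the line Re z = a, by parts from the derivative a [gdens a] -
    [gdens (a + 1)]; both boundary terms vanish. *)
Lemma chr_gdensS a (a0 : 0 < a) (a10 : 0 < a + 1) t :
  chr (gdens_measure a10) t = (a +i* t) * chr (gdens_measure a0) t.
Proof.
have iE b (b0 : 0 < b) := integrable_gdens b0.
have ic b (b0 : 0 < b) : mu.-integrable setT (EFin \o (fun u => gdens b u * cos (t * u))).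
  by apply: (@integrable_bounded_mul _ _ _ _ 1) => //; [exact: measurable_cosM|move=> x; exact: cos_max|exact: iE].
have is_ b (b0 : 0 < b) : mu.-integrable setT (EFin \o (fun u => gdens b u * sin (t * u))).
  by apply: (@integrable_bounded_mul _ _ _ _ 1) => //; [exact: measurable_sinM|move=> x; exact: sin_max|exact: iE].
have cw : continuous (fun x => a * gdens a x - gdens (a + 1) x).
  move=> x; apply: cvgB; last exact: continuous_gdens.
  by apply: cvgM; [exact: cvg_cst|exact: continuous_gdens].
have mT := @measurableT _ TR.
have iw : mu.-integrable setT (EFin \o (fun x => a * gdens a x - gdens (a + 1) x)).
  exact: (integrableB mT (integrableZl mT a (iE _ a0)) (iE _ a10)).
have := parts_T_cos t cw (is_derive_gdens a) (cvgy_gdens a0) (cvgNy_gdens a0) (iE _ a0) iw.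
have := parts_T_sin t cw (is_derive_gdens a) (cvgy_gdens a0) (cvgNy_gdens a0) (iE _ a0) iw.
under eq_Rintegral do rewrite mulrBl -(mulrA a).
rewrite RintegralB//; [|exact: (integrableZl mT a (is_ _ a0))|exact: is_].
rewrite RintegralZl//; last exact: is_.
move=> hs.
under eq_Rintegral do rewrite mulrBl -(mulrA a).
rewrite RintegralB//; [|exact: (integrableZl mT a (ic _ a0))|exact: ic].
rewrite RintegralZl//; last exact: ic.
move=> hc.
rewrite /chr !Rintegral_gdens; try exact: measurable_sinM; try exact: measurable_cosM.
move: hs hc; move: (Rintegral mu setT (fun x => gdens a x * cos (t * x)))
  (Rintegral mu setT (fun x => gdens a x * sin (t * x)))
  (Rintegral mu setT (fun x => gdens (a + 1) x * cos (t * x)))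
  (Rintegral mu setT (fun x => gdens (a + 1) x * sin (t * x))) => C S C1 S1 hs hc.
by apply/eqP; rewrite eq_complex/=; apply/andP; split; apply/eqP; lra.
Qed.

Lemma chr0 (m : {finite_measure set TR -> \bar R}) : chr m 0 = (fine (m setT))%:C.
Proof.
apply/eqP; rewrite eq_complex/=; apply/andP; split; apply/eqP.
  under eq_Rintegral do rewrite mul0r cos0.
  by rewrite Rintegral_cst// mul1r.
under eq_Rintegral do rewrite mul0r sin0.
by rewrite Rintegral_cst// mul0r.
Qed.

Lemma Gamma_gdens a : Gamma a = Rintegral mu setT (gdens a).
Proof.
rewrite /Gamma /Rintegral exp_substitution; last first.
  apply: measurable_funM; first exact: measurable_powR.
  by apply: measurableT_comp => //; exact: measurable_funN.
congr fine; apply: eq_integral => x _; congr EFin.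
rewrite /powR gt_eqF ?expR_gt0// expRK /gdens -!expRD; congr expR; ring.
Qed.

Lemma fine_gdens_measure a (a0 : 0 < a) : fine (gdens_measure a0 setT) = Gamma a.
Proof. by rewrite Gamma_gdens. Qed.

Lemma Gamma_gt0 (a : R) : 0 < a -> 0 < Gamma a.
Proof.
move=> a0; rewrite Gamma_gdens.
(* On [0, 1] the integrand is at least exp(-e), as a x >= 0 and e^x <= e. *)
have e0 : 0 < expR (- expR 1) :> R by exact: expR_gt0.
apply: (lt_le_trans e0).
have iI := integrableZl (@measurableT _ TR) (expR (- expR 1 : R))
   (integrable_indic_itv (0 : R) 1 true false).
have -> : expR (- expR 1) = Rintegral mu setT (fun x => expR (- expR 1) * \1_`[0, 1] x).
  rewrite RintegralZl//; last exact: integrable_indic_itv.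
  rewrite /Rintegral integral_indic// setIT.
  have := @lebesgue_measure_itv R `[0, 1]; rewrite /= lte_fin ltr01 oppr0 adde0 => ->.
  by rewrite mulr1.
apply: le_Rintegral => //; first exact: integrable_gdens.
move=> x _; rewrite indicE mem_setE in_itv/=.
have [/andP[x0 x1]|_] := boolP (0 <= x <= 1); last by rewrite mulr0 expR_ge0.
rewrite mulr1 /gdens ler_expR.
have : expR x <= expR 1 by rewrite ler_expR.
have : 0 <= a * x by rewrite mulr_ge0// ltW.
by move=> *; lra.
Qed.

Lemma Gamma_rec (a : R) : 0 < a -> Gamma (a + 1) = a * Gamma a.
Proof.
move=> a0; have a10 : 0 < a + 1 by rewrite addr_gt0.
have := chr_gdensS a0 a10 0; rewrite !chr0 !fine_gdens_measure.
by move=> [-> _]; rewrite mul0r subr0.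
Qed.

Lemma euler_integrandE (a t x : R) :
  cpow x (a +i* t - 1) * (expR (- x))%:C =
  (expR ((a - 1) * ln x) * cos (t * ln x) * expR (- x)) +i*
  (expR ((a - 1) * ln x) * sin (t * ln x) * expR (- x)).
Proof.
rewrite /cpow /cexp/=; apply/eqP; rewrite eq_complex/=.
by rewrite !(mulr0, subr0, mul0r, addr0, add0r, oppr0) !eqxx.
Qed.

(** For positive real part the shift is 0, so [cGamma] is Euler's integral itself, and t = e^x turns
    it into a characteristic function. *)
Lemma cGammaE (a : R) (a0 : 0 < a) t : cGamma (a +i* t) = chr (gdens_measure a0) t.
Proof.
have s0 : Gamma_shift (a +i* t) = 0%N by rewrite /Gamma_shift/= a0.
rewrite /cGamma s0 big_geq// divr1 mulr0n addr0 /euler_integral /cintegral /chr.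
rewrite !Rintegral_gdens; [|exact: measurable_sinM|exact: measurable_cosM].
have mG (h : R -> R) : measurable_fun setT h ->
    measurable_fun setT (fun x : TR => expR ((a - 1) * ln x) * h (t * ln x) * expR (- x)).
  move=> mh; have ml : measurable_fun setT (@ln R : TR -> R) by exact: measurable_ln.
  apply: measurable_funM; last by apply: measurableT_comp => //; exact: measurable_funN.
  apply: measurable_funM; last by apply: (measurableT_comp mh); exact: measurable_funM.
  by apply: measurableT_comp => //; exact: measurable_funM.
have gE x : expR ((a - 1) * x) * expR (- expR x) * expR x = gdens a x.
  by rewrite /gdens -!expRD; congr expR; ring.
have mc := continuous_measurable_fun (@continuous_cos R).
have ms := continuous_measurable_fun (@continuous_sin R).
congr (_ +i* _); under eq_Rintegral do rewrite euler_integrandE /=.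
  rewrite /Rintegral exp_substitution; last exact: mG.
  congr fine; apply: eq_integral => x _; congr EFin.
  by rewrite expRK -gE; ring.
rewrite /Rintegral exp_substitution; last exact: mG.
congr fine; apply: eq_integral => x _; congr EFin.
by rewrite expRK -gE; ring.
Qed.

Lemma normr_sin_le (y : R) : `|sin y| <= `|y|.
Proof.
wlog y0 : y / 0 <= y.
  move=> h; have [|y0] := leP 0 y; first exact: h.
  by rewrite -normrN -sinN -[leRHS]normrN; apply: h; rewrite oppr_ge0 ltW.
rewrite (ger0_norm y0).
have [->|yn0] := eqVneq y 0; first by rewrite sin0 normr0.
have y0' : 0 < y by rewrite lt_neqAle eq_sym yn0.
have [|c _] := @MVT R sin cos _ _ y0' (fun x _ => is_derive_sin x).
  by apply: continuous_subspaceT; exact: continuous_sin.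
rewrite sin0 !subr0 => ->; rewrite normrM (ger0_norm y0).
by rewrite ler_piMl// cos_max.
Qed.

Lemma onem_cos_le (y : R) : 1 - cos y <= y ^+ 2 / 2.
Proof.
have -> : cos y = 1 - 2 * sin (y / 2) ^+ 2.
  rewrite -[in LHS](divfK (_ : 2 != 0 :> R) y)// mulr_natr cos_mulr2n sin2cos2; ring.
have : sin (y / 2) ^+ 2 <= (y / 2) ^+ 2.
  by rewrite -[leLHS]real_normK ?num_real// -[leRHS]real_normK ?num_real// lerXn2r ?nnegrE ?normr_sin_le.
by rewrite exprMn; move=> h; lra.
Qed.

(** A square is traded for exponentials because e^x and e^(-x) integrate against [gdens a] to
    Gamma(a + 1) and Gamma(a - 1). The constant 4 is the price of the crude bound x/2 <= 2 sinh(x/2)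
    for x >= 0. *)
Lemma sqr_le_expR (x : R) : x ^+ 2 <= 4 * (expR x + expR (- x) - 2).
Proof.
wlog x0 : x / 0 <= x.
  move=> h; have [|x0] := leP 0 x; first exact: h.
  by have := h (- x); rewrite sqrrN opprK (addrC (expR (- x))); apply; rewrite oppr_ge0 ltW.
set u := expR (x / 2); have u1 : 1 + x / 2 <= u by exact: expR_ge1Dx.
have -> : expR x = u ^+ 2 by rewrite -expRM_natr; congr expR; field.
have -> : expR (- x) = u ^- 2 by rewrite expRN -[u ^+ 2]expRM_natr; congr (expR _)^-1; field.
have u0 : 0 < u by exact: expR_gt0.
have -> : u ^+ 2 + u ^- 2 - 2 = (u - u^-1) ^+ 2 by field; rewrite gt_eqF.
have h : x / 2 <= u - u^-1.
  have : u^-1 <= 1.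
    by rewrite invf_le1//; lra.
  by lra.
have : (x / 2) ^+ 2 <= (u - u^-1) ^+ 2 by rewrite lerXn2r ?nnegrE//; lra.
by rewrite exprMn => ?; lra.
Qed.

(* With T of Gamma law of parameter a, a^(it) Gamma(a-it)/Gamma(a) is the mean of
   (T/a)^(-it), which is close to 1 as T/a concentrates at 1 for large a. *)
Lemma chr_gdens_neq0_large (a : R) (a0 : 0 < a) t :
  4 * t ^+ 2 < 2 * (a - 1) -> chr (gdens_measure a0) t != 0.
Proof.
move=> ta; have a1 : 0 < a - 1 by have := sqr_ge0 t; lra.
set L := ln a; have aL : a = expR L by rewrite lnK.
have mT := @measurableT _ TR.
have iE := integrable_gdens a0.
have ic : mu.-integrable setT (EFin \o (fun u => gdens a u * cos (t * u))).
  by apply: (@integrable_bounded_mul _ _ _ _ 1) => //; [exact: measurable_cosM|move=> x; exact: cos_max].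
have is_ : mu.-integrable setT (EFin \o (fun u => gdens a u * sin (t * u))).
  by apply: (@integrable_bounded_mul _ _ _ _ 1) => //; [exact: measurable_sinM|move=> x; exact: sin_max].
have i1 : mu.-integrable setT (EFin \o gdens (a + 1)) by apply: integrable_gdens; rewrite addr_gt0.
have i2 : mu.-integrable setT (EFin \o gdens (a - 1)) by exact: integrable_gdens.
apply/negP => /eqP; rewrite /chr !Rintegral_gdens; [|exact: measurable_sinM|exact: measurable_cosM].
move=> [hc hs].
(* If the transform vanishes, so does the real part of its product with e^(-itL), which is the
   integral of cos(t(x - L)): the variable is recentred at L = ln a, where the mass concentrates. *)
have e0 : Rintegral mu setT (fun x => cos (t * L) * (gdens a x * cos (t * x)) + sin (t * L) * (gdens a x * sin (t * x))) = 0.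
  rewrite RintegralD//; [|exact: (integrableZl mT _ ic)|exact: (integrableZl mT _ is_)].
  by rewrite !RintegralZl// hc hs !mulr0 addr0.
have iq : mu.-integrable setT (EFin \o (fun x => a^-1 * gdens (a + 1) x + a * gdens (a - 1) x)).
  exact: (integrableD mT (integrableZl mT _ i1) (integrableZl mT _ i2)).
(* The minorant of the integrand given by cos y >= 1 - y^2/2 and [sqr_le_expR]; it integrates to (a
   - 1 - 2t^2) Gamma(a - 1), which is positive. *)
have il : mu.-integrable setT (EFin \o (fun x => (1 + 4 * t ^+ 2) * gdens a x -
   2 * t ^+ 2 * (a^-1 * gdens (a + 1) x + a * gdens (a - 1) x))).
  exact: (integrableB mT (integrableZl mT _ iE) (integrableZl mT _ iq)).
have ir : mu.-integrable setT (EFin \o (fun x => cos (t * L) * (gdens a x * cos (t * x)) + sin (t * L) * (gdens a x * sin (t * x)))).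
  exact: (integrableD mT (integrableZl mT _ ic) (integrableZl mT _ is_)).
have := le_Rintegral mT il ir; rewrite e0.
rewrite RintegralB//; [|exact: (integrableZl mT _ iE)|exact: (integrableZl mT _ iq)].
rewrite !RintegralZl// RintegralD//; [|exact: (integrableZl mT _ i1)|exact: (integrableZl mT _ i2)].
rewrite !RintegralZl// -!Gamma_gdens Gamma_rec//.
have Ga : Gamma a = (a - 1) * Gamma (a - 1) by rewrite -Gamma_rec// subrK.
have G1 : 0 < Gamma (a - 1) by exact: Gamma_gt0.
rewrite Ga mulKf ?gt_eqF//.
have -> : (1 + 4 * t ^+ 2) * ((a - 1) * Gamma (a - 1)) - 2 * t ^+ 2 *
  ((a - 1) * Gamma (a - 1) + a * Gamma (a - 1)) = (a - 1 - 2 * t ^+ 2) * Gamma (a - 1) by ring.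
rewrite leNgt mulr_gt0//; last by lra.
(* The integrated inequality is refuted; its pointwise premise remains to be checked. *)
move=> h; suff: false by []; apply: h => x _.
have -> : cos (t * L) * (gdens a x * cos (t * x)) + sin (t * L) * (gdens a x * sin (t * x)) =
  gdens a x * cos (t * (x - L)) by rewrite mulrBr cosB; ring.
have -> : gdens (a + 1) x = expR x * gdens a x by exact: gdensS.
have -> : gdens (a - 1) x = expR (- x) * gdens a x.
  by rewrite -[in RHS](subrK 1 a) gdensS mulrA -expRD addNr expR0 mul1r.
have -> : (1 + 4 * t ^+ 2) * gdens a x - 2 * t ^+ 2 * (a^-1 * (expR x * gdens a x) +
  a * (expR (- x) * gdens a x)) = gdens a x * (1 - t ^+ 2 / 2 * (4 * (expR (x - L) + expR (- (x - L)) - 2))).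
  rewrite opprB expRB expRB expRN -aL; field.
  by rewrite !gt_eqF// expR_gt0.
rewrite ler_wpM2l ?gdens_ge0//.
have h1 := onem_cos_le (t * (x - L)); have h2 := sqr_le_expR (x - L).
have : t ^+ 2 / 2 * (x - L) ^+ 2 <= t ^+ 2 / 2 * (4 * (expR (x - L) + expR (- (x - L)) - 2)).
  by rewrite ler_wpM2l// divr_ge0// sqr_ge0.
by rewrite exprMn in h1; lra.
Qed.

(** Descent: the recurrence exhibits the transform at b as a factor of the one at b + 1, so
    nonvanishing passes from large parameters down to b. *)
Lemma chr_gdens_neq0 (a : R) (a0 : 0 < a) t : chr (gdens_measure a0) t != 0.
Proof.
suff h n (b : R) (b0 : 0 < b) : 4 * t ^+ 2 < 2 * (b + n%:R - 1) ->
    chr (gdens_measure b0) t != 0.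
  (* Enough unit steps to bring the parameter into the range of [chr_gdens_neq0_large]. *)
  apply: (h (Num.truncn (4 * t ^+ 2 + 1)).+1).
  have : 4 * t ^+ 2 + 1 < (Num.truncn (4 * t ^+ 2 + 1)).+1%:R by exact: truncnS_gt.
  by have := sqr_ge0 t; lra.
elim: n b b0 => [|n IH] b b0 h.
  by apply: chr_gdens_neq0_large; rewrite addr0 in h.
have b10 : 0 < b + 1 by rewrite addr_gt0.
have := IH _ b10; rewrite (chr_gdensS b0 b10) mulf_eq0 negb_or.
by move=> /(_ _)/andP[]// ; move: h; rewrite -natr1; lra.
Qed.

Lemma cGamma_neq0 (z : R[i]) : 0 < complex.Re z -> cGamma z != 0.
Proof. by case: z => a t a0; rewrite (cGammaE a0) chr_gdens_neq0. Qed.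

Lemma cGamma_rec (z : R[i]) : 0 < complex.Re z -> cGamma (z + 1) = z * cGamma z.
Proof.
case: z => a t a0; have a10 : 0 < a + 1 by rewrite addr_gt0.
have -> : (a +i* t + 1 : R[i]) = (a + 1) +i* t.
  by apply/eqP; rewrite eq_complex/= addr0 !eqxx.
by rewrite (cGammaE a0) (cGammaE a10) (chr_gdensS a0 a10).
Qed.

End log_gamma_density.

(** * Abel weights and the Poisson kernel *)

Section abel_weights.
Context (R : realType).
Local Notation mu := (@lebesgue_measure R).
Local Notation TR := (measurableTypeR R).

Definition abel_weight (c t : R) : R := expR (- c * `|t|).

Lemma abel_weight_ge0 c t : 0 <= abel_weight c t. Proof. exact: expR_ge0. Qed.

Lemma measurable_abel_weight c : measurable_fun setT (abel_weight c : TR -> R).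
Proof.
apply: measurableT_comp => //.
by apply: measurable_funM => //; exact: measurableT_comp.
Qed.

Lemma integrable_abel_weight c : 0 < c -> mu.-integrable setT (EFin \o abel_weight c).
Proof.
move=> c0; have i1 := integrable_erlangT 0 c0.
apply: (le_integrable _ _ _ (integrableD (@measurableT _ TR) i1 (integrable_fold i1))) => //.
  by apply/measurable_EFinP; exact: measurable_abel_weight.
move=> x _ /=; rewrite lee_fin ger0_norm ?abel_weight_ge0// ger0_norm; last first.
  by rewrite addr_ge0 ?erlangT_ge0.
rewrite /erlangT !patchE !mem_setE !in_itv/= !andbT /erlang !expr0 fact0 !divr1 !mul1r /abel_weight.
have [x0|x0] := leP 0 x.
  by rewrite (ger0_norm x0) lerDl; case: ifP => // _; exact: expR_ge0.
by rewrite add0r oppr_ge0 (ltW x0) (ltr0_norm x0).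
Qed.

Definition abel_measure c (c0 : 0 < c) :=
  @fdens _ TR R mu (abel_weight c) (abel_weight_ge0 c) (@measurable_abel_weight c)
    (integrable_abel_weight c0).

HB.instance Definition _ c (c0 : 0 < c) := FiniteMeasure.on (abel_measure c0).

Lemma Rintegral_abel c (c0 : 0 < c) (g : TR -> R) : measurable_fun setT g ->
  Rintegral (abel_measure c0) setT g = Rintegral mu setT (fun x => abel_weight c x * g x).
Proof.
move=> mg; rewrite /Rintegral; congr fine; rewrite integral_dens; last exact/measurable_EFinP.
by apply: eq_integral => x _; rewrite -EFinM mulrC.
Qed.

Definition poisson_kernel (c x : R) : R := 2 * c / (c ^+ 2 + x ^+ 2).

(** The weight is even: the sine part cancels, and the cosine part is twice the real part of 1 / (c
    - ix). *)
Lemma chr_abel c (c0 : 0 < c) x : chr (abel_measure c0) x = (poisson_kernel c x)%:C.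
Proof.
rewrite /chr !Rintegral_abel; [|exact: measurable_sinM|exact: measurable_cosM].
have ia := integrable_abel_weight c0.
rewrite !Rintegral_fold; last 2 first.
- by apply: (@integrable_bounded_mul _ _ _ _ 1) => //; [exact: measurable_sinM|move=> y; exact: sin_max].
- by apply: (@integrable_bounded_mul _ _ _ _ 1) => //; [exact: measurable_cosM|move=> y; exact: cos_max].
have -> : Rintegral mu `[0, +oo[ (fun t => abel_weight c t * sin (x * t) +
    abel_weight c (- t) * sin (x * - t)) = 0.
  rewrite /Rintegral integral0_eq// => t _.
  by rewrite /abel_weight normrN mulrN sinN mulrN subrr.
have -> : Rintegral mu `[0, +oo[ (fun t => abel_weight c t * cos (x * t) +
    abel_weight c (- t) * cos (x * - t)) = Rintegral mu `[0, +oo[ (fun t => 2 * (erlang 0 c t * cos (x * t))).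
  apply: eq_Rintegral => t; rewrite inE/= in_itv/= andbT => t0.
  rewrite /abel_weight normrN mulrN cosN (ger0_norm t0) /erlang expr0 fact0 divr1 mul1r; ring.
rewrite RintegralZl//; last first.
  apply: (@integrable_bounded_mul _ _ _ _ 1) => //; [exact: measurable_cosM|by move=> y; exact: cos_max|].
  exact: integrable_erlang.
rewrite -(Rintegral_erlang 0 c0)//; last exact: measurable_cosM.
have := chr_erlang 0 c0 x; rewrite expr1 /chr => -[-> _].
by rewrite /poisson_kernel/= sqrrN mulrA.
Qed.

End abel_weights.

(** * Fourier inversion by Abel summation *)

Section inversion.
Context (R : realType).
Local Notation mu := (@lebesgue_measure R).
Local Notation TR := (measurableTypeR R).

Lemma abel_weight_cvg1 (t : R) : abel_weight (n.+1%:R^-1) t @[n --> \oo] --> (1 : R).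
Proof.
have h : - n.+1%:R^-1 * `|t| @[n --> \oo] --> (0 : R).
  rewrite -[X in _ --> X](mul0r `|t|); apply: cvgM; last exact: cvg_cst.
  by rewrite -oppr0; apply: cvgN; exact: cvg_harmonic.
by rewrite -[X in _ --> X]expR0; apply: (cvg_comp _ _ h); exact: continuous_expR.
Qed.

Let harm0 n : 0 < n.+1%:R^-1 :> R. Proof. by rewrite invr_gt0. Qed.

Lemma cvg_Rintegral_abel (C : R -> R) : mu.-integrable setT (EFin \o C) ->
  Rintegral (abel_measure (harm0 n)) setT C @[n --> \oo] --> Rintegral mu setT C.
Proof.
move=> iC; have mC : measurable_fun setT (C : TR -> R).
  by apply/measurable_EFinP; case/integrableP : iC.
under eq_fun do rewrite Rintegral_abel//.
apply: fine_cvg; rewrite /Rintegral fineK; last exact: integrable_fin_num.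
apply: (@dominated_cvg _ _ _ mu setT measurableT
  (fun n x => (abel_weight n.+1%:R^-1 x * C x)%:E) (EFin \o C) (fun x => `|(C x)%:E|%E)) => //.
- move=> n; apply/measurable_EFinP; apply: measurable_funM => //.
  exact: measurable_abel_weight.
- move=> x _; apply: cvg_EFin; first exact: nearW.
  rewrite -[X in _ --> X](mul1r (C x)); apply: cvgM; last exact: cvg_cst.
  exact: abel_weight_cvg1.
- exact: integrable_abse.
- move=> n x _; rewrite lee_fin normrM ler_piMl// ger0_norm ?abel_weight_ge0//.
  by rewrite /abel_weight expR_le1 mulNr oppr_le0 mulr_ge0.
Qed.

(** The weight makes Fubini applicable; exchanging the integrals moves the transform from [m] onto
    the weight. *)
Lemma Rintegral_abel_Re_chr (m : {finite_measure set TR -> \bar R}) c (c0 : 0 < c) :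
  Rintegral (abel_measure c0) setT (fun t => complex.Re (chr m t)) =
  Rintegral m setT (poisson_kernel c).
Proof.
rewrite (@Rintegral_swap _ (abel_measure c0) m (fun p => cos (p.1 * p.2)) 1); last 2 first.
- apply: measurableT_comp; first exact: continuous_measurable_fun (@continuous_cos R).
  exact: measurable_funM.
- by move=> p; exact: cos_max.
apply: eq_Rintegral => x _ /=.
under eq_Rintegral do rewrite mulrC.
by have [-> _] := chr_abel c0 x.
Qed.

Lemma Rintegral_abel_Im_chr (m : {finite_measure set TR -> \bar R}) c (c0 : 0 < c) :
  Rintegral (abel_measure c0) setT (fun t => complex.Im (chr m t)) = 0.
Proof.
rewrite (@Rintegral_swap _ (abel_measure c0) m (fun p => sin (p.1 * p.2)) 1); last 2 first.
- apply: measurableT_comp; first exact: continuous_measurable_fun (@continuous_sin R).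
  exact: measurable_funM.
- by move=> p; exact: sin_max.
rewrite /Rintegral integral0_eq// => x _ /=; congr EFin.
transitivity (Rintegral (abel_measure c0) setT (fun t => sin (x * t))).
  by apply: eq_Rintegral => t _; rewrite mulrC.
by have [_ ->] := chr_abel c0 x.
Qed.

Variables (psi : R) (psi0 : 0 < psi).
Let rho := erlang_measure 0 psi0.

(** The Poisson kernel of width 1/N centred at x, integrated against e^(-psi r) over r >= 0, after
    integration by parts. Since 2 atan(N(r - x)) is a primitive of the kernel, this form is bounded
    uniformly in N, whereas the kernel itself is not. *)
Definition smoothed_step (N x : R) : R :=
  2 * atan (N * x) + psi * Rintegral mu `[0, +oo[ (fun r => erlang 0 psi r * (2 * atan (N * (r - x)))).

Lemma atan_le (y : R) : `|2 * atan y| <= pi.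
Proof.
rewrite normrM ger0_norm// -ler_pdivlMl// mulrC ler_norml.
by rewrite (ltW (atan_gtNpi2 y)) (ltW (atan_ltpi2 y)).
Qed.

Let mI := measurable_itvR (`[0, +oo[ : interval R).

Lemma is_derive_atanM (N x r : R) :
  is_derive r 1 (fun r => 2 * atan (N * (r - x))) (2 * N / (1 + (N * (r - x)) ^+ 2)).
Proof.
have h : is_derive r 1 (fun r : R => N * (r - x)) N.
  by apply: is_derive_eq; rewrite /GRing.scale/= subr0 mulr1.
have h2 := @is_derive1_comp _ atan _ r _ _ (is_derive1_atan _) h.
by apply: (is_derive_eq (is_deriveZ 2 h2)); rewrite /GRing.scale/=; ring.
Qed.

Lemma continuous_atanM (N x : R) : continuous (fun r => 2 * atan (N * (r - x))).
Proof.
by move=> r; apply/differentiable_continuous/derivable1_diffP; have [] := is_derive_atanM N x r.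
Qed.

Lemma measurable_atanM (N x : R) : measurable_fun setT ((fun r => 2 * atan (N * (r - x))) : TR -> R).
Proof. exact: continuous_measurable_fun (@continuous_atanM N x). Qed.

Let oneDsqr_gt0 (y : R) : 0 < 1 + y ^+ 2.
Proof. by rewrite ltr_wpDr// sqr_ge0. Qed.

Lemma continuous_atanM_deriv (N x : R) : continuous (fun r => 2 * N / (1 + (N * (r - x)) ^+ 2)).
Proof.
move=> r; apply: cvgM; first exact: cvg_cst.
apply: cvgV; first by rewrite gt_eqF.
apply: cvgD; first exact: cvg_cst.
apply: cvgM; (apply: cvgM; [exact: cvg_cst|apply: cvgB; [exact: cvg_id|exact: cvg_cst]]).
Qed.

Lemma poisson_kernelE (N x r : R) : 0 < N ->
  poisson_kernel N^-1 (x - r) = 2 * N / (1 + (N * (r - x)) ^+ 2).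
Proof.
move=> N0; rewrite /poisson_kernel.
have h := oneDsqr_gt0 (N * (r - x)).
have e : N^-1 ^+ 2 + (x - r) ^+ 2 = (1 + (N * (r - x)) ^+ 2) / N ^+ 2.
  by field; rewrite gt_eqF.
by rewrite e; field; rewrite !gt_eqF.
Qed.

Lemma atanM_deriv_le (N x r : R) : 0 <= N -> `|2 * N / (1 + (N * (r - x)) ^+ 2)| <= 2 * N.
Proof.
move=> N0; have h := oneDsqr_gt0 (N * (r - x)).
rewrite ger0_norm ?divr_ge0 ?(ltW h) ?mulr_ge0// ler_pdivrMr// ler_peMr ?mulr_ge0//.
by rewrite lerDl sqr_ge0.
Qed.

Lemma Rintegral_poisson (N x : R) : 0 < N ->
  Rintegral rho setT (fun r => poisson_kernel N^-1 (x - r)) = smoothed_step N x.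
Proof.
move=> N0.
transitivity (Rintegral rho setT (fun r => 2 * N / (1 + (N * (r - x)) ^+ 2))).
  by apply: eq_Rintegral => r _; rewrite poisson_kernelE.
have mP := continuous_measurable_fun (@continuous_atanM_deriv N x).
rewrite Rintegral_erlang//.
have cw := @continuous_erlang R 0 psi.
have ie := integrable_erlang 0 psi0.
have i1 : mu.-integrable `[0, +oo[ (EFin \o (fun r => erlang 0 psi r * (2 * N / (1 + (N * (r - x)) ^+ 2)))).
  by apply: (integrable_bounded_mul mI mP _ ie) => r; exact: atanM_deriv_le (ltW N0).
have i2 : mu.-integrable `[0, +oo[ (EFin \o (fun r => erlang 0 psi r * (2 * atan (N * (r - x))))).
  apply: (integrable_bounded_mul mI (measurable_atanM N x) _ ie) => r; exact: atan_le.
have dF (r : R) : is_derive r 1 (fun r => erlang 0 psi r * (2 * atan (N * (r - x))))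
   (erlang 0 psi r * (2 * N / (1 + (N * (r - x)) ^+ 2)) - psi * (erlang 0 psi r * (2 * atan (N * (r - x))))).
  apply: (is_derive_eq (is_deriveM (is_derive_erlang0 psi r) (is_derive_atanM N x r))).
  by rewrite /GRing.scale/=; ring.
have cF : continuous (fun r => erlang 0 psi r * (2 * N / (1 + (N * (r - x)) ^+ 2)) - psi * (erlang 0 psi r * (2 * atan (N * (r - x))))).
  move=> r; apply: cvgB; first by apply: cvgM; [exact: cw|exact: continuous_atanM_deriv].
  by apply: cvgM; [exact: cvg_cst|apply: cvgM; [exact: cw|exact: continuous_atanM]].
have iF : mu.-integrable `[0, +oo[ (EFin \o (fun r => erlang 0 psi r * (2 * N / (1 + (N * (r - x)) ^+ 2)) - psi * (erlang 0 psi r * (2 * atan (N * (r - x)))))).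
  exact: (integrableB mI i1 (integrableZl mI psi i2)).
have lF : erlang 0 psi r * (2 * atan (N * (r - x))) @[r --> +oo] --> (0 : R).
  by apply: (@bounded_cvg0 _ _ _ _ _ _ pi); [move=> r; exact: atan_le|exact: cvgy_erlang].
have := FTC2y cF dF iF lF; rewrite RintegralB//; last exact: (integrableZl mI psi i2).
(* The boundary term at r = 0 is - 2 atan(- N x), the first summand of [smoothed_step]. *)
have e0 : erlang 0 psi 0 = 1 by rewrite /erlang expr0 mulr0 expR0 fact0 divr1 mulr1.
rewrite RintegralZl// !sub0r mulrN atanN e0 mul1r mulrN opprK => h.
by rewrite /smoothed_step; apply/eqP; rewrite -subr_eq; apply/eqP.
Qed.

Definition step (x : R) : R :=
  pi * Num.sg x + psi * Rintegral mu `[0, +oo[ (fun r => erlang 0 psi r * (pi * Num.sg (r - x))).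

Lemma cvg_atan_sg (y : R) : 2 * atan (n.+1%:R * y) @[n --> \oo] --> pi * Num.sg y.
Proof.
have pos (z : R) : 0 < z -> 2 * atan (n.+1%:R * z) @[n --> \oo] --> (pi : R).
  move=> z0; rewrite [X in _ --> X](_ : pi = 2 * (pi / 2)); last by field.
  apply: cvgM; first exact: cvg_cst.
  apply: (cvg_comp (fun n : nat => n.+1%:R * z) atan _ (@cvgy_atan R)).
  apply/cvgryPge => A; near=> n; rewrite -ler_pdivrMr//.
  by apply: (@le_trans _ _ n%:R); [near: n; exact: nbhs_infty_ger|rewrite ler_nat].
have [y0|y0|->] := ltgtP y 0.
- rewrite ltr0_sg// mulrN1.
  rewrite (_ : (fun n => _) = (fun n => - (2 * atan (n.+1%:R * - y)))); last first.
    by apply/funext => n; rewrite mulrN atanN mulrN opprK.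
  by apply: cvgN; apply: pos; rewrite oppr_gt0.
- by rewrite gtr0_sg// mulr1; exact: pos.
- rewrite sgr0 mulr0; under eq_fun do rewrite mulr0 atan0 mulr0; exact: cvg_cst.
Unshelve. all: end_near. Qed.

Lemma measurable_sg (x : R) : measurable_fun setT ((fun r => pi * Num.sg (r - x)) : TR -> R).
Proof.
have h (n : nat) := @measurable_atanM n.+1%:R x.
by apply: (measurable_fun_cvg h) => r _; exact: cvg_atan_sg.
Qed.

Lemma cvg_smoothed_step x : smoothed_step n.+1%:R x @[n --> \oo] --> step x.
Proof.
apply: cvgD; first exact: cvg_atan_sg.
apply: cvgM; first exact: cvg_cst.
have ie := integrable_erlang 0 psi0.
have isg : mu.-integrable `[0, +oo[ (EFin \o (fun r => erlang 0 psi r * (pi * Num.sg (r - x)))).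
  apply: (integrable_bounded_mul (M := pi) mI (measurable_sg x) _ ie) => r.
  rewrite normrM normr_sg (ger0_norm (pi_ge0 R)) ler_piMr ?pi_ge0//.
  by case: (_ != 0).
apply: fine_cvg; rewrite fineK; last exact: integrable_fin_num.
apply: (@dominated_cvg _ _ _ mu `[0, +oo[ mI
  (fun n r => (erlang 0 psi r * (2 * atan (n.+1%:R * (r - x))))%:E)
  (fun r => (erlang 0 psi r * (pi * Num.sg (r - x)))%:E) (fun r => (pi * erlang 0 psi r)%:E)) => //.
- move=> n; apply/measurable_EFinP; apply: measurable_funTS; apply: measurable_funM.
    exact: continuous_measurable_fun (@continuous_erlang R 0 psi).
  exact: measurable_atanM.
- move=> r _; apply: cvg_EFin; first exact: nearW.
  by apply: cvgM; [exact: cvg_cst|exact: cvg_atan_sg].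
- exact: (integrableZl mI pi ie).
- move=> n r; rewrite /= in_itv/= andbT => r0; rewrite lee_fin normrM mulrC ler_pM//.
    exact: atan_le.
  by rewrite ger0_norm// erlang_ge0.
Qed.

Lemma Rintegral_erlang0_y (a : R) : 0 <= a ->
  Rintegral mu `[a, +oo[ (erlang 0 psi) = expR (- psi * a) / psi.
Proof.
move=> a0; have dF (r : R) : is_derive r 1 (fun r => - (erlang 0 psi r / psi)) (erlang 0 psi r).
  rewrite [X in is_derive _ _ X _](_ : _ = - (psi^-1 \*: erlang 0 psi)); last first.
    by apply/funext => y; rewrite mulrC.
  apply: (is_derive_eq (is_deriveN (is_deriveZ psi^-1 (is_derive_erlang0 psi r)))).
  by rewrite /GRing.scale/=; field; rewrite gt_eqF.
have iF : mu.-integrable `[a, +oo[ (EFin \o erlang 0 psi).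
  apply: (integrableS mI (measurable_itvR `[a, +oo[) _ (integrable_erlang 0 psi0)).
  by move=> r /=; rewrite !in_itv/= !andbT; exact: le_trans.
have lF : - (erlang 0 psi r / psi) @[r --> +oo] --> (0 : R).
  rewrite -oppr0 -(mul0r psi^-1); apply: cvgN; apply: cvgM; last exact: cvg_cst.
  exact: cvgy_erlang.
rewrite (FTC2y (@continuous_erlang R 0 psi) dF iF lF) sub0r opprK.
by rewrite /erlang expr0 mul1r fact0 divr1.
Qed.

(** At the jump x = 0 the value is pi, the mean of the one-sided limits; hence the exclusion of 0
    here and the condition [m [set 0] = 0] below. *)
Lemma stepE x : x != 0 -> step x = if 0 < x then 2 * pi * expR (- psi * x) else 0.
Proof.
move=> xn0; have ie := integrable_erlang 0 psi0.
have pn0 : psi != 0 by rewrite gt_eqF.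
have i0 : Rintegral mu `[0, +oo[ (erlang 0 psi) = psi^-1.
  by rewrite Rintegral_erlang0_y// mulr0 expR0 mul1r.
rewrite /step; case: ltP => [x0|x0]; last first.
  have {}x0 : x < 0 by rewrite lt_neqAle xn0.
  rewrite ltr0_sg// (_ : Rintegral _ _ _ = Rintegral mu `[0, +oo[ (fun r => pi * erlang 0 psi r)); last first.
    apply: eq_Rintegral => r; rewrite inE/= in_itv/= andbT => r0.
    by rewrite gtr0_sg ?mulr1 1?mulrC// subr_gt0 (lt_le_trans x0).
  by rewrite RintegralZl// i0; field.
have ip (A : set TR) : measurable A -> mu.-integrable `[0, +oo[ (EFin \o (erlang 0 psi \_ A)).
  move=> mA; apply: (le_integrable mI _ _ ie).
    apply/measurable_EFinP; apply: measurable_funTS; apply/(measurable_restrictT _ _).1 => //.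
    by apply: measurable_funTS; exact: continuous_measurable_fun (@continuous_erlang R 0 psi).
  by move=> r _ /=; rewrite lee_fin patchE; case: ifP => // _; rewrite normr0.
have icc := ip _ (measurable_itvR `[x, +oo[).
have ioc := ip _ (measurable_itvR `]x, +oo[).
have ib : mu.-integrable `[0, +oo[ (EFin \o (fun r => (erlang 0 psi \_ `[x, +oo[) r + (erlang 0 psi \_ `]x, +oo[) r - erlang 0 psi r)).
  exact: (integrableB mI (integrableD mI icc ioc) ie).
(* The sign of r - x is 1_[r >= x] + 1_[r > x] - 1, also at r = x. *)
rewrite (_ : Rintegral _ _ _ = Rintegral mu `[0, +oo[ (fun r => pi * ((erlang 0 psi \_ `[x, +oo[) r + (erlang 0 psi \_ `]x, +oo[) r - erlang 0 psi r))); last first.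
  apply: eq_Rintegral => r _; rewrite !patchE !mem_setE !in_itv/= !andbT.
  case: (ltgtP x r) => h.
  - by rewrite gtr0_sg ?subr_gt0//; ring.
  - rewrite ltr0_sg ?subr_lt0//.
    by transitivity (pi * (0 + 0 - erlang 0 psi r)) => //; ring.
  - by rewrite h subrr sgr0 mulr0 mulr0 addr0 subrr mulr0.
rewrite RintegralZl// RintegralB//; last exact: (integrableD mI icc ioc).
rewrite RintegralD// -!Rintegral_mkcondr.
have -> : `[0, +oo[ `&` `[x, +oo[ = `[x, +oo[%classic :> set R.
  by apply/setIidPr => r /=; rewrite !in_itv/= !andbT; exact: le_trans (ltW x0).
have -> : `[0, +oo[ `&` `]x, +oo[ = `]x, +oo[%classic :> set R.
  by apply/setIidPr => r /=; rewrite !in_itv/= !andbT => /ltW; exact: le_trans (ltW x0).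
rewrite Rintegral_itv_obnd_cbnd; last first.
  apply: (integrableS mI (measurable_itvR `]x, +oo[) _ ie).
  by move=> r /=; rewrite !in_itv/= !andbT => /ltW; exact: le_trans (ltW x0).
rewrite i0 Rintegral_erlang0_y ?(ltW x0)// gtr0_sg//; field; exact: pn0.
Qed.

(** The constant that dominates the passage to the limit: pi from each of the two summands, e^(-psi
    r) having integral 1 / psi. *)
Lemma smoothed_step_le N x : `|smoothed_step N x| <= 2 * pi.
Proof.
have ie := integrable_erlang 0 psi0.
have i2 : mu.-integrable `[0, +oo[ (EFin \o (fun r => erlang 0 psi r * (2 * atan (N * (r - x))))).
  by apply: (integrable_bounded_mul mI (measurable_atanM N x) _ ie) => r; exact: atan_le.
rewrite /smoothed_step (le_trans (ler_normD _ _))//.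
have -> : 2 * pi = pi + psi * (pi * psi^-1) :> R by field; rewrite gt_eqF.
rewrite lerD ?atan_le// normrM (ger0_norm (ltW psi0)) ler_wpM2l ?(ltW psi0)//.
rewrite (le_trans (le_normr_Rintegral mI i2))//.
have -> : pi * psi^-1 = Rintegral mu `[0, +oo[ (fun r => pi * erlang 0 psi r).
  by rewrite RintegralZl// Rintegral_erlang0_y// mulr0 expR0 mul1r.
apply: le_Rintegral => //.
- exact: integrable_norm.
- exact: (integrableZl mI pi ie).
- move=> r; rewrite /= in_itv/= andbT => r0; rewrite normrM mulrC ler_pM//.
    exact: atan_le.
  by rewrite ger0_norm// erlang_ge0.
Qed.

Lemma measurable_smoothed_step N : measurable_fun setT (smoothed_step N : TR -> R).
Proof.
apply: measurable_funD.
  have := measurable_atanM N 0; apply: eq_measurable_fun => r _; by rewrite subr0.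
apply: measurable_funM => //.
rewrite (_ : (fun x => _) = (fun x : TR => Rintegral rho setT (fun r => 2 * atan (N * (r - x))))); last first.
  by apply/funext => x; rewrite Rintegral_erlang//; exact: measurable_atanM.
apply: (@measurable_Rintegral2 _ rho rho (fun p => 2 * atan (N * (p.2 - p.1))) pi).
- apply: measurable_funM => //; apply: measurableT_comp.
    exact: continuous_measurable_fun (@continuous_atan R).
  by apply: measurable_funM => //; exact: measurable_funB.
- by move=> p; exact: atan_le.
Qed.

Lemma measurable_expstep : measurable_fun setT
  ((fun x => if 0 < x then expR (- psi * x) else 0) : TR -> R).
Proof.
apply: measurable_fun_ifT => //; first exact: measurable_fun_ltr.
by apply: measurableT_comp => //; exact: measurable_funM.
Qed.

Lemma integrable_expstep (m : {finite_measure set TR -> \bar R}) :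
  m.-integrable setT (EFin \o (fun x => if 0 < x then expR (- psi * x) else 0)).
Proof.
apply: (@bounded_integrable _ _ _ 1); first exact: measurable_expstep.
move=> x; case: ifPn => x0; last by rewrite normr0.
by rewrite ger0_norm ?expR_ge0// expR_le1 mulNr oppr_le0 mulr_ge0// ltW.
Qed.

Lemma cvg_Rintegral_smoothed_step (m : {finite_measure set TR -> \bar R}) : m [set 0] = 0%E ->
  Rintegral m setT (smoothed_step n.+1%:R) @[n --> \oo] -->
  2 * pi * Rintegral m setT (fun x => if 0 < x then expR (- psi * x) else 0).
Proof.
move=> m0; rewrite -RintegralZl//; last exact: integrable_expstep.
have i2 := integrableZl (@measurableT _ TR) (2 * pi) (integrable_expstep m).
apply: fine_cvg; rewrite fineK; last exact: integrable_fin_num.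
have [] := @dominated_convergence _ _ _ m setT measurableT
  (fun n x => (smoothed_step n.+1%:R x)%:E)
  (fun x => (2 * pi * (if 0 < x then expR (- psi * x) else 0))%:E) (fun=> (2 * pi)%:E) => //.
- by move=> n; apply/measurable_EFinP; exact: measurable_smoothed_step.
- apply/measurable_EFinP; apply: measurable_funM => //; exact: measurable_expstep.
- exists [set 0]; split => // x /=; apply: contra_notP => xn0 _.
  apply: cvg_EFin; first exact: nearW.
  have -> : 2 * pi * (if 0 < x then expR (- psi * x) else 0) = step x.
    by rewrite stepE; [case: ifP => // _; rewrite mulr0|exact/eqP].
  exact: cvg_smoothed_step.
- exact: finite_measure_integrable_cst.
- by apply: aeW => x n _; rewrite lee_fin smoothed_step_le.
Qed.

(* The factor 1/(psi + it) is the characteristic function of minus an exponential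
   variable, so the left-hand side is a density of the difference at 0. *)
Lemma exponential_inversion (m : {finite_measure set TR -> \bar R}) : m [set 0] = 0%E ->
  cintegrable setT (fun t => chr m t / (psi +i* t)) ->
  cintegral setT (fun t => chr m t / (psi +i* t)) =
  (2 * pi * Rintegral m setT (fun x => if 0 < x then expR (- psi * x) else 0))%:C.
Proof.
move=> m0; have -> : (fun t => chr m t / (psi +i* t)) = chr (subm m rho).
  by apply/funext => t; rewrite chr_subm chr_erlang expr1 opprK.
move=> [ir ii]; rewrite /cintegral; congr (_ +i* _).
  have l1 := cvg_Rintegral_abel ir.
  have l2 := cvg_Rintegral_smoothed_step m0.
  suff e : (fun n => Rintegral (abel_measure (harm0 n)) setT (fun t => complex.Re (chr (subm m rho) t))) =
      (fun n => Rintegral m setT (smoothed_step n.+1%:R)).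
    by rewrite e in l1; exact: (cvg_unique _ l1 l2).
  apply/funext => n; rewrite Rintegral_abel_Re_chr.
  have N0 : 0 < n.+1%:R :> R by [].
  rewrite (@Rintegral_subm _ _ _ _ (2 * n.+1%:R)); last 2 first.
  - have := continuous_measurable_fun (@continuous_atanM_deriv n.+1%:R 0).
    apply: eq_measurable_fun => x _; rewrite -poisson_kernelE//.
    by rewrite /poisson_kernel sub0r sqrrN.
  - move=> x; rewrite -[x]subr0 poisson_kernelE//; exact: atanM_deriv_le.
  by apply: eq_Rintegral => x _; rewrite Rintegral_poisson.
have l1 := cvg_Rintegral_abel ii.
have e : (fun n => Rintegral (abel_measure (harm0 n)) setT (fun t => complex.Im (chr (subm m rho) t))) = (fun=> 0).
  by apply/funext => n; exact: Rintegral_abel_Im_chr.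
by rewrite e in l1; exact: (cvg_unique _ l1 (cvg_cst _)).
Qed.

End inversion.

(** * Evaluation of the Meijer G-function *)

Section complex_integral_theory.
Context (R : realType).
Local Notation mu := (@lebesgue_measure R).
Local Notation TR := (measurableTypeR R).

Lemma cintegralMr (f : R -> R[i]) (w : R[i]) : cintegrable setT f ->
  cintegrable setT (fun t => f t * w) /\
  cintegral setT (fun t => f t * w) = cintegral setT f * w.
Proof.
case: w => a b [ir ii]; have mT := @measurableT _ TR.
have hr : (fun t => complex.Re (f t * (a +i* b))) = (fun t => complex.Re (f t) * a - complex.Im (f t) * b).
  by apply/funext => t; case: (f t).
have hi : (fun t => complex.Im (f t * (a +i* b))) = (fun t => complex.Re (f t) * b + complex.Im (f t) * a).
  by apply/funext => t; case: (f t).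
split.
  split; rewrite ?hr ?hi.
    exact: (integrableB mT (integrableZr mT a ir) (integrableZr mT b ii)).
  exact: (integrableD mT (integrableZr mT b ir) (integrableZr mT a ii)).
rewrite /cintegral hr hi RintegralB//; [|exact: (integrableZr mT a ir)|exact: (integrableZr mT b ii)].
rewrite RintegralD//; [|exact: (integrableZr mT b ir)|exact: (integrableZr mT a ii)].
by rewrite !RintegralZr.
Qed.

Lemma integrable_oneDsqrV : mu.-integrable setT (EFin \o (fun t : R => (1 + t ^+ 2)^-1)).
Proof.
have c : continuous (fun t : R => (1 + t ^+ 2)^-1).
  by move=> t; exact: continuous_oneDsqrV.
apply/integrableP; split; first by apply/measurable_EFinP; exact: continuous_measurable_fun.
have p0 (x : R) : 0 <= (1 + x ^+ 2)^-1 by rewrite invr_ge0 addr_ge0// sqr_ge0.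
under eq_integral do rewrite /= ger0_norm//.
rewrite ge0_symfun_integralT//; last by move=> x /=; rewrite sqrrN.
rewrite -set_itvcy [X in (_ * X)%E](_ : _ = (pi / 2)%:E); first by rewrite -EFinM ltry.
exact: integral0y_oneDsqr.
Qed.

Lemma measurable_Re_chr (m : {finite_measure set TR -> \bar R}) :
  measurable_fun setT (fun t : TR => complex.Re (chr m t)).
Proof.
apply: (@measurable_Rintegral2 _ m m (fun p => cos (p.1 * p.2)) 1); last by move=> p; exact: cos_max.
apply: measurableT_comp; first exact: continuous_measurable_fun (@continuous_cos R).
exact: measurable_funM.
Qed.

Lemma measurable_Im_chr (m : {finite_measure set TR -> \bar R}) :
  measurable_fun setT (fun t : TR => complex.Im (chr m t)).
Proof.
apply: (@measurable_Rintegral2 _ m m (fun p => sin (p.1 * p.2)) 1); last by move=> p; exact: sin_max.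
apply: measurableT_comp; first exact: continuous_measurable_fun (@continuous_sin R).
exact: measurable_funM.
Qed.

(** Each part is bounded by the mass, whence the factor 2; a bound uniform in [t] is the purpose. *)
Lemma normc_chr_le (m : {finite_measure set TR -> \bar R}) t :
  `|chr m t| <= (2 * fine (m setT))%:C.
Proof.
have b (g : TR -> R) : measurable_fun setT g -> (forall x, `|g x| <= 1) ->
    `|Rintegral m setT g| <= fine (m setT).
  move=> mg g1; have ig := bounded_integrable m mg g1.
  rewrite (le_trans (le_normr_Rintegral _ ig))// -[leRHS]mul1r -Rintegral_cst//.
  apply: le_Rintegral => //; first exact: integrable_norm.
  exact: finite_measure_integrable_cst.
have hc : `|Rintegral m setT (fun x => cos (t * x))| <= fine (m setT).
  by apply: b; [exact: measurable_cosM|move=> x; exact: cos_max].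
have hs : `|Rintegral m setT (fun x => sin (t * x))| <= fine (m setT).
  by apply: b; [exact: measurable_sinM|move=> x; exact: sin_max].
rewrite /chr; move: hc hs; set A := Rintegral _ _ _; set B := Rintegral _ _ _ => hc hs.
have -> : A +i* B = A%:C + 'i%C * B%:C by apply/eqP; rewrite eq_complex/=; apply/andP; split; apply/eqP; ring.
have -> : 'i%C * B%:C = 0 +i* B by apply/eqP; rewrite eq_complex/=; apply/andP; split; apply/eqP; ring.
rewrite (le_trans (ler_normD _ _))// !normc_def/= !expr0n/= addr0 add0r !sqrtr_sqr.
by rewrite -rmorphD/= lecR; lra.
Qed.

Lemma Re_le_normc (z : R[i]) B : `|z| <= B%:C -> `|complex.Re z| <= B /\ `|complex.Im z| <= B.
Proof.
case: z => a b; rewrite normc_def/= lecR => h; split; apply: le_trans h;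
  rewrite -sqrtr_sqr ler_wsqrtr// ?lerDl ?lerDr sqr_ge0//.
Qed.

(** Compares 1 / |a + it| with (1 + t^2)^(-1/2), so that two such factors give an integrable
    bound. *)
Lemma normc_line_ge (e a t : R) : 0 < e -> e <= 1 -> e <= a ->
  (e * Num.sqrt (1 + t ^+ 2))%:C <= `|a +i* t|.
Proof.
move=> e0 e1 ea; rewrite normc_def/= lecR.
rewrite -[X in X * _]ger0_norm ?(ltW e0)// -sqrtr_sqr -sqrtrM ?sqr_ge0//.
rewrite ler_wsqrtr// mulrDr mulr1 lerD//.
  by rewrite lerXn2r ?nnegrE ?(ltW e0)// (le_trans (ltW e0)).
rewrite ler_piMl ?sqr_ge0// expr_le1// ltW//.
Qed.

End complex_integral_theory.

(** * The inverse Mellin integral on one vertical line *)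

Section mellin_inversion.
Context (R : realType).
Local Notation mu := (@lebesgue_measure R).
Local Notation TR := (measurableTypeR R).
Variables (alpha beta c : R) (n : nat) (z : R) (psi : R).
Hypotheses (psi0 : 0 < psi) (psia : 0 < alpha - psi) (psib : 0 < beta - psi) (psic : 0 < c - psi).
Let L := ln z.

(* Moving the contour to Re s = psi multiplies the densities by exponentials, which
   amounts to lowering alpha, beta and c by psi. *)
Definition tilted_law : {finite_measure set TR -> \bar R} :=
  subm (subm (subm (erlang_measure n psic) (\d_(- L : TR)))
    (gdens_measure psia)) (gdens_measure psib).

Lemma chr_dirac (x t : R) : chr (\d_(x : TR)) t = cos (t * x) +i* sin (t * x).
Proof.
by congr (_ +i* _); rewrite /Rintegral integral_dirac// ?diracT ?mul1e//;
  apply/measurable_EFinP; [exact: measurable_cosM|exact: measurable_sinM].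
Qed.

(** Subtracting the point mass at - ln z contributes the phase z^(it); subtracting the log-Gamma
    laws puts -t in their transforms, giving Gamma(alpha - s) and Gamma(beta - s). *)
Lemma chr_tilted_law t : chr tilted_law t =
  (c%:C - (psi +i* t)) ^- n.+1 * (cos (t * L) +i* sin (t * L)) *
  cGamma (alpha%:C - (psi +i* t)) * cGamma (beta%:C - (psi +i* t)).
Proof.
rewrite !chr_subm chr_erlang chr_dirac mulrNN.
have sub (a : R) : a%:C - (psi +i* t) = (a - psi) +i* (- t).
  by apply/eqP; rewrite eq_complex/= sub0r !eqxx.
by rewrite !sub (cGammaE psia) (cGammaE psib).
Qed.

(** The last law subtracted has a density, so the difference has no atom. *)
Lemma tilted_law0 : tilted_law [set 0] = 0%E.
Proof.
apply: subm_set1 => y; rewrite /gdens_measure /fdens /= /dens.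
exact: integral_set1.
Qed.

(** One of the n + 1 factors 1 / (c - s) and the factor 1 / s each decay like 1 / |t|; everything
    else is bounded. *)
Lemma cintegrable_tilted : cintegrable setT (fun t => chr tilted_law t / (psi +i* t)).
Proof.
(* The quotient is itself a characteristic function, which supplies its measurability. *)
have e : (fun t => chr tilted_law t / (psi +i* t)) = chr (subm tilted_law (erlang_measure 0 psi0)).
  by apply/funext => t; rewrite chr_subm chr_erlang expr1 opprK.
(* One constant for which [normc_line_ge] applies both to c - s and to s. *)
pose d := Num.min 1 (Num.min (c - psi) psi).
have d0 : 0 < d by rewrite !lt_min ltr01 psic.
have d1 : d <= 1 by rewrite ge_min lexx.
have dc : d <= c - psi by rewrite !ge_min lexx orbT.
have dp : d <= psi by rewrite !ge_min lexx !orbT.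
have bnd (m : {finite_measure set TR -> \bar R}) : exists B : R, forall t, `|chr m t| <= B%:C.
  by exists (2 * fine (m setT)) => t; exact: normc_chr_le.
have [Bd hBd] := bnd (\d_(- L : TR)); have [Ba hBa] := bnd (gdens_measure psia).
have [Bb hBb] := bnd (gdens_measure psib).
pose K := (d ^+ n)^-1 * Bd * Ba * Bb * (d ^+ 2)^-1.
have bound t : `|chr tilted_law t / (psi +i* t)| <= (K * (1 + t ^+ 2)^-1)%:C.
  pose w := Num.sqrt (1 + t ^+ 2).
  have w20 : 0 <= 1 + t ^+ 2 by rewrite addr_ge0// sqr_ge0.
  have w1 : 1 <= w by rewrite -[leLHS]sqrtr1 ler_wsqrtr// lerDl sqr_ge0.
  have dw0 : 0 < d * w by rewrite mulr_gt0// (lt_le_trans ltr01).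
  have dwC : 0 < (d * w)%:C by rewrite ltcR.
  have dC : 0 <= d%:C by rewrite lecR ltW.
  have h1 : (d * w)%:C <= `|(c - psi) -i* t|.
    by rewrite /w -sqrrN; exact: normc_line_ge.
  have h2 : (d * w)%:C <= `|psi +i* t| by exact: normc_line_ge.
  have h1' : d%:C <= `|(c - psi) -i* t|.
    by apply: le_trans h1; rewrite lecR ler_peMr// ltW.
  (* n factors are bounded by 1 / d, and the last one keeps its decay. *)
  have e1 : `|chr (erlang_measure n psic) t| <= ((d ^+ n)^-1 * (d * w)^-1)%:C.
    rewrite chr_erlang normfV normrX exprSr invfM rmorphM/= ler_pM ?invr_ge0 ?exprn_ge0//.
      have n1 : 0 < `|(c - psi) -i* t| by exact: lt_le_trans dwC h1.
      have dC0 : 0 < d%:C by rewrite ltcR.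
      rewrite fmorphV rmorphXn lef_pV2 ?posrE; [|exact: exprn_gt0|exact: exprn_gt0].
      by rewrite lerXn2r ?nnegrE.
    by rewrite fmorphV/= lef_pV2 ?posrE// (lt_le_trans dwC).
  have e2 : `|(psi +i* t)^-1| <= ((d * w)^-1)%:C.
    by rewrite normfV fmorphV/= lef_pV2 ?posrE// (lt_le_trans dwC).
  have -> : K * (1 + t ^+ 2)^-1 = ((d ^+ n)^-1 * (d * w)^-1) * Bd * Ba * Bb * (d * w)^-1.
    have -> : 1 + t ^+ 2 = w ^+ 2 by rewrite sqr_sqrtr.
    rewrite /K; field; rewrite !gt_eqF ?exprn_gt0// (lt_le_trans ltr01)//.
  rewrite !chr_subm 4!normrM !rmorphM/=.
  by rewrite !ler_pM ?mulr_ge0// -rmorphM.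
have iK := integrableZl (@measurableT _ TR) K (integrable_oneDsqrV R).
split.
  apply: (le_integrable _ _ _ iK) => //.
    apply/measurable_EFinP.
    rewrite (_ : (fun t => _) = (fun t => complex.Re (chr (subm tilted_law (erlang_measure 0 psi0)) t))).
      exact: measurable_Re_chr.
    by apply/funext => t; rewrite -e.
  move=> t _ /=; rewrite lee_fin (le_trans (Re_le_normc (bound t)).1)// ler_norm//.
apply: (le_integrable _ _ _ iK) => //.
  apply/measurable_EFinP.
  rewrite (_ : (fun t => _) = (fun t => complex.Im (chr (subm tilted_law (erlang_measure 0 psi0)) t))).
    exact: measurable_Im_chr.
  by apply/funext => t; rewrite -e.
move=> t _ /=; rewrite lee_fin (le_trans (Re_le_normc (bound t)).2)// ler_norm//.
Qed.

Lemma ge0_integral_gdens a (a0 : 0 < a) (f : TR -> \bar R) : measurable_fun setT f ->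
  (forall x, 0 <= f x)%E ->
  (\int[gdens_measure a0]_x f x = \int[mu]_x (f x * (gdens a x)%:E))%E.
Proof. exact: ge0_integral_dens. Qed.

Lemma ge0_integral_erlang a (a0 : 0 < a) (f : TR -> \bar R) : measurable_fun setT f ->
  (forall x, 0 <= f x)%E ->
  (\int[erlang_measure n a0]_x f x = \int[mu]_x (f x * (erlangT n a x)%:E))%E.
Proof. exact: ge0_integral_dens. Qed.

Lemma integral_dirac_sub (u x : R) (f : TR -> \bar R) : measurable_fun setT f ->
  (\int[\d_(x : TR)]_y f (u - y)%R = f (u - x)%R)%E.
Proof.
move=> mf; rewrite integral_dirac ?diracT ?mul1e//.
by apply: (measurableT_comp mf); exact: measurable_funB.
Qed.

(* Let X and Y be independent logarithms of Gamma variables of parameters alpha and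
   beta. Up to the factor Gamma(alpha) Gamma(beta), [gg_law w] is P(X + Y <= w) and
   [gg_erlang] is c^-(n+1) P(X + Y <= U + ln z), with U of Erlang law. *)
Definition gg_inner (w : R) : \bar R := (\int[mu]_(v in `]-oo, w]) (gdens beta v)%:E)%E.

Definition gg_law (w : R) : \bar R :=
  (\int[mu]_x ((gdens alpha x)%:E * gg_inner (w - x)))%E.

Definition gg_erlang : \bar R := (\int[mu]_u ((erlangT n c u)%:E * gg_law (u + L)%R))%E.

Let g (x : R) : R := if 0 < x then expR (- psi * x) else 0.

Let mg : measurable_fun setT (g : TR -> R). Proof. exact: measurable_expstep. Qed.

Let g0 x : 0 <= g x. Proof. by rewrite /g; case: ifP => // _; exact: expR_ge0. Qed.

Lemma measurable_integral_sub (m : {finite_measure set TR -> \bar R}) (h : TR -> \bar R) :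
  measurable_fun setT h -> (forall x, 0 <= h x)%E ->
  measurable_fun setT (fun x : TR => \int[m]_y h (x - y : R)%R)%E.
Proof.
move=> mh h0.
have := @measurable_fun_fubini_tonelli_F _ _ TR TR R m (h \o (@subp R)).
apply; last by move=> x; exact: h0.
by apply: measurableT_comp => //; exact: measurable_subp.
Qed.

(** The kernel e^(-psi(w - y)) restores [gdens beta] from the tilted density and leaves the factor
    e^(-psi w), ready to untilt the next law. *)
Lemma tilted_inner (w : R) :
  (\int[gdens_measure psib]_y (g (w - y))%:E = (expR (- psi * w))%:E * gg_inner w)%E.
Proof.
have mgw : measurable_fun setT (fun y : TR => g (w - y)).
  by apply: measurableT_comp => //; exact: measurable_funB.
rewrite ge0_integral_gdens; [|exact/measurable_EFinP|by move=> x; rewrite lee_fin].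
(* [g] imposes y < w strictly; the endpoint is a null set. *)
rewrite /gg_inner -integral_itv_bndo_bndc; last first.
  by apply/measurable_EFinP; apply: measurable_funTS; exact: measurable_gdens.
rewrite -ge0_integralZl_EFin; first last.
- exact: expR_ge0.
- by apply/measurable_EFinP; apply: measurable_funTS; exact: measurable_gdens.
- by move=> x _; rewrite lee_fin gdens_ge0.
- exact: measurable_itvR.
rewrite [RHS]integral_mkcond; apply: eq_integral => y _.
rewrite patchE mem_setE in_itv/= /g subr_gt0; case: ifP => _; last by rewrite mul0e.
by rewrite -!EFinM /gdens -!expRD; congr (expR _)%:E; ring.
Qed.

Lemma gg_inner_ge0 w : (0 <= gg_inner w)%E.
Proof. by apply: integral_ge0 => x _; rewrite lee_fin gdens_ge0. Qed.

(** Up to an exponential factor this is an integral against a finite measure, by [tilted_inner]. *)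
Lemma measurable_gg_inner : measurable_fun setT (gg_inner : TR -> \bar R).
Proof.
rewrite (_ : gg_inner = (fun w => (expR (psi * w))%:E * \int[gdens_measure psib]_y (g (w - y))%:E)%E); last first.
  apply/funext => w; rewrite tilted_inner muleA -EFinM -expRD.
  by rewrite mulNr subrr expR0 mul1e.
apply: emeasurable_funM.
  by apply/measurable_EFinP; apply: measurableT_comp => //; exact: measurable_funM.
apply: (@measurable_integral_sub _ (EFin \o g)); first exact/measurable_EFinP.
by move=> x; rewrite lee_fin.
Qed.

Let h1 (w : R) : \bar R := ((expR (- psi * w))%:E * gg_inner w)%E.

Let h1_ge0 w : (0 <= h1 w)%E.
Proof. by rewrite mule_ge0 ?gg_inner_ge0// lee_fin expR_ge0. Qed.

Let mexp (a : R) : measurable_fun setT (fun w : TR => (expR (a * w))%:E).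
Proof. by apply/measurable_EFinP; apply: measurableT_comp => //; exact: measurable_funM. Qed.

Let mh1 : measurable_fun setT (h1 : TR -> \bar R).
Proof. by apply: emeasurable_funM => //; exact: measurable_gg_inner. Qed.

Lemma measurable_gg_integrand (w : R) :
  measurable_fun setT (fun x : TR => (gdens alpha x)%:E * gg_inner (w - x)%R)%E.
Proof.
apply: emeasurable_funM; first by apply/measurable_EFinP; exact: measurable_gdens.
by apply: (measurableT_comp measurable_gg_inner); exact: measurable_funB.
Qed.

Lemma tilted_middle (w : R) :
  (\int[gdens_measure psia]_y h1 (w - y) = (expR (- psi * w))%:E * gg_law w)%E.
Proof.
have mhw : measurable_fun setT (fun y : TR => h1 (w - y)).
  by apply: (measurableT_comp mh1); exact: measurable_funB.
rewrite ge0_integral_gdens; [|exact: mhw|by move=> x; exact: h1_ge0].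
rewrite /gg_law -ge0_integralZl_EFin; first last.
- exact: expR_ge0.
- exact: measurable_gg_integrand.
- by move=> x _; rewrite mule_ge0 ?gg_inner_ge0// lee_fin gdens_ge0.
- exact: measurableT.
apply: eq_integral => y _; rewrite /h1 muleAC muleA -!EFinM.
by congr (_%:E * _)%E; rewrite /gdens -!expRD; congr expR; ring.
Qed.

Lemma gg_law_ge0 w : (0 <= gg_law w)%E.
Proof. by apply: integral_ge0 => x _; rewrite mule_ge0 ?gg_inner_ge0// lee_fin gdens_ge0. Qed.

Lemma measurable_gg_law : measurable_fun setT (gg_law : TR -> \bar R).
Proof.
rewrite (_ : gg_law = (fun w => (expR (psi * w))%:E * \int[gdens_measure psia]_y h1 (w - y))%E); last first.
  apply/funext => w; rewrite tilted_middle muleA -EFinM -expRD.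
  by rewrite mulNr subrr expR0 mul1e.
by apply: emeasurable_funM => //; exact: measurable_integral_sub.
Qed.

(** The laws are peeled off one by one, each being untilted by the exponential passed on from the
    previous stage. The right-hand side is free of psi, hence the line is irrelevant. *)
Lemma tilted_integral :
  (expR (psi * L) * Rintegral tilted_law setT g)%:E = gg_erlang.
Proof.
have ig := integrable_expstep psi0 tilted_law.
rewrite EFinM /Rintegral fineK; last exact: integrable_fin_num.
rewrite ge0_integral_subm//; last exact/measurable_EFinP.
rewrite (eq_integral (fun w : TR => h1 w)); last by move=> w _; exact: tilted_inner.
rewrite ge0_integral_subm; [|exact: mh1|exact: h1_ge0].
pose h2 (w : R) : \bar R := ((expR (- psi * w))%:E * gg_law w)%E.
rewrite (eq_integral (fun w : TR => h2 w)); last by move=> w _; exact: tilted_middle.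
have h20 w : (0 <= h2 w)%E by rewrite mule_ge0 ?gg_law_ge0// lee_fin expR_ge0.
have mh2 : measurable_fun setT (h2 : TR -> \bar R).
  by apply: emeasurable_funM => //; exact: measurable_gg_law.
rewrite ge0_integral_subm; [|exact: mh2|exact: h20].
have mL : measurable_fun setT (fun u : TR => h2 (u + L)).
  by apply: (measurableT_comp mh2); exact: measurable_funD.
rewrite (eq_integral (fun u : TR => h2 (u + L))); last first.
  move=> u _; have uL : u + L = u - - L by rewrite opprK.
  by rewrite uL; exact: integral_dirac_sub.
rewrite ge0_integral_erlang; [|exact: mL|by move=> u; exact: h20].
rewrite -ge0_integralZl_EFin; first last.
- exact: expR_ge0.
- by apply: emeasurable_funM; [exact: mL|apply/measurable_EFinP; exact: measurable_erlangT].
- by move=> x _; rewrite mule_ge0 ?h20// lee_fin erlangT_ge0.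
- exact: measurableT.
apply: eq_integral => u _.
(* The last tilt, that of the Erlang density, takes up what is left of the exponentials, including
   the prefactor z^psi. *)
have -> : erlangT n c u = expR (psi * L) * (expR (- psi * (u + L)) * erlangT n (c - psi) u).
  rewrite /erlangT !patchE; case: ifPn => _; last by rewrite !mulr0.
  have -> : expR (psi * L) * (expR (- psi * (u + L)) * erlang n (c - psi) u) =
    u ^+ n * (expR (psi * L) * expR (- psi * (u + L)) * expR (- (c - psi) * u)) / n`!%:R.
    by rewrite /erlang; ring.
  by rewrite -!expRD; congr (_ * expR _ / _); ring.
rewrite !EFinM -!muleA; congr (_ * _)%E.
by rewrite /h2; congr (_ * _)%E; exact: muleC.
Qed.

End mellin_inversion.
(** The integrand with its special values made opaque: [g] is Gamma(c - s), [w] is c - s, [h] is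
    Gamma(s), [a] and [b] are the two other Gamma factors, and [e] and [p] are the modulus and the
    phase of z^s. *)
Lemma meijer_cancel (F : fieldType) (m : nat) (a b g h w s e p i : F) :
  g != 0 -> h != 0 -> w != 0 -> s != 0 ->
  a * (b * g ^+ m) * h / (s * h * (w * g) ^+ m) * (e * p) * i =
  w ^- m * p * a * b / s * (e * i).
Proof.
move=> g0 h0 w0 s0; rewrite exprMn.
by field; rewrite s0 h0 !expf_neq0.
Qed.

(** * Poles, separating lines and the value of the G-function *)

Section meijer_value.
Context (R : realType).
Variables (alpha beta c : R) (n : nat) (z : R).
Hypotheses (alpha0 : 0 < alpha) (beta0 : 0 < beta) (c0 : 0 < c) (z0 : 0 < z).

(** For n = 2k these are the parameter lists of the theorem. The first n + 3 entries of [lb] belong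
    to the numerator, and the final 0 to the denominator. *)
Let la : seq R[i] := 1 :: nseq (n + 1) (c + 1)%:C.
Let lb : seq R[i] := alpha%:C :: beta%:C :: nseq (n + 1) c%:C ++ [:: 0].

Lemma lb_nth_lt j : (j < n + 1)%N -> lb`_j.+2 = c%:C.
Proof. by move=> jn; rewrite /lb/= nth_cat size_nseq jn nth_nseq jn. Qed.

(** Only the extreme poles matter: alpha, beta and c on the right, 0 on the left. The other poles
    lie a natural number further out. *)
Lemma separating_lineP (psi : R) :
  separating_line (n + 3) 1 la lb psi <-> [/\ 0 < psi, psi < alpha, psi < beta & psi < c].
Proof.
split=> [[h1 h2]|[p0 pa pb pc]].
  split.
  - by have := h2 0%N 0%N 0 isT; apply; rewrite /la/= subrr addr0 oppr0.
  - by have := h1 0%N 0%N alpha%:C; apply; rewrite ?addn3//= subrr oppr0.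
  - by have := h1 1%N 0%N beta%:C; apply; rewrite ?addn3//= subrr oppr0.
  - have := h1 2%N 0%N c%:C; apply; rewrite ?addn3//.
    by rewrite lb_nth_lt ?addn1// subrr oppr0.
have reals (r : R) l (s : R[i]) : psi < r -> r%:C - s = - l%:R -> psi < complex.Re s.
  move=> pr /(congr1 (@complex.Re R)); rewrite raddfB/= raddfN/= => e.
  have -> : complex.Re s = r + l%:R.
    have : complex.Re (l%:R : R[i]) = l%:R by rewrite -[l%:R]/(l%:R) raddfMn.
    by move: e => /[swap] ->; lra.
  by rewrite (lt_le_trans pr)// lerDl.
split=> [j l s jn|j l s].
  case: j jn => [|[|j]] jn; [exact: reals|exact: reals|].
  rewrite lb_nth_lt; first exact: reals.
  by move: jn; rewrite addn3 addn1.
case: j => // _; rewrite /la/= subrr add0r => ->.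
rewrite raddfN/= (_ : complex.Re (l%:R : R[i]) = l%:R); last by rewrite raddfMn.
by rewrite (le_lt_trans _ p0)// oppr_le0.
Qed.

Section line.
Variable psi : R.
Hypotheses (psi0 : 0 < psi) (psia : 0 < alpha - psi) (psib : 0 < beta - psi) (psic : 0 < c - psi).

Lemma meijer_on_lineE t : meijer_on_line (n + 3) 1 la lb z psi t =
  chr (tilted_law n z psia psib psic) t / (psi +i* t) * ((expR (psi * ln z))%:C * 'i%C).
Proof.
rewrite chr_tilted_law /meijer_on_line /meijer_integrand.
set s := psi +i* t.
have Rsub (a : R) : 0 < a - psi -> 0 < complex.Re (a%:C - s) by rewrite raddfB/=.
have g0 (a : R) : 0 < a - psi -> cGamma (a%:C - s) != 0 by move=> /Rsub; exact: cGamma_neq0.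
have p1 : \prod_(0 <= j < n + 3) cGamma (lb`_j - s) =
    cGamma (alpha%:C - s) * (cGamma (beta%:C - s) * cGamma (c%:C - s) ^+ n.+1).
  rewrite addn3 big_nat_recl// big_nat_recl//; congr (_ * (_ * _)).
  rewrite (@eq_big_nat _ _ _ _ _ _ (fun=> cGamma (c%:C - s))) ?prodr_const_nat ?subn0//.
  move=> j /andP[_ jn]; congr cGamma; congr (_ - _).
  by apply: lb_nth_lt; rewrite addn1.
have p2 : \prod_(0 <= j < 1) cGamma (1 - la`_j + s) = cGamma s.
  by rewrite big_nat1/= subrr add0r.
(* The entry 0 yields Gamma(1 + s) = s Gamma(s); its Gamma(s) cancels the one produced by the upper
   parameter 1. *)
have p3 : \prod_(n + 3 <= j < size lb) cGamma (1 - lb`_j + s) = s * cGamma s.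
  have -> : size lb = (n + 3).+1 by rewrite /lb/= size_cat size_nseq/= addn1 addn3 addn1.
  rewrite big_nat1 addn3 /lb/= nth_cat size_nseq addn1 ltnn subnn/= subr0 addrC.
  by rewrite cGamma_rec.
have p4 : \prod_(1 <= j < size la) cGamma (la`_j - s) = ((c%:C - s) * cGamma (c%:C - s)) ^+ n.+1.
  rewrite /la/= size_nseq addn1 (@eq_big_nat _ _ _ _ _ _ (fun=> (c%:C - s) * cGamma (c%:C - s))).
    by rewrite prodr_const_nat subn1.
  move=> [//|j] /andP[_ jn]; rewrite -[_`__]/((nseq n.+1 _)`_j) nth_nseq -ltnS jn -cGamma_rec; last exact: Rsub.
  by congr cGamma; rewrite rmorphD/= rmorph1 addrAC.
have pw : cpow z s = (expR (psi * ln z))%:C * (cos (t * ln z) +i* sin (t * ln z)).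
  by rewrite /cpow /cexp /s/= !mulr0 subr0 add0r.
have s0 : s != 0 by rewrite eq_complex/= gt_eqF.
have gs0 : cGamma s != 0 by apply: cGamma_neq0.
have cs0 : c%:C - s != 0.
  by apply/eqP => /(congr1 (@complex.Re R)); rewrite raddfB/= => /eqP; rewrite gt_eqF.
have gc0 := g0 _ psic; rewrite p1 p2 p3 p4 pw; exact: meijer_cancel.
Qed.

Lemma meijer_line_integralE :
  cintegrable setT (meijer_on_line (n + 3) 1 la lb z psi) /\
  meijer_line_integral (n + 3) 1 la lb z psi = (fine (gg_erlang alpha beta c n z))%:C.
Proof.
have [i1 i2] := cintegralMr ((expR (psi * ln z))%:C * 'i%C) (cintegrable_tilted n z psi0 psia psib psic).
have e : meijer_on_line (n + 3) 1 la lb z psi =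
    (fun t => chr (tilted_law n z psia psib psic) t / (psi +i* t) * ((expR (psi * ln z))%:C * 'i%C)).
  by apply/funext => t; exact: meijer_on_lineE.
rewrite /meijer_line_integral e; split; first exact: i1.
rewrite i2 exponential_inversion//; [|exact: tilted_law0|exact: cintegrable_tilted].
rewrite -(tilted_integral n z psi0 psia psib psic)/=.
set I := Rintegral _ _ _.
have pi0 : (2 * pi : R)%:C != 0 by rewrite eq_complex/= eqxx andbT mulf_neq0// gt_eqF// pi_gt0.
have i0 : 'i%C != 0 :> R[i] by rewrite eq_complex/= oner_eq0 andbF.
have -> : (2 * pi * I)%:C = (2 * pi)%:C * I%:C by exact: rmorphM.
have -> : (expR (psi * ln z) * I)%:C = (expR (psi * ln z))%:C * I%:C by exact: rmorphM.
move: pi0 i0; set X := (2 * pi)%:C; set Y := 'i%C; set E := (expR _)%:C; set J := I%:C => X0 Y0.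
have -> : X * J * (E * Y) = X * Y * (E * J) by ring.
by rewrite mulKf ?mulf_neq0.
Qed.

End line.

(** Any admissible line shows it through [tilted_integral]; half the least of the three parameters
    provides one. *)
Lemma gg_erlang_fin : gg_erlang alpha beta c n z \is a fin_num.
Proof.
pose d := Num.min alpha (Num.min beta c) / 2.
have m0 : 0 < Num.min alpha (Num.min beta c) by rewrite !lt_min alpha0 beta0.
have d0 : 0 < d by rewrite divr_gt0.
have dm : d < Num.min alpha (Num.min beta c) by rewrite ltr_pdivrMr// ltr_pMr// ltr1n.
move: dm; rewrite !lt_min => /and3P[da db dc].
move: da db dc; rewrite -subr_gt0 => da; rewrite -subr_gt0 => db; rewrite -subr_gt0 => dc.
by rewrite -(tilted_integral n z d0 da db dc).
Qed.

Lemma exists_separating_line : exists psi, separating_line (n + 3) 1 la lb psi.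
Proof.
pose m := Num.min alpha (Num.min beta c).
have m0 : 0 < m by rewrite !lt_min alpha0 beta0.
have : m / 2 < m by rewrite ltr_pdivrMr// ltr_pMr// ltr1n.
rewrite !lt_min => /and3P[? ? ?].
by exists (m / 2); apply/separating_lineP; split => //; rewrite divr_gt0.
Qed.

Lemma meijerG_erlang : meijerG (n + 3) 1 la lb z = (fine (gg_erlang alpha beta c n z))%:C.
Proof.
have [p0 pa pb pc] := (separating_lineP _).1 (xgetPex 0 exists_separating_line).
by rewrite /meijerG (meijer_line_integralE p0 _ _ _).2 ?subr_gt0.
Qed.

Lemma meijerG_erlang_wd : meijerG_wd (n + 3) 1 la lb z.
Proof.
split; first exact: exists_separating_line.
move=> psi /separating_lineP[p0]; rewrite -subr_gt0 => pa; rewrite -subr_gt0 => pb.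
rewrite -subr_gt0 => pc.
by rewrite meijerG_erlang; exact: meijer_line_integralE.
Qed.

End meijer_value.

(** * The laws of the channel factors *)

Section gamma_gamma.
Context (R : realType).
Local Notation mu := (@lebesgue_measure R).
Local Notation TR := (measurableTypeR R).

(** Integrability of [k] is inherited from the folded [f], as [r] is invertible. *)
Lemma Rintegral_fold_scale (f k : R -> R) (r : R) : r != 0 ->
  mu.-integrable setT (EFin \o f) -> (forall t, f t + f (- t) = r * k t) ->
  Rintegral mu setT f = r * Rintegral mu `[0, +oo[ k.
Proof.
move=> r0 intf fk; rewrite Rintegral_fold//.
have kE : k = (fun t => r^-1 * (f t + f (- t))) by apply/funext => t; rewrite fk mulKf.
have i2 : mu.-integrable `[0, +oo[ (EFin \o (fun t => f t + f (- t))).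
  have := integrableD (@measurableT _ TR) intf (integrable_fold intf).
  by apply: integrableS => //; exact: measurable_itvR.
by rewrite kE RintegralZl; [rewrite mulVKf|exact: measurable_itvR|exact: i2].
Qed.

Lemma gdens_bounded (b x : R) : 0 < b -> gdens b x <= expR (b * (ln b - 1)).
Proof.
move=> b0; rewrite /gdens ler_expR.
have : b * (1 + (x - ln b)) <= b * expR (x - ln b) by rewrite ler_pM2l// expR_ge1Dx.
rewrite expRB lnK ?posrE// mulrCA mulfV ?gt_eqF// mulr1.
by move=> h; lra.
Qed.

Variables (alpha beta : R).
Hypotheses (alpha0 : 0 < alpha) (beta0 : 0 < beta).

(* Gamma(alpha) Gamma(beta) times the density of ln (alpha beta hs). *)
Definition gg_conv (w : R) : R :=
  Rintegral mu setT (fun x => gdens alpha x * gdens beta (w - x)).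

Let mgb (w : R) : measurable_fun setT (fun x : TR => gdens beta (w - x)).
Proof. by apply: (measurableT_comp (measurable_gdens beta)); exact: measurable_funB. Qed.

Let gdens_normr_le (x : R) : `|gdens beta x| <= expR (beta * (ln beta - 1)).
Proof. by rewrite ger0_norm ?gdens_ge0// gdens_bounded. Qed.

Lemma integrable_gg_conv w :
  mu.-integrable setT (EFin \o (fun x => gdens alpha x * gdens beta (w - x))).
Proof.
apply: (@integrable_bounded_mul _ setT _ _ (expR (beta * (ln beta - 1)))) => //.
exact: integrable_gdens.
Qed.

Lemma gg_convE w : (gg_conv w)%:E = (\int[mu]_x (gdens alpha x * gdens beta (w - x))%:E)%E.
Proof. by rewrite /gg_conv /Rintegral fineK//; exact: integrable_fin_num (integrable_gg_conv w). Qed.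

Lemma gg_conv_ge0 w : 0 <= gg_conv w.
Proof. by rewrite -lee_fin gg_convE integral_ge0// => x _; rewrite lee_fin mulr_ge0 ?gdens_ge0. Qed.

Lemma measurable_gg_conv : measurable_fun setT (gg_conv : TR -> R).
Proof.
rewrite (_ : gg_conv = (fun w => Rintegral (gdens_measure alpha0) setT (fun x => (gdens beta \o @subp R) (w, x)))).
  apply: (@measurable_Rintegral2 _ (gdens_measure alpha0) (gdens_measure alpha0) _ (expR (beta * (ln beta - 1)))).
    exact: measurableT_comp (measurable_gdens beta) (@measurable_subp R).
  by move=> p; exact: gdens_normr_le.
by apply/funext => w; exact/esym/(Rintegral_gdens alpha0 (mgb w)).
Qed.

(** After recentring at w/2 the two exponentials add up to 2 e^(w/2) cosh t, and folding turns
    e^((alpha - beta)t) into a hyperbolic cosine. *)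
Lemma gg_conv_besselK w : gg_conv w =
  2 * expR ((alpha + beta) / 2 * w) * besselK (alpha - beta) (2 * expR (w / 2)).
Proof.
pose f t := gdens alpha (t + w / 2) * gdens beta (w / 2 - t).
pose g x := gdens alpha x * gdens beta (w - x).
have fg t : f t = g (t + w / 2) by rewrite /f /g; congr (_ * gdens _ _); lra.
have mg : measurable_fun setT (EFin \o g : TR -> \bar R).
  by have /integrableP[] := integrable_gg_conv w.
have if_ : mu.-integrable setT (EFin \o f).
  have := (iffRL (integrableT_shift (w / 2) mg)) (integrable_gg_conv w).
  by rewrite (_ : (fun x => _) = EFin \o f)//; apply/funext => x; rewrite /= fg.
have h := integralT_shift (w / 2) mg.
have -> : gg_conv w = Rintegral mu setT f.
  have hf : (\int[mu]_x (f x)%:E = \int[mu]_x (g x)%:E)%E.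
    rewrite -[RHS]/(\int[mu]_x ((EFin \o g) x))%E -h.
    by apply: eq_integral => x _; rewrite fg.
  by rewrite /gg_conv /Rintegral hf.
apply: Rintegral_fold_scale if_ _ => [|t].
  by apply: lt0r_neq0; apply: mulr_gt0; [exact: ltr0n|exact: expR_gt0].
rewrite /f /gdens /cosh -!expRD !opprK.
have e1 : alpha * (t + w / 2) - expR (t + w / 2) + (beta * (w / 2 - t) - expR (w / 2 - t)) =
  (alpha + beta) / 2 * w - 2 * expR (w / 2) * ((expR t + expR (- t)) / 2) + (alpha - beta) * t.
  by rewrite !expRD; lra.
have e2 : alpha * (- t + w / 2) - expR (- t + w / 2) + (beta * (w / 2 + t) - expR (w / 2 + t)) =
  (alpha + beta) / 2 * w - 2 * expR (w / 2) * ((expR t + expR (- t)) / 2) - (alpha - beta) * t.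
  by rewrite !expRD; lra.
rewrite e1 e2 mulNr; set A := expR t + expR (- t); set B := _ * (A / 2); set C := _ / 2 * w.
set D := (_ - _) * t.
by rewrite !expRD; field.
Qed.

(** With w = ln (alpha beta x) the Bessel argument 2 sqrt(alpha beta x) is 2 e^(w/2); the last
    factor is the Jacobian 1 / x. *)
Lemma gamma_gamma_densityE x : 0 < x -> gamma_gamma_density alpha beta x =
  gg_conv (ln (alpha * beta * x)) / (Gamma alpha * Gamma beta) * expR (- ln x).
Proof.
move=> x0; have ab0 : 0 < alpha * beta by rewrite mulr_gt0.
have w0 : 0 < alpha * beta * x by rewrite mulr_gt0.
rewrite gg_conv_besselK /gamma_gamma_density.
set w := ln (alpha * beta * x).
have -> : Num.sqrt (alpha * beta * x) = expR (w / 2).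
  rewrite -[alpha * beta * x](lnK (x := alpha * beta * x)) ?posrE// -/w.
  have -> : expR w = expR (w / 2) ^+ 2 by rewrite -expRM_natl; congr expR; lra.
  by rewrite sqrtr_sqr ger0_norm// expR_ge0.
have wE : w = ln (alpha * beta) + ln x by rewrite /w lnM ?posrE.
rewrite /powR !gt_eqF//.
set s := (alpha + beta) / 2; set K := besselK _ _.
have e : expR (s * ln (alpha * beta)) * expR ((s - 1) * ln x) = expR (s * w) * expR (- ln x).
  by rewrite -!expRD; congr expR; rewrite wE; ring.
transitivity (2 / (Gamma alpha * Gamma beta) * K * (expR (s * ln (alpha * beta)) * expR ((s - 1) * ln x))).
  by ring.
by rewrite e; ring.
Qed.

Let mL (P : pred R) (i : interval R) (f : TR -> R) : (forall x, P x = (x \in i)) ->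
  measurable_fun setT f -> measurable_fun setT (fun x : TR => if P x then f x else 0).
Proof.
move=> Pi mf.
rewrite (_ : (fun x => _) = f \_ [set` i]).
  apply/(measurable_restrictT _ _).1; first exact: measurable_itvR.
  exact: measurable_funTS.
by apply/funext => x; rewrite patchE mem_setE Pi.
Qed.

(** Tonelli, after translating the inner variable by x. *)
Lemma gg_lawE w : gg_law alpha beta w =
  (\int[mu]_x (if (x <= w)%R then gg_conv x else 0)%:E)%E.
Proof.
pose h (p : TR * TR) : \bar R := (if (p.2 <= w)%R then gdens alpha p.1 * gdens beta (p.2 - p.1) else 0)%:E.
have h0 p : (0 <= h p)%E by rewrite lee_fin; case: ifP => // _; rewrite mulr_ge0 ?gdens_ge0.
have mh : measurable_fun setT h.
  apply/measurable_EFinP.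
  rewrite (_ : (fun p => _) = (fun p => (if (p.2 <= w)%R then 1 else 0) * (gdens alpha p.1 * gdens beta (p.2 - p.1)))).
    apply: measurable_funM.
      apply: (@measurableT_comp _ _ _ _ _ _ (fun y : TR => if (y <= w)%R then 1 else 0 : R) _ snd) => //.
      by apply: (@mL _ `]-oo, w]) => // y; rewrite in_itv.
    apply: measurable_funM; first exact: (measurableT_comp (measurable_gdens alpha)).
    by apply: (measurableT_comp (measurable_gdens beta)); exact: measurable_funB.
  by apply/funext => p; case: ifP => _; rewrite ?mul1r ?mul0r.
have -> : (\int[mu]_x (if (x <= w)%R then gg_conv x else 0)%:E = \int[mu]_y \int[mu]_x h (x, y))%E.
  apply: eq_integral => y _; rewrite /h /=; case: ifP => _; first exact: gg_convE.
  by rewrite integral0.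
rewrite -fubini_tonelli//; apply: eq_integral => x _.
pose k (v : TR) : \bar R := (if (v <= w - x)%R then gdens beta v else 0)%:E.
have mk : measurable_fun setT k.
  by apply/measurable_EFinP; apply: (@mL _ `]-oo, (w - x)]); [move=> y; rewrite in_itv|exact: measurable_gdens].
have k0 v : (0 <= k v)%E by rewrite lee_fin; case: ifP => // _; exact: gdens_ge0.
have -> : gg_inner beta (w - x) = (\int[mu]_y k y)%E.
  rewrite /gg_inner integral_mkcond; apply: eq_integral => y _.
  by rewrite patchE mem_setE in_itv/= /k; case: ifP.
rewrite -(integralT_shift (- x) mk) -ge0_integralZl_EFin; first last.
- exact: gdens_ge0.
- by apply: (measurableT_comp mk); exact: measurable_funD.
- by move=> y _; exact: k0.
- exact: measurableT.
apply: eq_integral => y _; rewrite /k /h lerD2r/=; case: ifP => _; first by rewrite -EFinM.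
by rewrite mule0.
Qed.

(** The substitution x = e^t removes the Jacobian, and a shift by ln (alpha beta) matches the
    argument of [gg_conv]. *)
Lemma integral_gamma_gamma_density y : 0 < y ->
  (\int[mu]_(x in `]-oo, y] `&` `]0%R, +oo[) (gamma_gamma_density alpha beta x)%:E =
   ((Gamma alpha * Gamma beta)^-1)%:E * gg_law alpha beta (ln (alpha * beta * y)))%E.
Proof.
move=> y0; have ab0 : 0 < alpha * beta by rewrite mulr_gt0.
pose c := (Gamma alpha * Gamma beta)^-1.
have c0 : 0 <= c by rewrite invr_ge0 mulr_ge0// ltW// Gamma_gt0.
pose l := ln (alpha * beta).
pose h (w : TR) : R := if (w <= ln (alpha * beta * y))%R then gg_conv w else 0.
have mh : measurable_fun setT h.
  by apply: (@mL _ `]-oo, (ln (alpha * beta * y))]); [move=> w; rewrite in_itv|exact: measurable_gg_conv].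
have h0 w : 0 <= h w by rewrite /h; case: ifP => // _; exact: gg_conv_ge0.
pose G (x : TR) : R := c * h (ln x + l) * expR (- ln x).
have mln : measurable_fun setT (@ln R : TR -> TR) by exact: measurable_ln.
have mG : measurable_fun setT G.
  apply: measurable_funM.
    have m1 : measurable_fun setT (fun x : TR => ln x + l : TR) by exact: measurable_funD.
    exact: measurable_funM (measurable_cst c) (measurableT_comp mh m1).
  by apply: measurableT_comp => //; exact: measurableT_comp.
transitivity (\int[mu]_(x in `]0%R, +oo[) (G x)%:E)%E.
  rewrite [LHS]integral_mkcond [RHS]integral_mkcond; apply: eq_integral => x _.
  rewrite !patchE in_setI !mem_setE !in_itv/= andbT.
  have [x0|x0] := ltP 0 x; last by rewrite andbF.
  rewrite andbT /G /h /l addrC -lnM ?posrE//.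
  have <- : (x <= y) = (ln (alpha * beta * x) <= ln (alpha * beta * y)).
    by rewrite ler_ln ?posrE ?mulr_gt0// ler_pM2l.
  case: ifP => _; last by rewrite mulr0 mul0r.
  by rewrite gamma_gamma_densityE// mulrC mulrAC -mulrA mulrC [c * _]mulrC.
rewrite (exp_substitution mG) gg_lawE -/c -/(h _).
have mh' : measurable_fun setT (EFin \o h) by exact/measurable_EFinP.
have sh := integralT_shift l mh'.
rewrite -[X in (_ * X)%E]/(\int[mu]_x (EFin \o h) x)%E -sh.
rewrite -ge0_integralZl_EFin; first last.
- exact: c0.
- by apply: (measurableT_comp mh'); exact: measurable_funD.
- by move=> w _; rewrite lee_fin h0.
- exact: measurableT.
apply: eq_integral => x _; have e : expR (- x) * expR x = 1 by rewrite -expRD addNr expR0.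
rewrite /G expRK -(mulrA (c * h (x + l))) e mulr1.
by rewrite EFinM.
Qed.

End gamma_gamma.

(** * The pointing-error factor *)

Section pointing.
Context (R : realType).
Local Notation mu := (@lebesgue_measure R).
Local Notation TR := (measurableTypeR R).

Lemma nneseries_EFin (f : nat -> R) : cvgn (series f) ->
  (\sum_(k <oo) (f k)%:E = (limn (series f))%:E)%E.
Proof.
move=> cf; rewrite -EFin_lim//; congr (limn _); apply/funext => n /=.
by rewrite sumEFin.
Qed.

(** Dominated by the exponential series at (x/2)^2, because k! <= (k!)^2. *)
Lemma is_cvg_besselI0 (x : R) : cvgn (series (fun k : nat => (x / 2) ^+ (2 * k) / (k`!%:R) ^+ 2)).
Proof.
have ge0 k : 0 <= (x / 2) ^+ (2 * k) by rewrite exprM exprn_ge0// sqr_ge0.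
apply: (series_le_cvg _ _ _ (is_cvg_series_exp_coeff ((x / 2) ^+ 2))) => k.
- by rewrite divr_ge0// sqr_ge0.
- by rewrite /exp_coeff/= -exprM divr_ge0.
rewrite /exp_coeff/= -exprM ler_wpM2l// lef_pV2 ?posrE ?exprn_gt0 ?ltr0n ?fact_gt0//.
by rewrite expr2 ler_peMl ?ler0n// ler1n fact_gt0.
Qed.

Lemma bin2_fact (k : nat) : 'C(2 * k, k)%:R / (2 * k)`!%:R = (k`!%:R ^+ 2)^-1 :> R.
Proof.
have h : ('C(2 * k, k) * (k`! * k`!) = (2 * k)`!)%N.
  have e : (2 * k - k = k)%N by rewrite mul2n -addnn addnK.
  by rewrite -(@bin_fact (2 * k) k) ?leq_pmull// e.
have f0 : k`!%:R != 0 :> R by rewrite pnatr_eq0 -lt0n fact_gt0.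
have b0 : 'C(2 * k, k)%:R != 0 :> R by rewrite pnatr_eq0 -lt0n bin_gt0 leq_pmull.
by rewrite -h !natrM; field; rewrite f0 b0.
Qed.

Variables (A0 omega q c v : R).
Hypotheses (A00 : 0 < A0) (omega0 : 0 < omega).
Hypothesis cE : c = (1 + q ^+ 2) * omega / (2 * q).
Hypothesis vE : v = (1 - q ^+ 2) * omega / (2 * q).

Definition bessel_coef (k : nat) : R := 'C(2 * k, k)%:R * (v / 2) ^+ (2 * k).

Lemma bessel_coef_ge0 k : 0 <= bessel_coef k.
Proof. by rewrite mulr_ge0// exprM exprn_ge0// sqr_ge0. Qed.

(* The density of -ln (hg1 / A0). *)
Definition log_pointing (u : R) : R :=
  if 0 <= u then omega * expR (- c * u) * besselI0 (v * u) else 0.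

Lemma log_pointingE (u : R) : ((log_pointing u)%:E =
  \sum_(k <oo) (omega * bessel_coef k * erlangT (2 * k) c u)%:E)%E.
Proof.
rewrite /log_pointing; case: ifPn => u0; last first.
  rewrite eseries0// => k _ _.
  by rewrite /erlangT patchE mem_setE in_itv/= andbT (negbTE u0) mulr0.
rewrite EFinM -(nneseries_EFin (@is_cvg_besselI0 (v * u))) -nneseriesZl; last first.
  by move=> k _; rewrite lee_fin divr_ge0 ?sqr_ge0// exprM exprn_ge0// sqr_ge0.
apply: eq_eseriesr => k _; rewrite -EFinM; congr EFin.
rewrite /erlangT patchE mem_setE in_itv/= andbT u0 /erlang -bin2_fact /bessel_coef.
have -> : v * u / 2 = v / 2 * u by ring.
by rewrite exprMn; ring.
Qed.

Lemma log_pointing_term_ge0 k (u : R) : 0 <= omega * bessel_coef k * erlangT (2 * k) c u.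
Proof. apply: mulr_ge0; last exact: erlangT_ge0.
by apply: mulr_ge0; [exact: ltW|exact: bessel_coef_ge0]. Qed.

Lemma log_pointing_ge0 (u : R) : 0 <= log_pointing u.
Proof. by rewrite -lee_fin log_pointingE nneseries_ge0// => k _ _; rewrite lee_fin log_pointing_term_ge0. Qed.

Lemma measurable_log_pointing_term k :
  measurable_fun setT (fun u : TR => (omega * bessel_coef k * erlangT (2 * k) c u)%:E).
Proof. by apply/measurable_EFinP; apply: measurable_funM => //; exact: measurable_erlangT. Qed.

Lemma measurable_log_pointing : measurable_fun setT (log_pointing : TR -> R).
Proof.
apply/measurable_EFinP.
rewrite (_ : EFin \o _ = (fun u => \sum_(k <oo) (omega * bessel_coef k * erlangT (2 * k) c u)%:E)%E).
  apply: ge0_emeasurable_sum => [k x _ _|k _]; last exact: measurable_log_pointing_term.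
  by rewrite lee_fin log_pointing_term_ge0.
by apply/funext => u /=; exact: log_pointingE.
Qed.

Lemma pointing_error_densityE (y : R) : 0 < y -> y <= A0 ->
  pointing_error_density A0 omega q y = log_pointing (ln A0 - ln y) * expR (- ln y).
Proof.
move=> y0 yA; rewrite /log_pointing subr_ge0 ler_ln ?posrE// yA /pointing_error_density -cE -vE.
have lE : ln (y / A0) = - (ln A0 - ln y) by rewrite ln_div ?posrE// opprB.
rewrite /powR gt_eqF ?divr_gt0// lE mulrNN.
have Ai : A0^-1 = expR (- ln A0) by rewrite expRN lnK.
rewrite Ai; set u := ln A0 - ln y; set K := besselI0 _.
have e : expR (- ln A0) * expR ((c - 1) * - u) = expR (- c * u) * expR (- ln y).
  by rewrite -!expRD; congr expR; rewrite /u; ring.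
transitivity (omega * (expR (- ln A0) * expR ((c - 1) * - u)) * K); first by ring.
by rewrite e; ring.
Qed.

Let F (y : TR) : R := if 0 < (y : R) then log_pointing (ln A0 - ln y) * expR (- ln y) else 0.

Let F0 y : 0 <= F y.
Proof. by rewrite /F; case: ifP => // _; rewrite mulr_ge0 ?log_pointing_ge0 ?expR_ge0. Qed.

Let mln : measurable_fun setT (@ln R : TR -> TR). Proof. exact: measurable_ln. Qed.

Let mF' : measurable_fun setT (fun y : TR => log_pointing (ln A0 - ln y) * expR (- ln y)).
Proof.
apply: measurable_funM.
  by apply: (measurableT_comp measurable_log_pointing); exact: measurable_funB.
by apply: measurableT_comp => //; exact: measurableT_comp.
Qed.

Let mF : measurable_fun setT F.
Proof.
rewrite (_ : F = (fun y : TR => log_pointing (ln A0 - ln y) * expR (- ln y)) \_ `]0, +oo[).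
  apply/(measurable_restrictT _ _).1; first exact: measurable_itvR.
  exact: measurable_funTS.
by apply/funext => y; rewrite patchE mem_setE in_itv/= andbT.
Qed.

Lemma pointing_expectation (m : {measure set TR -> \bar R}) (g : TR -> R) :
  (forall A, measurable A -> m A =
    \int[mu]_(x in (A `&` `]0%R, A0])%classic) (pointing_error_density A0 omega q x)%:E)%E ->
  measurable_fun setT g -> (forall y, 0 <= g y) ->
  (\int[m]_y (g y)%:E = \int[mu]_u (g (A0 * expR (- u)) * log_pointing u)%:E)%E.
Proof.
move=> hm mg g0.
have mg' : measurable_fun setT (EFin \o g) by exact/measurable_EFinP.
transitivity (\int[dens mu F0 mF]_y (g y)%:E)%E.
  apply: eq_measure_integral => A mA _; rewrite hm//= /dens.
  rewrite [LHS]integral_mkcond [RHS]integral_mkcond; apply: eq_integral => x _.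
  rewrite !patchE in_setI; case: (x \in A) => //=.
  rewrite mem_setE in_itv/= /F; have [x0|x0] := ltP 0 x => //=.
  have [xA|xA] := leP x A0; first by rewrite pointing_error_densityE.
  by rewrite /log_pointing subr_ge0 ler_ln ?posrE// leNgt xA/= mul0r.
rewrite (@ge0_integral_dens _ _ _ _ _ F0 mF (EFin \o g))//.
pose K (u : TR) : \bar R := (g (A0 * expR (- u)) * log_pointing u)%:E.
have mK : measurable_fun setT K.
  apply/measurable_EFinP; apply: measurable_funM; last exact: measurable_log_pointing.
  by apply: (measurableT_comp mg); apply: measurable_funM => //; exact: measurableT_comp.
have mK' : measurable_fun setT (fun u : TR => K (- u)).
  by apply: (measurableT_comp mK).
transitivity (\int[mu]_(x in `]0%R, +oo[) (g x * (log_pointing (ln A0 - ln x) * expR (- ln x)))%:E)%E.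
  rewrite [RHS]integral_mkcond; apply: eq_integral => x _.
  by rewrite patchE mem_setE in_itv/= andbT /F; case: ifP => _; rewrite ?mule0// -EFinM.
rewrite (exp_substitution (measurable_funM mg mF')).
(* With y = e^x already substituted, u = ln A0 - x is a reflection followed by a shift. *)
rewrite -[RHS](integralT_opp mK) -(integralT_shift (- ln A0) mK').
apply: eq_integral => x _; rewrite /K opprB opprB /= expRK.
have -> : A0 * expR (x - ln A0) = expR x by rewrite expRD expRN lnK// mulrCA divff ?mulr1// gt_eqF.
have e : expR (- x) * expR x = 1 by rewrite -expRD addNr expR0.
by rewrite -!mulrA e mulr1.
Qed.

End pointing.

(** * The law of the channel *)

Section product_law.
Context d (T : measurableType d) (R : realType) (P : probability T R).
Local Notation TR := (measurableTypeR R).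

(* [X], with the reals carrying the display used by [lebesgue_measure]. *)
Definition realRV (X : {RV P >-> R}) : T -> TR := X.

Let measurable_realRV X : measurable_fun setT (realRV X).
Proof. by move=> mD A mA; exact: (measurable_funPT X mD A mA). Qed.

HB.instance Definition _ X := isMeasurableFun.Build _ _ _ _ (realRV X) (measurable_realRV X).

Definition law (X : {RV P >-> R}) := distribution P (realRV X).

HB.instance Definition _ X := Probability.on (law X).

(** The joint law agrees with the product on rectangles, hence everywhere. [Y] comes first in the
    pair so that sections are taken with [Y] fixed. *)
Lemma independent_law (X Y : {RV P >-> R}) (B : set (TR * TR)) :
  independent_RVs X Y -> measurable B ->
  P [set w | B (Y w, X w)] = (\int[law Y]_y law X (xsection B y))%E.
Proof.
move=> ind mB.
have mXY : measurable_fun setT (fun w => (realRV Y w, realRV X w)).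
  by apply/measurable_fun_pairP; split; exact: measurable_funPT.
pose m := measure_function_pushforward__canonical__measure_function_Measure P mXY.
have /= := @product_measure_unique _ _ TR TR R (law Y) (law X) m.
move=> h; apply: esym; apply: (h _ B mB).
move=> A1 A2 mA1 mA2 /=; rewrite muleC; apply: (etrans _ (ind _ _ mA2 mA1)).
by congr (P _); apply/seteqP; split => w [].
Qed.

Lemma series_of_nneseries (t : nat -> R) (l : R) : (forall k, 0 <= t k) ->
  (\sum_(k <oo) (t k)%:E = l%:E)%E -> series t @ \oo --> l.
Proof.
move=> t0 h.
have c : (fun n => \sum_(0 <= k < n) (t k)%:E)%E @ \oo --> l%:E.
  by rewrite -h; apply: is_cvg_nneseries => k _ _; rewrite lee_fin.
rewrite (_ : series t = fine \o (fun n => \sum_(0 <= k < n) (t k)%:E)%E); first exact: fine_cvg c.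
by apply/funext => n /=; rewrite sumEFin.
Qed.
End product_law.

(** * The outage event in terms of the channel coefficient *)

Section outage.
Context (R : realType).

(** Clearing positive denominators leaves a condition on h^2. The absolute value makes the
    equivalence hold for every real h, whereas the channel is nonnegative only almost surely. *)
Lemma sinr1_lt_gth (a1 a2 B1 snr gth h : R) : 0 < a2 -> 0 < B1 -> 0 < snr -> gth < a1 / a2 -> 0 < gth ->
  (sinr1 a1 a2 B1 snr h < gth) =
  (`|h| < Num.sqrt (gth / (a1 * B1 * snr - a2 * B1 * snr * gth))).
Proof.
move=> a20 B0 s0 ga g0; rewrite /sinr1.
have K0 : 0 < B1 * snr by rewrite mulr_gt0.
have D0 : 0 < a1 * B1 * snr - a2 * B1 * snr * gth.
  have -> : a1 * B1 * snr - a2 * B1 * snr * gth = (a1 - gth * a2) * (B1 * snr) by ring.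
  by rewrite mulr_gt0// subr_gt0 -ltr_pdivlMr.
have den0 : 0 < a2 * B1 * snr * h ^+ 2 + 1.
  by rewrite ltr_wpDl// mulr_ge0 ?sqr_ge0// !mulr_ge0// ltW.
rewrite -sqrtr_sqr ltr_sqrt ?divr_gt0// ltr_pdivrMr// ltr_pdivlMr//.
rewrite -subr_gt0 -[RHS]subr_gt0; congr (_ < _); ring.
Qed.

(** Interference caps the ratio at [a1 / a2], so outage is certain once the threshold reaches this
    cap. *)
Lemma sinr1_lt (a1 a2 B1 snr h : R) : 0 < a2 -> 0 < a1 -> 0 < B1 -> 0 < snr ->
  sinr1 a1 a2 B1 snr h < a1 / a2.
Proof.
move=> a20 a10 B0 s0; rewrite /sinr1.
have den0 : 0 < a2 * B1 * snr * h ^+ 2 + 1.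
  by rewrite ltr_wpDl// mulr_ge0 ?sqr_ge0// !mulr_ge0// ltW.
rewrite ltr_pdivrMr//.
have -> : a1 / a2 * (a2 * B1 * snr * h ^+ 2 + 1) = a1 * B1 * snr * h ^+ 2 + a1 / a2.
  by field; rewrite gt_eqF.
by rewrite ltrDl divr_gt0.
Qed.

End outage.

(** * The distribution function of the channel *)

Section channel_law.
Context d (T : measurableType d) (R : realType) (P : probability T R).
Local Notation mu := (@lebesgue_measure R).
Local Notation TR := (measurableTypeR R).
Variables (hl1 alpha beta A0 omega q c v : R).
Hypotheses (hl0 : 0 < hl1) (alpha0 : 0 < alpha) (beta0 : 0 < beta)
  (A00 : 0 < A0) (omega0 : 0 < omega) (q0 : 0 < q)
  (cE : c = (1 + q ^+ 2) * omega / (2 * q))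
  (vE : v = (1 - q ^+ 2) * omega / (2 * q)).
Variables hs hg1 h1 : {RV P >-> R}.
Hypotheses (hs_density : has_density_on hs `]0, +oo[ (gamma_gamma_density alpha beta))
  (hg1_density : has_density_on hg1 `]0, A0] (pointing_error_density A0 omega q))
  (h_indep : independent_RVs hs hg1)
  (hh1 : forall w, h1 w = hl1 * hs w * hg1 w).

Let c0 : 0 < c.
Proof. by rewrite cE divr_gt0 ?mulr_gt0// addr_gt0// exprn_gt0. Qed.

(** Conditioning on [hg1], written as A0 e^(-u). *)
Lemma channel_law (A : set TR) : measurable A ->
  law h1 A =
  (\int[mu]_u (fine (law hs [set s | A (hl1 * s * (A0 * expR (- u)))%R])
    * log_pointing omega c v u)%:E)%E.
Proof.
move=> mA.
pose B : set (TR * TR) := [set p | A (hl1 * p.2 * p.1)].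
have mB : measurable B.
  have mf : measurable_fun setT (fun p : TR * TR => hl1 * p.2 * p.1 : TR).
    by apply: measurable_funM => //; exact: measurable_funM.
  by rewrite -[X in measurable X]setTI; exact: mf.
pose g (y : TR) : R := fine (law hs (xsection B y)).
have gE y : (g y)%:E = law hs (xsection B y).
  by rewrite fineK// fin_num_measure//; exact: measurable_xsection.
have mg : measurable_fun setT g.
  apply/measurable_EFinP; rewrite (_ : EFin \o g = (law hs \o xsection B)).
    exact: measurable_fun_xsection.
  by apply/funext => y /=; exact: gE.
have g0 y : 0 <= g y by rewrite -lee_fin gE.
transitivity (\int[law hg1]_y (g y)%:E)%E.
  transitivity (P [set w | B (hg1 w, hs w)]).
    by congr (P _); apply/seteqP; split => w /=; rewrite /B/= hh1.
  by rewrite (independent_law h_indep mB); apply: eq_integral => y _; rewrite gE.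
rewrite (pointing_expectation A00 omega0 cE vE (m := law hg1) hg1_density mg g0).
apply: eq_integral => u _; congr ((fine _ * _)%:E); congr (law hs _).
by apply/seteqP; split => s /=; rewrite /xsection/= in_setE.
Qed.

Let fine_gamma_gamma_law (A : set TR) : measurable A ->
  (fine (law hs A))%:E =
  (\int[mu]_(x in (A `&` `]0%R, +oo[)%classic) (gamma_gamma_density alpha beta x)%:E)%E.
Proof. by move=> mA; rewrite fineK ?fin_num_measure//; exact: hs_density. Qed.

Lemma channel_law_null (A : set TR) : measurable A ->
  (forall u : R, (\int[mu]_(x in ([set s | A (hl1 * s * (A0 * expR (- u)))%R] `&` `]0%R, +oo[)%classic)
     (gamma_gamma_density alpha beta x)%:E = 0)%E) ->
  law h1 A = 0%E.
Proof.
move=> mA h; rewrite channel_law//; apply: integral0_eq => u _.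
have mA' : measurable [set s : TR | A (hl1 * s * (A0 * expR (- u)))].
  have mf : measurable_fun setT (fun s : TR => hl1 * s * (A0 * expR (- u)) : TR).
    by apply: measurable_funM => //; exact: measurable_funM.
  by rewrite -[X in measurable X]setTI; exact: mf.
by rewrite EFinM fine_gamma_gamma_law// h mul0e.
Qed.

Let gain (u : R) : 0 < hl1 * (A0 * expR (- u)).
Proof. by rewrite !mulr_gt0// expR_gt0. Qed.

(** For fixed [hg1] a single value of [hs] produces r, and [hs] has a density. *)
Lemma channel_atomless (r : R) : law h1 [set r] = 0%E.
Proof.
apply: channel_law_null => // u.
apply: (integral_Sset1 (r / (hl1 * (A0 * expR (- u))))) => x [/= <- _].
have -> : hl1 * x * (A0 * expR (- u)) = x * (hl1 * (A0 * expR (- u))) by ring.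
by rewrite mulfK// gt_eqF.
Qed.

Lemma channel_ge0 : law h1 `]-oo, 0[ = 0%E.
Proof.
apply: channel_law_null => // u.
rewrite (_ : _ `&` _ = set0) ?integral_set0//.
apply/seteqP; split => // x [] /=; rewrite !in_itv/= andbT mulrAC => + x0.
by rewrite ltNge (ltW (mulr_gt0 _ x0)).
Qed.

(** The two events differ at most within the null event [N], where h1 equals r or is negative. *)
Lemma outage_cdf (r : R) : 0 < r -> P [set w | `|h1 w| < r] = cdf h1 r.
Proof.
move=> r0; pose N := h1 @^-1` [set r] `|` h1 @^-1` `]-oo, 0[.
have mp (A : set TR) : measurable A -> measurable (h1 @^-1` A).
  by move=> mA; rewrite -[X in measurable X]setTI; exact: (measurable_funPT h1).
have mN : measurable N by apply: measurableU; apply: mp.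
have N0 : P N = 0%E.
  apply/eqP; rewrite eq_le measure_ge0 andbT.
  apply: (le_trans (measureU2 _ _ _)); [exact: mp|exact: mp|].
  rewrite -[X in (X <= _)%E]/(law h1 [set r] + law h1 `]-oo, 0%R[%classic)%E.
  by rewrite channel_atomless channel_ge0 adde0.
have mS : measurable [set w | `|h1 w| < r].
  rewrite (_ : [set w | _] = h1 @^-1` `](- r), r[); first exact: mp.
  by apply/seteqP; split => w /=; rewrite in_itv/= ltr_norml.
rewrite -[cdf h1 r]/(P (h1 @^-1` `]-oo, r])) -(measureU0 mS mN N0).
rewrite -[RHS](measureU0 _ mN N0); last exact: mp.
congr (P _); apply/seteqP; split => w [|wN]; try by right.
- by move=> /= /ltr_normlW /ltW hr; left; rewrite /= in_itv.
move=> /=; rewrite in_itv/= le_eqVlt => /orP[/eqP hr|hr]; first by right; left.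
have [h0|h0] := ltP (h1 w) 0; first by right; right; rewrite /= in_itv.
by left; rewrite /= ger0_norm.
Qed.

Let GG := Gamma alpha * Gamma beta.

Let GG0 : 0 < GG. Proof. by rewrite mulr_gt0// Gamma_gt0. Qed.

Variable x : R.
Hypothesis x0 : 0 < x.
Let z := alpha * beta * x / (A0 * hl1).
Let gg k : R := fine (gg_erlang alpha beta c (2 * k) z).

Let z0 : 0 < z. Proof. by rewrite divr_gt0 ?mulr_gt0. Qed.

Let ggK k : (gg k)%:E = gg_erlang alpha beta c (2 * k) z.
Proof. by rewrite fineK//; exact: gg_erlang_fin. Qed.

Let gg_law_pos u : (0 <= gg_law alpha beta u)%E.
Proof. exact: gg_law_ge0. Qed.

Lemma gg_erlang_ge0 k : (0 <= gg_erlang alpha beta c (2 * k) z)%E.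
Proof. by apply: integral_ge0 => u _; rewrite mule_ge0// lee_fin erlangT_ge0. Qed.

Let a (u : R) : R := fine (law hs [set s | `]-oo, x]%classic (hl1 * s * (A0 * expR (- u)))]).

Let aE (u : R) : (a u)%:E = ((GG^-1)%:E * gg_law alpha beta (u + ln z)%R)%E.
Proof.
(* The threshold on [hs] when [hg1] is A0 e^(-u); it satisfies alpha beta y = z e^u, whence the
   argument u + ln z. *)
pose y := x / (hl1 * (A0 * expR (- u))).
have y0 : 0 < y by rewrite divr_gt0.
have -> : a u = fine (law hs `]-oo, y]).
  congr (fine (law hs _)); apply/seteqP; split => s /=; rewrite !in_itv/= ler_pdivlMr//.
    by move=> h; apply: le_trans h; rewrite le_eqVlt; apply/orP; left; apply/eqP; ring.
  by move=> h; apply: le_trans h; rewrite le_eqVlt; apply/orP; left; apply/eqP; ring.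
rewrite fine_gamma_gamma_law//.
have e : ln (alpha * beta * y) = u + ln z.
  have -> : alpha * beta * y = z * expR u.
    by rewrite /y /z expRN; field; rewrite !gt_eqF// expR_gt0.
  by rewrite lnM ?posrE ?expR_gt0// expRK addrC.
by rewrite (integral_gamma_gamma_density alpha0 beta0 y0) -/GG e.
Qed.

(** [measurable_gg_law] goes through a tilt; half the smaller parameter is an admissible one. *)
Lemma measurable_gg_law_ln : measurable_fun setT (fun u : TR => gg_law alpha beta (u + ln z)%R).
Proof.
pose m := Num.min alpha beta.
have m0 : 0 < m by rewrite lt_min alpha0.
have : m / 2 < m by rewrite ltr_pdivrMr// ltr_pMr// ltr1n.
rewrite lt_min -subr_gt0 -[X in _ && X]subr_gt0 => /andP[ma mb].
apply: (measurableT_comp (measurable_gg_law ma mb)).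
exact: measurable_funD.
Qed.

(** All terms are nonnegative, so the series of Erlang laws can be integrated term by term. *)
Lemma channel_cdf : cdf h1 x =
  (\sum_(k <oo) (omega / GG * (bessel_coef v k * gg k))%:E)%E.
Proof.
rewrite -[cdf h1 x]/(law h1 `]-oo, x]%classic) channel_law; last exact: measurable_itvR.
pose f (k : nat) (u : TR) : \bar R :=
  ((omega / GG * bessel_coef v k)%:E * ((erlangT (2 * k) c u)%:E * gg_law alpha beta (u + ln z)%R))%E.
have k0 k : 0 <= omega / GG * bessel_coef v k.
  by rewrite mulr_ge0 ?bessel_coef_ge0// divr_ge0// ltW.
have h0 k u : (0 <= (erlangT (2 * k) c u)%:E * gg_law alpha beta (u + ln z)%R)%E.
  by rewrite mule_ge0// lee_fin erlangT_ge0.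
have mh k : measurable_fun setT (fun u : TR => (erlangT (2 * k) c u)%:E * gg_law alpha beta (u + ln z)%R)%E.
  apply: emeasurable_funM; last exact: measurable_gg_law_ln.
  by apply/measurable_EFinP; exact: measurable_erlangT.
transitivity (\int[mu]_u (\sum_(k <oo) f k u))%E.
  apply: eq_integral => u _; rewrite -/(a u) EFinM (log_pointingE omega c v u) -nneseriesZl; last first.
    by move=> k _; rewrite lee_fin log_pointing_term_ge0.
  apply: eq_eseriesr => k _; rewrite aE /f muleAC muleA -!EFinM.
  by congr (_%:E * _)%E; rewrite !mulrA; congr (_ * _); ring.
rewrite integral_nneseries//; first last.
- by move=> k u _; rewrite /f mule_ge0// lee_fin.
- by move=> k; apply: emeasurable_funM.
apply: eq_eseriesr => k _; rewrite /f ge0_integralZl_EFin//.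
by rewrite -/(gg_erlang alpha beta c (2 * k) z) -ggK -EFinM mulrA.
Qed.

End channel_law.

(** * Real series in the complex numbers and positivity of the turbulence parameters *)

Section complex_series.
Context (R : realType).

Lemma cvg_complex_series (t : nat -> R) (l : R) : series t @ \oo --> l ->
  (series (fun k => (t k)%:C : (R[i])^o)) @ \oo --> (l%:C : (R[i])^o).
Proof.
(* A positive complex tolerance has imaginary part 0 and positive real part. *)
move=> h; apply/cvgrPdist_lt => -[e i]; rewrite ltcE/= => /andP[/eqP i0 e0].
have /cvgrPdist_lt/(_ e e0) := h; apply: filterS => n.
have -> : series (fun k => (t k)%:C : (R[i])^o) n = (series t n)%:C.
  by rewrite /series/= rmorph_sum.
by rewrite -rmorphB/= normc_def/= expr0n/= addr0 sqrtr_sqr ltcE/= i0 eqxx.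
Qed.

Lemma gg_alpha_gt0 (sigma : R) : 0 < sigma -> 0 < gg_alpha sigma.
Proof.
move=> s0; rewrite invr_gt0 subr_gt0 expR_gt1 divr_gt0 ?mulr_gt0 ?exprn_gt0//.
by rewrite powR_gt0// ltr_pwDl// mulr_ge0// powR_ge0.
Qed.

Lemma gg_beta_gt0 (sigma : R) : 0 < sigma -> 0 < gg_beta sigma.
Proof.
move=> s0; rewrite invr_gt0 subr_gt0 expR_gt1 divr_gt0 ?mulr_gt0 ?exprn_gt0//.
by rewrite powR_gt0// ltr_pwDl// mulr_ge0// powR_ge0.
Qed.

End complex_series.

Theorem proposition1
  (R : realType) (d : measure_display) (T : measurableType d)
  (P : probability T R)
  (a1 a2 B1 snr R1 gth : R)
  (ha2 : 0 < a2) (ha12 : a2 < a1) (ha : a1 + a2 = 1)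
  (hB1 : 0 < B1) (hsnr : 0 < snr) (hR1 : 0 < R1)
  (hgth : gth = 2 `^ R1 - 1)
  (hl1 sigma alpha beta A0 omega q c v : R)
  (hl1_gt0 : 0 < hl1)
  (hsigma : 0 < sigma)
  (halpha : alpha = gg_alpha sigma) (hbeta : beta = gg_beta sigma)
  (hA0 : 0 < A0) (homega : 0 < omega) (hq : 0 < q)
  (hc : c = (1 + q ^+ 2) * omega / (2 * q))
  (hv : v = (1 - q ^+ 2) * omega / (2 * q))
  (hs hg1 h1 : {RV P >-> R})
  (hs_density : has_density_on hs `]0, +oo[ (gamma_gamma_density alpha beta))
  (hg1_density :
     has_density_on hg1 `]0, A0] (pointing_error_density A0 omega q))
  (h_indep : independent_RVs hs hg1)
  (hh1 : forall w, h1 w = hl1 * hs w * hg1 w) :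
  P [set w | sinr1 a1 a2 B1 snr (h1 w) < gth]
  = (if gth < a1 / a2
     then cdf h1 (Num.sqrt (gth / (a1 * B1 * snr - a2 * B1 * snr * gth)))
     else 1%E)
  /\
  (forall x : R, 0 < x ->
     let G (k : nat) : seq R[i] * seq R[i] :=
       (1 :: nseq (2 * k + 1) (c + 1)%:C,
        alpha%:C :: beta%:C :: nseq (2 * k + 1) c%:C ++ [:: 0]) in
     let z := alpha * beta * x / (A0 * hl1) in
     let term (k : nat) : R[i] :=
       'C(2 * k, k)%:R * ((v / 2) ^+ (2 * k))%:C
       * meijerG (2 * k + 3) 1 (G k).1 (G k).2 z in
     [/\ forall k, meijerG_wd (2 * k + 3) 1 (G k).1 (G k).2 z,
         cvgn (series (term : nat -> (R[i])^o)) &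
         (fine (cdf h1 x))%:C
         = (omega / (Gamma alpha * Gamma beta))%:C
           * limn (series (term : nat -> (R[i])^o)) ]).

Proof.
have alpha0 : 0 < alpha by rewrite halpha gg_alpha_gt0.
have beta0 : 0 < beta by rewrite hbeta gg_beta_gt0.
have c0 : 0 < c by rewrite hc divr_gt0 ?mulr_gt0// addr_gt0// exprn_gt0.
have gth0 : 0 < gth.
  by rewrite hgth subr_gt0 /powR gt_eqF// expR_gt1 mulr_gt0// ln_gt0// ltr1n.
split.
  case: ifPn => [gth_lt|]; last first.
    rewrite -leNgt => ath; rewrite -(@probability_setT _ _ _ P); congr (P _).
    apply/seteqP; split => // w _ /=; apply: lt_le_trans ath.
    by rewrite sinr1_lt// (lt_trans ha2).
  rewrite -(outage_cdf hl1_gt0 hA0 homega hc hv hs_density hg1_density h_indep hh1).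
    by congr (P _); apply/seteqP; split => w /=; rewrite sinr1_lt_gth.
  rewrite sqrtr_gt0 divr_gt0//.
  have -> : a1 * B1 * snr - a2 * B1 * snr * gth = (a1 - gth * a2) * (B1 * snr) by ring.
  by rewrite !mulr_gt0// subr_gt0 -ltr_pdivlMr.
move=> x x0 G z term.
have z0 : 0 < z by rewrite divr_gt0 ?mulr_gt0.
pose t k := bessel_coef v k * fine (gg_erlang alpha beta c (2 * k) z).
have termE : term = (fun k => (t k)%:C).
  apply/funext => k; rewrite /term meijerG_erlang// /t !rmorphM/=.
  by rewrite rmorph_nat.
pose K := omega / (Gamma alpha * Gamma beta).
have K0 : 0 < K by rewrite divr_gt0 ?mulr_gt0 ?Gamma_gt0.
have t0 k : 0 <= t k.
  by rewrite mulr_ge0 ?bessel_coef_ge0// fine_ge0// gg_erlang_ge0.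
(* The nonnegative series with the factor [K] has the finite sum F(x), which gives convergence; [K]
   is divided out afterwards. *)
have cvgKt : series (fun k => K * t k) @ \oo --> fine (cdf h1 x).
  apply: series_of_nneseries => [k|]; first by rewrite mulr_ge0// ltW.
  rewrite fineK; last by rewrite /cdf fin_num_measure.
  apply: esym; exact: (channel_cdf hl1_gt0 alpha0 beta0 hA0 homega hq hc hv hs_density hg1_density h_indep hh1 x0).
have cvgt : series t @ \oo --> K^-1 * fine (cdf h1 x).
  have -> : series t = (fun n => K^-1 * series (fun k => K * t k) n).
    by apply/funext => n; rewrite /series/= -mulr_sumr mulKf// gt_eqF.
  by apply: cvgM => //; exact: cvg_cst.
have cvgC := cvg_complex_series cvgt.
split.
- by move=> k; exact: meijerG_erlang_wd.
- by rewrite termE; apply/cvg_ex; eexists; exact: cvgC.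
- rewrite termE (cvg_lim _ cvgC)//.
  by rewrite -rmorphM/= -/K mulrA mulfV ?gt_eqF// mul1r.
Qed.
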